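(* Let $k$ and $a$ be real constants. Suppose that $X_t$ satisfies the free stochastic differential equation $$dX_t=kX_t(dW_t)X_t,$$ where $W_t$ is the free Brownian motion, and let the initial condition be $X_0=aI$. Then the spectral distribution of $X_t$ is defined for all $t\le (ak)^{-2}$ and it is supported on the interval $$I=\Big[a\,\frac{(1-ak\sqrt t)^2}{(1-a^2k^2t)^2},\ a\,\frac{(1+ak\sqrt t)^2}{(1-a^2k^2t)^2}\Big].$$ For $\tau\in(0,1)$, the density of the spectral distribution of the operator $a^{-1}X_{(ak)^{-2}\tau}$ is given by the formula $$f(\xi)=\frac{\sqrt{-(1-\tau)^2\xi^2+2(1+\tau)\xi-1}}{2\pi\xi^3\tau}.$$
   Context: All operators belong to a $W^*$-probability space $(\mathcal{A},E)$: a von Neumann algebra $\mathcal{A}$ with a faithful normal trace $E$ (the expectation); $I$ in $X_0=aI$ is the identity operator. Freeness is in the sense of Voiculescu. The spectral distribution of a self-adjoint $X\in\mathcal{A}$ is the probability measure $\mu$ on $\mathbb{R}$ with $E(X^n)=\int x^n\mu(dx)$ for all $n$. Free Brownian motion (Wigner process): a family of operators $W_t$, $t\ge0$, with $W_0=0$, such that for $t>s$ the increment $W_t-W_s$ is free from the subalgebra $\mathcal{W}_s$ generated by all $W_\tau$, $\tau\le s$, and has the semicircle distribution with expectation $0$ and variance $t-s$. Free stochastic integral: if $u_t,v_t\in\mathcal{W}_t$ are bounded in norm and $t\mapsto u_t$, $t\mapsto v_t$ are norm-continuous, then $\int_0^T u_t(dW_t)v_t$ is the operator-norm limit of the sums $\sum_i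 u_{\tau_i}(W_{t_i}-W_{t_{i-1}})v_{\tau_i}$, where $0=t_0\le\dots\le t_n=T$ and $0\le\tau_i\le t_{i-1}$, as $\max_i(t_i-\tau_i)\to0$. The differential equation is shorthand for $X_t=X_0+k\int_0^t X_\tau(dW_\tau)X_\tau$.
   Formalization: The endpoints of I are taken in increasing order, since for k<0 the displayed order is reversed; existence of X_t is claimed only for t<(ak)^{-2}, since at t=(ak)^{-2} the solution blows up and I has zero denominators; the density formula is stated for ak≠0. *)

(* Defs.v *)
From HB Require Import structures.
From mathcomp Require Import all_boot all_order all_algebra.
From mathcomp Require Import all_classical all_reals all_analysis.
From mathcomp Require Import complex.

Set Implicit Arguments.
Unset Strict Implicit.
Unset Printing Implicit Defensive.

Import Order.TTheory GRing.Theory Num.Theory.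
Import numFieldNormedType.Exports.

Local Open Scope classical_set_scope.
Local Open Scope ring_scope.
Local Open Scope complex_scope.

Record hilbert (R : realType) := Hilbert {
  hilbert_sort :> completeNormedModType R[i];
  hdot : {dot hilbert_sort for (@Num.conj R[i])};
  hdotE : forall x : hilbert_sort, `|x| ^+ 2 = hdot x x
}.

(* Operators are bare functions [H -> H]; addition and scaling are the pointwise
   ones, the product is [\o], the identity is [idfun]. *)
Notation op H := (hilbert_sort H -> hilbert_sort H).

Section operators.
Context {R : realType} {H : hilbert R}.
Implicit Types (S T : op H) (A : set (op H)).

Definition opnorm_le T (M : R) := forall x, `|T x| <= M%:C * `|x|.

Definition bounded_op T := linear T /\ exists M : R, opnorm_le T M.

Definition adjoint_of T S := forall x y, hdot H (T x) y = hdot H x (S y).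

Definition self_adjoint T := adjoint_of T T.

(* The order on [R[i]] makes [0 <= z] say that [z] is real and nonnegative. *)
Definition op_le T S := forall x, 0 <= hdot H ((S - T) x) x.

Definition commutant A : set (op H) :=
  [set T | bounded_op T /\ forall S, A S -> T \o S = S \o T].

Definition von_neumann_algebra A :=
  [/\ A `<=` bounded_op,
      forall T, A T -> exists2 S, A S & adjoint_of T S
    & commutant (commutant A) = A].

Definition vN_generated A : set (op H) :=
  [set T | forall B, von_neumann_algebra B -> A `<=` B -> B T].

Definition op_sup A (D : set (op H)) S :=
  [/\ A S, self_adjoint S, forall T, D T -> op_le T S
    & forall U, A U -> self_adjoint U -> (forall T, D T -> op_le T U) ->
        op_le S U].

Definition directed (D : set (op H)) :=
  D !=set0 /\
  forall S T, D S -> D T -> exists U, [/\ D U, op_le S U & op_le T U].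

Definition faithful_normal_trace A (E : op H -> R[i]) :=
  [/\ (forall (c : R[i]) S T, A S -> A T -> E (c *: S + T) = c * E S + E T)
        /\ E idfun = 1,
      forall T S, A T -> adjoint_of T S -> 0 <= E (S \o T),
      forall T S, A T -> adjoint_of T S -> E (S \o T) = 0 -> T = 0,
      forall S T, A S -> A T -> E (S \o T) = E (T \o S)
    & forall (D : set (op H)) S,
        D `<=` A -> (forall T, D T -> self_adjoint T) -> directed D ->
        op_sup A D S ->
        forall c : R[i], (forall T, D T -> E T <= c) -> E S <= c].

End operators.

Record wprob_space (R : realType) := WProbSpace {
  wp_hilbert :> hilbert R;
  wp_alg : set (op wp_hilbert);
  wp_expect : op wp_hilbert -> R[i];
  wp_algP : von_neumann_algebra wp_alg;
  wp_expectP : faithful_normal_trace wp_alg wp_expect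
}.

Section free_probability.
Context {R : realType} {A : wprob_space R}.
Local Notation E := (@wp_expect R A).
Local Notation lebesgue := (@lebesgue_measure R).
Implicit Types (X : op A) (mu : probability (measurableTypeR R) R).

Definition spectral_distribution X mu :=
  [/\ wp_alg X, self_adjoint X
    & forall n : nat,
        mu.-integrable setT (fun x : R => (x ^+ n)%:E) /\
        E (iter n X) = (\int[mu]_(x in setT) (x ^+ n))%:C].

(* The spectral distribution of [X] is defined and satisfies [P]. *)
Definition spectral_law X (P : probability (measurableTypeR R) R -> Prop) :=
  (exists mu, spectral_distribution X mu) /\
  (forall mu, spectral_distribution X mu -> P mu).

Definition has_density (f : R -> R) mu :=
  forall B : set (measurableTypeR R), measurable B ->
    mu B = (\int[lebesgue]_(x in B) (f x)%:E)%E.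

(* [Num.sqrt] vanishes on negative arguments, so no cut-off to the support
   [[-2 sqrt v, 2 sqrt v]] is needed. *)
Definition semicircle_density (v : R) (x : R) : R :=
  Num.sqrt (4 * v - x ^+ 2) / (2 * pi * v).

(* Every von Neumann algebra contains [idfun], so the subalgebras are unital as
   Voiculescu's definition requires. *)
Definition free (I : Type) (B : I -> set (op A)) :=
  forall (n : nat) (i : nat -> I) (X : nat -> op A),
    (forall j, (j <= n)%N -> B (i j) (X j) /\ E (X j) = 0) ->
    (forall j, (j < n)%N -> i j <> i j.+1) ->
    E (\big[(fun S T : op A => S \o T)/idfun]_(j < n.+1) X j) = 0.

Definition filtration (W : R -> op A) (s : R) : set (op A) :=
  vN_generated [set W r | r in [set r | 0 <= r <= s]].

Definition free_brownian_motion (W : R -> op A) :=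
  [/\ forall t, 0 <= t -> wp_alg (W t),
      W 0 = 0
    & forall s t, 0 <= s -> s < t ->
        free (fun b : bool =>
                if b then vN_generated [set W t - W s] else filtration W s) /\
        spectral_law (W t - W s) (has_density (semicircle_density (t - s)))].

(* [r i] is the evaluation point attached to the interval [[t i, t i.+1]]; it
   must lie at or before the left endpoint, and need not be in the interval. *)
Definition is_free_integral (W u v : R -> op A) (T : R) (J : op A) :=
  forall e : R, 0 < e -> exists2 d : R, 0 < d &
    forall (n : nat) (t r : nat -> R),
      t 0%N = 0 -> t n = T ->
      (forall i, (i < n)%N ->
         [/\ t i <= t i.+1, 0 <= r i <= t i & t i.+1 - r i < d]) ->
      opnorm_le
        (\sum_(i < n) (u (r i) \o (W (t i.+1) - W (t i)) \o v (r i)) - J) e.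

Definition norm_continuous (X : R -> op A) (T : R) :=
  forall t, 0 <= t <= T -> forall e : R, 0 < e -> exists2 d : R, 0 < d &
    forall s, 0 <= s <= T -> `|s - t| < d -> opnorm_le (X s - X t) e.

(* [dX_t = k X_t (dW_t) X_t] on [[0, T]] with [X_0 = a I].  Adaptedness and
   continuity are what gives the stochastic integral a meaning. *)
Definition solves_sde (W : R -> op A) (k a : R) (T : R) (X : R -> op A) :=
  [/\ X 0 = a%:C *: (idfun : op A),
      forall t, 0 <= t <= T -> filtration W t (X t),
      norm_continuous X T
    & forall t, 0 <= t <= T -> exists2 J : op A,
        is_free_integral W X X t J & X t = X 0 + k%:C *: J].

End free_probability.

Section formulas.
Context {R : realType}.
Implicit Types a k t tau xi : R.

Definition endpoint_minus a k t : R :=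
  a * ((1 - a * k * Num.sqrt t) ^+ 2 / (1 - a ^+ 2 * k ^+ 2 * t) ^+ 2).

Definition endpoint_plus a k t : R :=
  a * ((1 + a * k * Num.sqrt t) ^+ 2 / (1 - a ^+ 2 * k ^+ 2 * t) ^+ 2).

(* [endpoint_plus <= endpoint_minus] when [k < 0], whence the min and max. *)
Definition spectral_interval a k t : set (measurableTypeR R) :=
  [set x | Num.min (endpoint_minus a k t) (endpoint_plus a k t) <= x
           <= Num.max (endpoint_minus a k t) (endpoint_plus a k t)].

(* The radicand is nonpositive exactly off the open support, where [Num.sqrt]
   gives 0; this also covers [xi = 0]. *)
Definition spectral_density tau xi : R :=
  Num.sqrt (- (1 - tau) ^+ 2 * xi ^+ 2 + 2 * (1 + tau) * xi - 1)
  / (2 * pi * xi ^+ 3 * tau).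

End formulas.

(* Main.v *)
(** Dividing by [a] and putting [b = a k], the solution is the resolvent
    [Y_t = (1 + b^2 t - b W_t)^-1].  An increment [S = W_t - W_s] is free from the
    past, so in L2 it acts on the past as [l + l*], with [l] the creation operator of
    Fock space.  Subordination uses this to write the denominator at time [t], up to
    an invertible conjugation, as its value at time [s] plus a square: this keeps it
    positive as long as [b^2 t < 1] and gives [tr Y_t = 1] and lower and upper bounds
    on the L2 norm of [Y_t].  Hence [Y_t - Y_s - b Y_s S Y_s] is orthogonal to the past
    and of second order, so the Riemann sums converge in L2; a bound on free
    martingales, obtained from the same recursion, turns this into convergence in
    operator norm.

    Two solutions agree because the free Ito isometry makes the integral a contraction
    for the L2 norm weighted by [exp (- l t)].  The L2 norm of [Y_t] blows up at
    [b^2 t = 1], so no solution reaches that time.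

    The law of [X_t] is the image of the semicircle law of variance [t] under
    [u |-> a / (1 + b^2 t - b u)]; a law with compact support is determined by its
    moments, and the density follows by the change of variables
    [u = (1 + b^2 t - 1/xi) / b]. *)

Require Import Defs.
From HB Require Import structures.
From mathcomp Require Import all_boot all_order all_algebra.
From mathcomp Require Import all_classical all_reals all_analysis.
From mathcomp Require Import measurable_realfun complex ring lra.

Set Implicit Arguments.
Unset Strict Implicit.
Unset Printing Implicit Defensive.

Import Order.TTheory GRing.Theory Num.Theory.
Import numFieldNormedType.Exports.

Local Open Scope classical_set_scope.
Local Open Scope ring_scope.
Local Open Scope complex_scope.

(** * Operators in a W*-probability space *)

(** The obstacle is that convergence is wanted in operator norm, while freeness only speaks about
    traces. The bridge is the order: for self-adjoint [x], the two relations [-r <= x <= r] bound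
    the norm, and positivity can be tested with the trace on a subspace that is not complete, so it
    also survives L2 limits. The norm bounds on increments and on martingales are therefore obtained
    by keeping some denominator positive. Let [h] be a denominator with inverse [G] in the past, [c]
    a coefficient and [V y = G c l*(c y)]. The next denominator [K] is [h] conjugated by [1 - V].
    Annihilation kills the past, so the adjoint of [V] kills 1, and the inverse of [K] applied to 1
    is the orthogonal series [G + V G + V^2 G + ...]: the first term gives the trace, the second is
    the Ito term, and the tail is the second-order error. The summand [b^2 t] of the resolvent is
    the compensator [d tr(c G c) c^2] accumulated over time; it does not depend on the history
    because the trace of [G] is always 1. *)

Section hilbert_norm.
Context {R : realType} {H : hilbert R}.
Implicit Types (x y z : H) (T S : op H).

(** Norms take values in [R[i]]; the real part is taken once here, so that estimates become
    inequalities in the ordered field [R], within reach of [lra] and [nra]. *)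
Definition hnm (x : H) : R := complex.Re `|x|.
Definition rdot (x y : H) : R := complex.Re (hdot H x y).

Lemma Re_norm_ge0 (c : R[i]) : 0 <= complex.Re `|c|.
Proof. by rewrite -lecR RRe_real; [exact: normr_ge0|exact: ger0_real (normr_ge0 c)]. Qed.

Lemma hnmE x : `|x| = (hnm x)%:C.
Proof. by rewrite /hnm RRe_real; [|exact: ger0_real (normr_ge0 x)]. Qed.

Lemma hnm_ge0 x : 0 <= hnm x.
Proof. by rewrite -lecR -hnmE; exact: normr_ge0. Qed.

Lemma hnmD x y : hnm (x + y) <= hnm x + hnm y.
Proof. by rewrite -lecR rmorphD /= -!hnmE; exact: ler_normD. Qed.

Lemma hnmN x : hnm (- x) = hnm x.
Proof. by rewrite /hnm normrN. Qed.

Lemma hnm0 : hnm 0 = 0.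
Proof. by rewrite /hnm normr0. Qed.

Lemma hnm0_eq x : hnm x = 0 -> x = 0.
Proof. by move=> h; apply/eqP; rewrite -normr_eq0 hnmE h. Qed.

Lemma hnmZ (c : R[i]) x : hnm (c *: x) = complex.Re `|c| * hnm x.
Proof.
rewrite /hnm normrZ (hnmE x) -(RRe_real (ger0_real (normr_ge0 c))).
by rewrite -rmorphM.
Qed.

Lemma hdot_sqr x : hdot H x x = (hnm x ^+ 2)%:C.
Proof. by rewrite -hdotE hnmE rmorphXn. Qed.

Lemma rdot_sqr x : rdot x x = hnm x ^+ 2.
Proof. by rewrite /rdot hdot_sqr. Qed.

Lemma hdotC x y : hdot H x y = (hdot H y x)^*%C.
Proof.
by rewrite (hermC (hdot H) x y) expr0 mul1r.
Qed.

Lemma rdotC x y : rdot x y = rdot y x.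
Proof. by rewrite /rdot hdotC; case: (hdot H y x). Qed.

Lemma rdotDl x y z : rdot (x + y) z = rdot x z + rdot y z.
Proof. by rewrite /rdot linearDl raddfD. Qed.

Lemma rdotBl x y z : rdot (x - y) z = rdot x z - rdot y z.
Proof. by rewrite /rdot linearBl raddfB. Qed.

Lemma rdotBr x y z : rdot x (y - z) = rdot x y - rdot x z.
Proof. by rewrite rdotC rdotBl !(rdotC x). Qed.

Lemma ReM_real (r : R) (z : R[i]) : complex.Re (r%:C * z) = r * complex.Re z.
Proof. by case: z => a b /=; rewrite mul0r subr0. Qed.

Lemma rdotZl (r : R) x y : rdot (r%:C *: x) y = r * rdot x y.
Proof. by rewrite /rdot linearZl_LR /= ReM_real. Qed.

Lemma hnm_real (r : R) x : 0 <= r -> hnm (r%:C *: x) = r * hnm x.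
Proof.
by move=> r0; rewrite hnmZ ger0_norm // -[0]/(0%:C) lecR.
Qed.

Lemma opnorm_leP T (M : R) :
  opnorm_le T M <-> forall x, hnm (T x) <= M * hnm x.
Proof.
split=> h x; first by rewrite -lecR rmorphM /= -!hnmE; exact: h.
by rewrite !hnmE -rmorphM lecR.
Qed.

Lemma hcomplete (u : nat -> H) :
  (forall e : R, 0 < e -> exists N, forall m n, (N <= m)%N -> (N <= n)%N ->
     hnm (u m - u n) <= e) ->
  exists l, forall e : R, 0 < e -> exists N, forall n, (N <= n)%N ->
     hnm (l - u n) <= e.
Proof.
move=> hu.
have cu : cauchy (u n @[n --> \oo]).
  apply/cauchy_ballP => e e0.
  have [r r0 re] : exists2 r : R, 0 < r & (r%:C < e)%R.
    move: e0; case: e => a b; rewrite ltcE /= => /andP[/eqP-> a0].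
    exists (a / 2); first by rewrite divr_gt0.
    by rewrite ltcE /= eqxx /=; lra.
  have [N hN] := hu r r0.
  near=> xy; rewrite -ball_normE /=.
  apply: le_lt_trans re; rewrite hnmE lecR.
  by near: xy; exists ([set x | exists2 n, (N <= n)%N & x = u n],
      [set x | exists2 n, (N <= n)%N & x = u n]) => /=;
    [split; exists N => // n hn; exists n|
     move=> [a b] /= [[m hm ->] [n hn ->]]; exact: hN].
have /cvg_ex[l hl] : cvg (u n @[n --> \oo]) by exact: cauchy_cvg.
exists l => e e0.
have e0' : 0 < e%:C :> R[i] by rewrite -[0]/(0%:C) ltcR.
move/cvgrPdist_le : hl => /(_ _ e0') [N _ hN]; exists N => n nN.
by have := hN n nN; rewrite hnmE lecR.
Unshelve. all: by end_near.
Qed.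

Lemma hdot_eq x y : (forall z, hdot H x z = hdot H y z) -> x = y.
Proof.
move=> h; apply/eqP; rewrite -subr_eq0; apply/eqP; apply: hnm0_eq.
apply/eqP; rewrite -sqrf_eq0 -rdot_sqr /rdot linearBl /= h subrr.
by [].
Qed.

End hilbert_norm.

(** * Algebraic and norm closure of a von Neumann algebra *)

Section von_neumann_closure.
Context {R : realType} {H : hilbert R}.
Variable (V : set (op H)).
Hypothesis hV : von_neumann_algebra V.
Implicit Types (T S : op H).

Lemma vNP T : V T <-> bounded_op T /\ forall S, commutant V S -> T \o S = S \o T.
Proof. by case: hV => _ _ {1}<-. Qed.

Lemma vN_bdd T : V T -> bounded_op T.
Proof. by case: hV => h _ _ /h. Qed.

Lemma bounded_pos T : bounded_op T ->
  linear T /\ exists2 M : R, 0 <= M & forall x, hnm (T x) <= M * hnm x.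
Proof.
move=> [lT [M /opnorm_leP hM]]; split=> //; exists (Num.max M 0).
  by rewrite le_max lexx orbT.
move=> x; apply: (le_trans (hM x)); apply: ler_wpM2r; first exact: hnm_ge0.
by rewrite le_max lexx.
Qed.

Lemma vN_id : V idfun.
Proof.
apply/vNP; split; last by [].
by split=> //; exists 1 => x; rewrite mul1r.
Qed.

Lemma vN_lin (c : R[i]) T S : V T -> V S -> V (c *: T + S).
Proof.
move=> hT hS.
have [lT [M M0 bM]] := bounded_pos (vN_bdd hT).
have [lS [N N0 bN]] := bounded_pos (vN_bdd hS).
apply/vNP; split.
  split.
    move=> a x y; rewrite /= !fctE lT lS !scalerDr !scalerA (mulrC c).
    by rewrite -!addrA; congr (_ + _); rewrite addrCA.
  exists (complex.Re `|c| * M + N); apply/opnorm_leP => x.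
  apply: (le_trans (hnmD _ _)); rewrite mulrDl lerD // hnmZ -mulrA.
  by rewrite ler_wpM2l // Re_norm_ge0.
move=> U hU; have [[lU _] cU] := hU.
move/vNP : hT => [_ /(_ _ hU) hT]; move/vNP : hS => [_ /(_ _ hU) hS].
apply/funext => x /=; rewrite !fctE lU.
by move/(congr1 (@^~ x)) : hT => /= ->; move/(congr1 (@^~ x)) : hS => /= ->.
Qed.

Lemma vN_comp T S : V T -> V S -> V (T \o S).
Proof.
move=> hT hS.
have [lT [M M0 bM]] := bounded_pos (vN_bdd hT).
have [lS [N N0 bN]] := bounded_pos (vN_bdd hS).
apply/vNP; split.
  split; first by move=> a x y; rewrite /= lS lT.
  exists (M * N); apply/opnorm_leP => x.
  by apply: (le_trans (bM _)); rewrite -mulrA ler_wpM2l.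
move=> U hU; have [[lU _] cU] := hU.
move/vNP : hT => [_ /(_ _ hU) hT]; move/vNP : hS => [_ /(_ _ hU) hS].
apply/funext => x /=.
move/(congr1 (@^~ x)) : hS => /= ->; by move/(congr1 (@^~ (S x))) : hT => /= ->.
Qed.

Lemma vN_star T : V T -> exists2 S, V S & adjoint_of T S.
Proof. by case: hV => _ h _ /h. Qed.

(** Norm limits stay in [V] because commuting with an element of the commutant passes to limits. As
    [T] is a bare function, its linearity and boundedness are read off from the approximants as
    well. *)
Lemma vN_closed T :
  (forall e : R, 0 < e -> exists2 S, V S & forall x, hnm (T x - S x) <= e * hnm x) ->
  V T.
Proof.
move=> hT.
have small (r C : R) : 0 <= r -> 0 <= C -> (forall e, 0 < e -> r <= e * C) -> r = 0.
  move=> r0 C0 h; apply/eqP; rewrite eq_le r0 andbT leNgt; apply/negP => rp.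
  have C1 : 0 < 2 * (C + 1) by lra.
  have := h (r / (2 * (C + 1))) ltac:(by rewrite divr_gt0).
  rewrite mulrAC ler_pdivlMr //; nra.
have lT : linear T.
  move=> a x y; apply/eqP; rewrite -subr_eq0; apply/eqP; apply: hnm0_eq.
  pose C := hnm (a *: x + y) + (complex.Re `|a| * hnm x + hnm y).
  apply: (small _ C); first exact: hnm_ge0.
    by rewrite /C !addr_ge0 ?hnm_ge0 // mulr_ge0 ?hnm_ge0 ?Re_norm_ge0.
  move=> e e0; have [S hS hTS] := hT e e0.
  have [lS _] := vN_bdd hS.
  have -> : T (a *: x + y) - (a *: T x + T y) =
    (T (a *: x + y) - S (a *: x + y)) + (a *: - (T x - S x) + - (T y - S y)).
    rewrite lS scalerN scalerBr -opprD addrACA -opprD opprB addrA.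
    by rewrite subrK.
  rewrite /C mulrDr; apply: (le_trans (hnmD _ _)); apply: lerD => //.
  rewrite mulrDr; apply: (le_trans (hnmD _ _)); apply: lerD; last by rewrite hnmN.
  rewrite hnmZ hnmN mulrCA; apply: ler_wpM2l => //.
  exact: Re_norm_ge0.
apply/vNP; split.
  split=> //; have [S hS hTS] := hT 1 ltr01.
  have [lS [N N0 bN]] := bounded_pos (vN_bdd hS).
  exists (1 + N); apply/opnorm_leP => x.
  rewrite -(subrK (S x) (T x)) mulrDl; apply: (le_trans (hnmD _ _)).
  exact: lerD.
move=> U hU; have [bU _] := hU.
have [lU [M M0 bM]] := bounded_pos bU.
apply/funext => x /=.
apply/eqP; rewrite -subr_eq0; apply/eqP; apply: hnm0_eq.
apply: (small _ (hnm (U x) + M * hnm x)); first exact: hnm_ge0.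
  by rewrite !addr_ge0 ?mulr_ge0 ?hnm_ge0.
move=> e e0; have [S hS hTS] := hT e e0.
move/vNP : hS => [_ /(_ _ hU) /(congr1 (@^~ x)) /= hS].
have -> : T (U x) - U (T x) = (T (U x) - S (U x)) + - U (T x - S x).
  have lUB y z : U (y - z) = U y - U z.
    by rewrite addrC -scaleN1r lU scaleN1r addrC.
  by rewrite lUB hS opprB addrA subrK.
apply: (le_trans (hnmD _ _)); rewrite mulrDr lerD // hnmN.
by apply: (le_trans (bM _)); rewrite mulrCA ler_wpM2l.
Qed.

End von_neumann_closure.

(** * The operators of the algebra as a ring *)

Section algebra_type.
Context {R : realType} (A : wprob_space R).

(** [x \o (y + z)] splits only for additive [x]. Bundling an operator with its membership in the
    algebra supplies linearity and makes the ring structure possible. *)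
Record walg := WAlg { oper : op A ; operP : wp_alg oper }.

Lemma oper_inj (x y : walg) : oper x = oper y -> x = y.
Proof.
case: x y => [T hT] [S hS] /= e; subst T; congr WAlg; exact: Prop_irrelevance.
Qed.

HB.instance Definition _ := gen_eqMixin walg.
HB.instance Definition _ := gen_choiceMixin walg.

Lemma wp_alg0 : wp_alg (0 : op A).
Proof.
have := vN_lin (wp_algP A) (-1) (vN_id (wp_algP A)) (vN_id (wp_algP A)).
by rewrite scaleN1r addNr.
Qed.

Lemma wp_algZ c (T : op A) : wp_alg T -> wp_alg (c *: T).
Proof. by move=> h; have := vN_lin (wp_algP A) c h wp_alg0; rewrite addr0. Qed.

Lemma wp_algD (T S : op A) : wp_alg T -> wp_alg S -> wp_alg (T + S).
Proof. by move=> h h'; have := vN_lin (wp_algP A) 1 h h'; rewrite scale1r. Qed.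

Lemma wp_algN (T : op A) : wp_alg T -> wp_alg (- T).
Proof. by move=> h; rewrite -scaleN1r; exact: wp_algZ. Qed.

Definition walg0 := WAlg wp_alg0.
Definition walg_add (x y : walg) := WAlg (wp_algD (operP x) (operP y)).
Definition walg_opp (x : walg) := WAlg (wp_algN (operP x)).
Definition walg_scale (c : R[i]) (x : walg) := WAlg (wp_algZ c (operP x)).
Definition walg1 := WAlg (vN_id (wp_algP A)).
Definition walg_mul (x y : walg) := WAlg (vN_comp (wp_algP A) (operP x) (operP y)).

Lemma walg_addA : associative walg_add.
Proof. by move=> x y z; apply: oper_inj; rewrite /= addrA. Qed.
Lemma walg_addC : commutative walg_add.
Proof. by move=> x y; apply: oper_inj; rewrite /= addrC. Qed.
Lemma walg_add0 : left_id walg0 walg_add.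
Proof. by move=> x; apply: oper_inj; rewrite /= add0r. Qed.
Lemma walg_addN : left_inverse walg0 walg_opp walg_add.
Proof. by move=> x; apply: oper_inj; rewrite /= addNr. Qed.
HB.instance Definition _ :=
  GRing.isZmodule.Build walg walg_addA walg_addC walg_add0 walg_addN.

Lemma oper_linear (x : walg) : linear (oper x).
Proof. by have [] := vN_bdd (wp_algP A) (operP x). Qed.

Lemma operD_arg (x : walg) (u v : A) : oper x (u + v) = oper x u + oper x v.
Proof. by have := oper_linear x 1 u v; rewrite !scale1r. Qed.

Lemma operZ_arg (x : walg) c (u : A) : oper x (c *: u) = c *: oper x u.
Proof.
have h0 : oper x 0 = 0.
  by apply: (addrI (oper x 0)); rewrite -operD_arg !addr0.
by have := oper_linear x c u 0; rewrite !addr0 h0 addr0.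
Qed.

Lemma walg_mulA : associative walg_mul.
Proof. by move=> x y z; apply: oper_inj. Qed.
Lemma walg_mul1l : left_id walg1 walg_mul.
Proof. by move=> x; apply: oper_inj. Qed.
Lemma walg_mul1r : right_id walg1 walg_mul.
Proof. by move=> x; apply: oper_inj. Qed.
Lemma walg_mulDl : left_distributive walg_mul +%R.
Proof. by move=> x y z; apply: oper_inj. Qed.
Lemma walg_mulDr : right_distributive walg_mul +%R.
Proof.
by move=> x y z; apply: oper_inj; apply/funext => u /=; rewrite !fctE operD_arg.
Qed.
Lemma walg_1neq0 : walg1 != 0.
Proof.
apply/eqP => /(congr1 oper) /= e.
have [[hl h1] _ _ _ _] := wp_expectP A.
have := hl 1 0 0 wp_alg0 wp_alg0; rewrite scale1r addr0 mul1r => h0.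
have {}h0 : @wp_expect R A 0 = 0.
  by apply: (addrI (@wp_expect R A 0)); rewrite -h0 addr0.
have e2 : (idfun : op A) = 0 by rewrite e.
by move: h1; rewrite e2 h0 => /eqP; rewrite eq_sym oner_eq0.
Qed.
HB.instance Definition _ := GRing.Zmodule_isNzRing.Build walg
  walg_mulA walg_mul1l walg_mul1r walg_mulDl walg_mulDr walg_1neq0.

Lemma walg_scaleA c d (x : walg) : walg_scale c (walg_scale d x) = walg_scale (c * d) x.
Proof. by apply: oper_inj; rewrite /= scalerA. Qed.
Lemma walg_scale1 : left_id 1 walg_scale.
Proof. by move=> x; apply: oper_inj; rewrite /= scale1r. Qed.
Lemma walg_scaleDr : right_distributive walg_scale +%R.
Proof. by move=> c x y; apply: oper_inj; rewrite /= scalerDr. Qed.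
Lemma walg_scaleDl x : {morph walg_scale^~ x : c d / c + d}.
Proof. by move=> c d; apply: oper_inj; rewrite /= scalerDl. Qed.
HB.instance Definition _ := GRing.Zmodule_isLmodule.Build R[i] walg
  walg_scaleA walg_scale1 walg_scaleDr walg_scaleDl.

Lemma walg_scaleAl (c : R[i]) (x y : walg) : c *: (x * y) = c *: x * y.
Proof. by apply: oper_inj. Qed.
HB.instance Definition _ := GRing.Lmodule_isLalgebra.Build R[i] walg walg_scaleAl.
Lemma walg_scaleAr (c : R[i]) (x y : walg) : c *: (x * y) = x * (c *: y).
Proof.
by apply: oper_inj; apply/funext => u; rewrite /= !fctE operZ_arg.
Qed.
HB.instance Definition _ := GRing.Lalgebra_isAlgebra.Build R[i] walg walg_scaleAr.

End algebra_type.

(** * Adjoint, norm bounds, order and trace *)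

Section algebra_theory.
Context {R : realType} {A : wprob_space R}.
Local Notation M := (walg A).
Implicit Types (x y z p : M) (u v : A) (c : R[i]).

Lemma operDE x y u : oper (x + y) u = oper x u + oper y u. Proof. by []. Qed.
Lemma operBE x y u : oper (x - y) u = oper x u - oper y u. Proof. by []. Qed.
Lemma operNE x u : oper (- x) u = - oper x u. Proof. by []. Qed.
Lemma operZE c x u : oper (c *: x) u = c *: oper x u. Proof. by []. Qed.
Lemma operME x y u : oper (x * y) u = oper x (oper y u). Proof. by []. Qed.
Lemma oper1E u : oper (1 : M) u = u. Proof. by []. Qed.

Lemma star_ex x : exists y : M, adjoint_of (oper x) (oper y).
Proof.
by have [S hS h] := vN_star (wp_algP A) (operP x); exists (WAlg hS).
Qed.
Definition star x : M := sval (cid (star_ex x)).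

Lemma starP x u v : hdot A (oper x u) v = hdot A u (oper (star x) v).
Proof. exact: (svalP (cid (star_ex x))). Qed.

Lemma star_uniq x y : adjoint_of (oper x) (oper y) -> star x = y.
Proof.
move=> h; apply: oper_inj; apply/funext => v; apply: hdot_eq => z.
by rewrite hdotC -starP h -hdotC.
Qed.

Lemma hdotDr (u v w : A) : hdot A u (v + w) = hdot A u v + hdot A u w.
Proof. by rewrite hdotC linearDl rmorphD /= -!hdotC. Qed.
Lemma hdotZr c (u v : A) : hdot A u (c *: v) = c^*%C * hdot A u v.
Proof. by rewrite hdotC linearZl_LR /= rmorphM /= -hdotC. Qed.

Lemma starK : involutive star.
Proof. by move=> x; apply: star_uniq => u v; rewrite hdotC -starP -hdotC. Qed.
Lemma starD x y : star (x + y) = star x + star y.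
Proof.
apply: star_uniq => u v; rewrite !operDE hdotDr linearDl /=.
by rewrite !starP.
Qed.
Lemma starZ c x : star (c *: x) = c^*%C *: star x.
Proof.
apply: star_uniq => u v; rewrite !operZE hdotZr linearZl_LR /= conjcK.
by rewrite starP.
Qed.
Lemma starM x y : star (x * y) = star y * star x.
Proof. by apply: star_uniq => u v; rewrite !operME !starP. Qed.
Lemma star1 : star 1 = 1 :> M.
Proof. exact: star_uniq. Qed.
Lemma star0 : star 0 = 0 :> M.
Proof. by apply: (addrI (star 0)); rewrite -starD !addr0. Qed.
Lemma starN x : star (- x) = - star x.
Proof. by apply: (addrI (star x)); rewrite -starD !subrr star0. Qed.
Lemma starB x y : star (x - y) = star x - star y.
Proof. by rewrite starD starN. Qed.
Lemma starZr (r : R) x : star (r%:C *: x) = r%:C *: star x.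
Proof. by rewrite starZ conjc_real. Qed.
Lemma starX x n : star (x ^+ n) = star x ^+ n.
Proof. by elim: n => [|n IH]; [exact: star1|rewrite exprS starM IH -exprSr]. Qed.
Lemma star_sum (I : Type) (s : seq I) (P : pred I) (F : I -> M) :
  star (\sum_(i <- s | P i) F i) = \sum_(i <- s | P i) star (F i).
Proof. exact: (big_morph star starD star0). Qed.

Lemma rstarP x u v : rdot (oper x u) v = rdot u (oper (star x) v).
Proof. by rewrite /rdot starP. Qed.

Lemma rdot_cs u v : rdot u v <= hnm u * hnm v.
Proof.
set a := hnm u; set b := hnm v.
have a0 : 0 <= a := hnm_ge0 u.
have b0 : 0 <= b := hnm_ge0 v.
have rdot0l w : rdot (0 : A) w = 0.
  by rewrite /rdot linear0l.
have [ea|na] := eqVneq a 0.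
  by rewrite ea mul0r (hnm0_eq ea) rdot0l.
have [eb|nb] := eqVneq b 0.
  by rewrite eb mulr0 (hnm0_eq eb) rdotC rdot0l.
have : 0 <= rdot (b%:C *: u - a%:C *: v) (b%:C *: u - a%:C *: v).
  by rewrite rdot_sqr sqr_ge0.
rewrite rdotBl !rdotBr !rdotZl !(rdotC _ (_ *: _)) !rdotZl !rdot_sqr -/a -/b.
rewrite (rdotC v u).
have : 0 < a * b by rewrite mulr_gt0 // lt_neqAle eq_sym ?na ?nb.
nra.
Qed.

(** The operator norm enters as a relation: estimates only compare it with numbers, and no supremum
    has to be formed. *)
Definition nle x (r : R) := forall u, hnm (oper x u) <= r * hnm u.

Lemma nle_le x r s : r <= s -> nle x r -> nle x s.
Proof. by move=> rs h u; apply: (le_trans (h u)); rewrite ler_wpM2r ?hnm_ge0. Qed.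

Lemma nleD x y r s : nle x r -> nle y s -> nle (x + y) (r + s).
Proof.
by move=> hx hy u; rewrite operDE mulrDl (le_trans (hnmD _ _)) // lerD.
Qed.

Lemma nleN x r : nle x r -> nle (- x) r.
Proof. by move=> hx u; rewrite operNE hnmN. Qed.

Lemma nleB x y r s : nle x r -> nle y s -> nle (x - y) (r + s).
Proof. by move=> hx /nleN hy; exact: nleD. Qed.

Lemma nleM x y r s : 0 <= r -> nle x r -> nle y s -> nle (x * y) (r * s).
Proof.
by move=> r0 hx hy u; rewrite operME (le_trans (hx _)) // -mulrA ler_wpM2l.
Qed.

Lemma nle1 : nle 1 1.
Proof. by move=> u; rewrite oper1E mul1r. Qed.

Lemma nle0 r : 0 <= r -> nle 0 r.
Proof.
move=> r0 u; rewrite (_ : oper 0 u = 0) // hnm0 mulr_ge0 ?hnm_ge0 //.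
Qed.

Lemma nleZ c x r : nle x r -> nle (c *: x) (complex.Re `|c| * r).
Proof.
by move=> hx u; rewrite operZE hnmZ -mulrA ler_wpM2l ?Re_norm_ge0.
Qed.

Lemma nleZr (a : R) x r : 0 <= a -> nle x r -> nle (a%:C *: x) (a * r).
Proof. by move=> a0 hx u; rewrite operZE hnm_real // -mulrA ler_wpM2l. Qed.

Lemma nle_star x r : nle x r -> nle (star x) r.
Proof.
move=> hx u; have [->|n0] := eqVneq (hnm (oper (star x) u)) 0.
  have [->|n1] := eqVneq (hnm u) 0; first by rewrite mulr0.
  have u0 : 0 < hnm u by rewrite lt_neqAle eq_sym n1 hnm_ge0.
  by rewrite pmulr_lge0 // -(pmulr_lge0 _ u0) (le_trans (hnm_ge0 _) (hx u)).
have p0 : 0 < hnm (oper (star x) u) by rewrite lt_neqAle eq_sym n0 hnm_ge0.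
rewrite -(ler_pM2r p0) -expr2 -rdot_sqr -rstarP.
rewrite (le_trans (rdot_cs _ _)) // mulrAC ler_wpM2r ?hnm_ge0 //.
Qed.

Lemma nle_ex x : exists2 r : R, 0 < r & nle x r.
Proof.
have [_ [r r0 h]] := bounded_pos (vN_bdd (wp_algP A) (operP x)).
exists (r + 1); first by lra.
by apply: (@nle_le _ r) => //; lra.
Qed.

Lemma nle_opnorm x r : nle x r <-> opnorm_le (oper x) r.
Proof. by split=> /opnorm_leP. Qed.

Lemma nle_small x : (forall r : R, 0 < r -> nle x r) -> x = 0.
Proof.
move=> h; apply: oper_inj; apply/funext => u; apply: hnm0_eq.
apply/eqP; rewrite eq_le hnm_ge0 andbT leNgt; apply/negP => p.
have q : 0 < 2 * (hnm u + 1) by have := hnm_ge0 u; lra.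
have := h (hnm (oper x u) / (2 * (hnm u + 1))) ltac:(by rewrite divr_gt0) u.
rewrite mulrAC ler_pdivlMr //; have := hnm_ge0 u; nra.
Qed.

Definition pos p := star p = p /\ forall u, 0 <= rdot (oper p u) u.

Lemma posD x y : pos x -> pos y -> pos (x + y).
Proof.
move=> [sx hx] [sy hy]; split; first by rewrite starD sx sy.
by move=> u; rewrite operDE rdotDl addr_ge0.
Qed.

Lemma posZ r x : 0 <= r -> pos x -> pos (r%:C *: x).
Proof.
move=> r0 [sx hx]; split; first by rewrite starZr sx.
by move=> u; rewrite operZE rdotZl mulr_ge0.
Qed.

Lemma pos_conj p y : pos p -> pos (star y * p * y).
Proof.
move=> [sp hp]; split; first by rewrite !starM starK sp mulrA.
by move=> u; rewrite !operME rstarP starK.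
Qed.

Lemma pos1 : pos 1.
Proof.
by split; [exact: star1|move=> u; rewrite oper1E rdot_sqr sqr_ge0].
Qed.

Lemma pos_star_mul y : pos (star y * y).
Proof. by rewrite -[star y]mulr1; apply: pos_conj; exact: pos1. Qed.

Lemma pos0 : pos 0.
Proof. by rewrite -(mulr0 (star 0)); exact: pos_star_mul. Qed.

Lemma pos_real r : 0 <= r -> pos (r%:C *: 1).
Proof. by move=> r0; apply: posZ => //; exact: pos1. Qed.

Lemma nle_sqP x r : 0 <= r ->
  nle x r <-> forall u, 0 <= rdot (oper ((r ^+ 2)%:C *: 1 - star x * x) u) u.
Proof.
move=> r0.
have e u : rdot (oper ((r ^+ 2)%:C *: 1 - star x * x) u) u =
    (r * hnm u) ^+ 2 - hnm (oper x u) ^+ 2.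
  rewrite operBE rdotBl operZE rdotZl oper1E rdot_sqr operME rstarP starK.
  by rewrite rdot_sqr exprMn.
split=> h u; rewrite ?e ?subr_ge0.
  by rewrite ler_sqr ?nnegrE ?mulr_ge0 ?hnm_ge0.
by have := h u; rewrite e subr_ge0 ler_sqr ?nnegrE ?mulr_ge0 ?hnm_ge0.
Qed.

Lemma nle_pos_sub x r : star x = x -> nle x r -> pos (r%:C *: 1 - x).
Proof.
move=> sx hx; split; first by rewrite starB starZr star1 sx.
move=> u; rewrite operBE rdotBl operZE rdotZl oper1E rdot_sqr subr_ge0.
rewrite (le_trans (rdot_cs _ _)) // expr2 mulrA ler_wpM2r ?hnm_ge0 //.
Qed.

Lemma nle_pos_add x r : star x = x -> nle x r -> pos (r%:C *: 1 + x).
Proof.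
move=> sx /nleN h; rewrite -[x]opprK; apply: nle_pos_sub => //.
by rewrite starN sx.
Qed.

(** With [a = r - x] and [b = r + x], which commute and add up to [2 r], one has
    [2 r a b = a b a + b a b], a sum of conjugates of positive elements, and [a b = r^2 - x^2]. Two
    order bounds thus become a norm bound. *)
Lemma pos_nle x r : 0 < r -> pos (r%:C *: 1 - x) -> pos (r%:C *: 1 + x) -> nle x r.
Proof.
move=> r0 h1 h2.
have sx : star x = x.
  by case: h2 => + _; rewrite starD starZr star1 => /addrI.
apply/(nle_sqP _ (ltW r0)) => u; rewrite sx.
set a := r%:C *: 1 - x in h1; set b := r%:C *: 1 + x in h2.
have ab : a * b = (r ^+ 2)%:C *: 1 - x * x.
  rewrite /a /b mulrBl !mulrDr -!scalerAl -!scalerAr !mul1r !mulr1 scalerA.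
  by rewrite -rmorphM -expr2 opprD addrA addrK.
have ba : b * a = a * b.
  rewrite ab /a /b mulrDl !mulrBr -!scalerAl -!scalerAr !mul1r !mulr1 scalerA.
  by rewrite -rmorphM -expr2 addrA subrK.
have sa : star a = a by case: h1.
have sb : star b = b by case: h2.
have e : (2 * r)%:C *: (a * b) = star a * b * a + star b * a * b.
  rewrite sa sb ba -mulrDr addrC addrC /a /b addrACA addNr addr0.
  by rewrite -scalerDl -rmorphD -scalerAr mulr1; congr (_%:C *: _); lra.
have [_ /(_ u)] : pos ((2 * r)%:C *: (a * b)).
  by rewrite e; apply: posD; apply: pos_conj.
by rewrite -ab operZE rdotZl pmulr_rge0 // mulr_gt0.
Qed.

(** The limit is built vector by vector from completeness of the Hilbert space. The Cauchy estimate
    is uniform over vectors, so [vN_closed] puts the limit back in the algebra. *)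
Lemma walg_complete (f : nat -> M) :
  (forall e : R, 0 < e -> exists N, forall m n, (N <= m)%N -> (N <= n)%N ->
     nle (f m - f n) e) ->
  exists x, forall e : R, 0 < e -> exists N, forall n, (N <= n)%N -> nle (x - f n) e.
Proof.
move=> hf.
have hp (u : A) : exists l, forall e : R, 0 < e -> exists N, forall n, (N <= n)%N ->
     hnm (l - oper (f n) u) <= e.
  apply: hcomplete => e e0.
  have u1 : 0 < hnm u + 1 by have := hnm_ge0 u; lra.
  have [N hN] := hf (e / (hnm u + 1)) ltac:(by rewrite divr_gt0).
  exists N => m n hm hn; apply: (le_trans (hN m n hm hn u)).
  by rewrite mulrAC ler_pdivrMr //; have := hnm_ge0 u; nra.
pose T (u : A) := sval (cid (hp u)).
have hT u := svalP (cid (hp u)).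
have key e : 0 < e -> exists N, forall n, (N <= n)%N ->
    forall u, hnm (T u - oper (f n) u) <= e * hnm u.
  move=> e0; have [N hN] := hf e e0; exists N => n nN u.
  apply/ler_addgt0Pr => d d0; have [N' hN'] := hT u d d0.
  have -> : T u - oper (f n) u =
    (T u - oper (f (maxn N N')) u) + oper (f (maxn N N') - f n) u.
    by rewrite operBE addrA subrK.
  rewrite (le_trans (hnmD _ _)) // [e * _ + _]addrC lerD //.
    by apply: hN'; rewrite leq_maxr.
  by apply: hN => //; rewrite leq_maxl.
have hTA : wp_alg (T : op A).
  apply: (vN_closed (wp_algP A)) => e /key[N hN].
  by exists (oper (f N)); [exact: operP|exact: hN].
by exists (WAlg hTA) => e /key[N hN]; exists N => n nN u; exact: hN.
Qed.

Definition tr x : R[i] := @wp_expect R A (oper x).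
Definition rtr x : R := complex.Re (tr x).

Lemma trD x y : tr (x + y) = tr x + tr y.
Proof.
have [[hl _] _ _ _ _] := wp_expectP A.
by have := hl 1 _ _ (operP x) (operP y); rewrite scale1r mul1r.
Qed.
Lemma tr0 : tr 0 = 0.
Proof. by apply: (addrI (tr 0)); rewrite -trD !addr0. Qed.
Lemma trZ c x : tr (c *: x) = c * tr x.
Proof.
have [[hl _] _ _ _ _] := wp_expectP A.
have := hl c _ _ (operP x) (wp_alg0 A); rewrite addr0 => h.
by rewrite /tr h -[RHS]addr0; congr (_ + _); exact: tr0.
Qed.
Lemma trN x : tr (- x) = - tr x.
Proof. by apply: (addrI (tr x)); rewrite -trD !subrr tr0. Qed.
Lemma trB x y : tr (x - y) = tr x - tr y.
Proof. by rewrite trD trN. Qed.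
Lemma tr1 : tr 1 = 1.
Proof. by have [[_ h] _ _ _ _] := wp_expectP A. Qed.
Lemma trC x y : tr (x * y) = tr (y * x).
Proof. by have [_ _ _ h _] := wp_expectP A; apply: h; exact: operP. Qed.
Lemma tr_sum (I : Type) (s : seq I) (P : pred I) (F : I -> M) :
  tr (\sum_(i <- s | P i) F i) = \sum_(i <- s | P i) tr (F i).
Proof. exact: (big_morph tr trD tr0). Qed.
Lemma starPP x : adjoint_of (oper x) (oper (star x)).
Proof. by move=> u v; rewrite starP. Qed.
Lemma tr_ge0 x : 0 <= tr (star x * x).
Proof.
by have [_ h _ _ _] := wp_expectP A; apply: h; [exact: operP|exact: starPP].
Qed.
Lemma tr_eq0 x : tr (star x * x) = 0 -> x = 0.
Proof.
have [_ _ h _ _] := wp_expectP A => e; apply: oper_inj.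
exact: (h _ _ (operP x) (starPP x) e).
Qed.
(** The trace is real on squares. Applied to [x], [1 + x] and [1 + i x], this determines both
    components of [tr (star x)] by polarisation. *)
Lemma tr_star x : tr (star x) = (tr x)^*%C.
Proof.
have := tr_ge0 (1 + x); have := tr_ge0 x; have := tr_ge0 (1 + 'i%C *: x).
rewrite !starD !starZ !star1 !mulrDl !mulrDr !mul1r !mulr1 !trD tr1.
rewrite -scalerAl -scalerAr scalerA !trZ.
have -> : ('i^* * 'i)%C = 1 :> R[i] by simpc.
rewrite mul1r.
case: (tr x) => a b; case: (tr (star x)) => c d; case: (tr (star x * x)) => e f.
rewrite !lecE /=; simpc => /andP[/eqP h1 _] /andP[/eqP h2 _] /andP[/eqP h3 _].
by apply/eqP; rewrite eq_complex /=; apply/andP; split; apply/eqP; lra.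
Qed.

End algebra_theory.

(** * Normalisation in noncommutative algebras *)

Section nc_normal_form.
Context {K : comNzRingType} {V : algType K}.

(** Reflected terms for identities in a noncommutative algebra: both sides are expanded into sums of
    words, and equality is reduced to one scalar identity per word, in the commutative ring of
    coefficients. *)
Inductive nc_expr :=
  | NcVar of nat | NcZero | NcOne | NcAdd of nc_expr & nc_expr | NcOpp of nc_expr
  | NcMul of nc_expr & nc_expr | NcScale of K & nc_expr.

Fixpoint nc_eval (env : seq V) (e : nc_expr) : V :=
  match e with
  | NcVar n => nth 0 env n
  | NcZero => 0
  | NcOne => 1
  | NcAdd a b => nc_eval env a + nc_eval env b
  | NcOpp a => - nc_eval env a
  | NcMul a b => nc_eval env a * nc_eval env b
  | NcScale k a => k *: nc_eval env a
  end.

Fixpoint nc_nf (e : nc_expr) : seq (K * seq nat) :=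
  match e with
  | NcVar n => [:: (1, [:: n])]
  | NcZero => [::]
  | NcOne => [:: (1, [::])]
  | NcAdd a b => nc_nf a ++ nc_nf b
  | NcOpp a => map (fun t => (- t.1, t.2)) (nc_nf a)
  | NcMul a b =>
      flatten (map (fun s => map (fun t => (s.1 * t.1, s.2 ++ t.2)) (nc_nf b)) (nc_nf a))
  | NcScale k a => map (fun t => (k * t.1, t.2)) (nc_nf a)
  end.

Definition nc_word (env : seq V) (w : seq nat) : V := foldr (fun i p => nth 0 env i * p) 1 w.

Definition nc_sum (env : seq V) (l : seq (K * seq nat)) : V :=
  foldr (fun t s => t.1 *: nc_word env t.2 + s) 0 l.

(** Private equality tests, named in the [cbv] call of [nc] so that words are compared there by
    computation. *)
Fixpoint nc_eqn (i j : nat) : bool :=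
  match i, j with
  | 0%N, 0%N => true
  | i'.+1, j'.+1 => nc_eqn i' j'
  | _, _ => false
  end.

Fixpoint nc_eqw (w v : seq nat) : bool :=
  match w, v with
  | [::], [::] => true
  | i :: w', j :: v' => if nc_eqn i j then nc_eqw w' v' else false
  | _, _ => false
  end.

Fixpoint nc_insert (t : K * seq nat) (l : seq (K * seq nat)) :=
  match l with
  | [::] => [:: t]
  | s :: l' => if nc_eqw t.2 s.2 then (t.1 + s.1, s.2) :: l' else s :: nc_insert t l'
  end.

Fixpoint nc_collect (l : seq (K * seq nat)) :=
  match l with [::] => [::] | t :: l' => nc_insert t (nc_collect l') end.

(** A conjunction and not a boolean, since the vanishing of a coefficient is left as a goal for
    [ring] or [field]. *)
Fixpoint nc_zero (l : seq (K * seq nat)) : Prop :=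
  match l with [::] => True | t :: l' => t.1 = 0 /\ nc_zero l' end.

Lemma nc_word_cat env w v : nc_word env (w ++ v) = nc_word env w * nc_word env v.
Proof. by elim: w => [|i w IH] /=; rewrite ?mul1r // IH mulrA. Qed.

Lemma nc_sum_cat env l m : nc_sum env (l ++ m) = nc_sum env l + nc_sum env m.
Proof. by elim: l => [|t l IH] /=; rewrite ?add0r // IH addrA. Qed.

Lemma nc_sum_scale env k l :
  nc_sum env (map (fun t => (k * t.1, t.2)) l) = k *: nc_sum env l.
Proof. by elim: l => [|t l IH] /=; rewrite ?scaler0 // IH scalerDr scalerA. Qed.

Lemma nc_sum_opp env l :
  nc_sum env (map (fun t => (- t.1, t.2)) l) = - nc_sum env l.
Proof. by elim: l => [|t l IH] /=; rewrite ?oppr0 // IH opprD scaleNr. Qed.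

Lemma nc_sum_mul env (s : K * seq nat) l :
  nc_sum env (map (fun t => (s.1 * t.1, s.2 ++ t.2)) l) =
  s.1 *: nc_word env s.2 * nc_sum env l.
Proof.
elim: l => [|t l IH] /=; rewrite ?mulr0 // IH mulrDr nc_word_cat.
by rewrite -!scalerAl -scalerAr scalerA.
Qed.

Lemma nc_nfE env e : nc_eval env e = nc_sum env (nc_nf e).
Proof.
elim: e => //=.
- by move=> n; rewrite scale1r mulr1 addr0.
- by rewrite scale1r addr0.
- by move=> a -> b ->; rewrite nc_sum_cat.
- by move=> a ->; rewrite nc_sum_opp.
- move=> a -> b ->; elim: (nc_nf a) => [|t l IH] /=; first by rewrite mul0r.
  by rewrite mulrDl IH nc_sum_cat nc_sum_mul.
- by move=> k a ->; rewrite nc_sum_scale.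
Qed.

Lemma nc_eqwP w v : nc_eqw w v -> w = v.
Proof.
elim: w v => [|i w IH] [|j v] //=.
have eqn : nc_eqn i j -> i = j by elim: i j => [|i IHi] [|j] //= /IHi ->.
by case: ifP => // /eqn -> /IH ->.
Qed.

Lemma nc_insertE env t l : nc_sum env (nc_insert t l) = nc_sum env (t :: l).
Proof.
elim: l => [//|s l IH] /=; case: ifP => [/nc_eqwP e|_] /=.
  by rewrite e scalerDl addrA.
by rewrite IH /= addrCA.
Qed.

Lemma nc_collectE env l : nc_sum env (nc_collect l) = nc_sum env l.
Proof. by elim: l => [//|t l IH] /=; rewrite nc_insertE /= IH. Qed.

Lemma nc_zeroE env l : nc_zero l -> nc_sum env l = 0.
Proof. by elim: l => [//|t l IH] /= [-> /IH ->]; rewrite scale0r addr0. Qed.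

Lemma nc_correct env a b : nc_zero (nc_collect (nc_nf (NcAdd a (NcOpp b)))) ->
  nc_eval env a = nc_eval env b.
Proof.
move=> /(nc_zeroE env); rewrite nc_collectE -nc_nfE /= => /eqP.
by rewrite subr_eq0 => /eqP.
Qed.

End nc_normal_form.

Ltac nc_add T x l :=
  lazymatch l with
  | nil => constr:(@cons T x (@nil T))
  | x :: _ => l
  | ?y :: ?l' => let r := nc_add T x l' in constr:(@cons T y r)
  end.

Ltac nc_atoms T t l :=
  lazymatch t with
  | (?a + ?b)%R => let l1 := nc_atoms T a l in nc_atoms T b l1
  | (- ?a)%R => nc_atoms T a l
  | (?a * ?b)%R => let l1 := nc_atoms T a l in nc_atoms T b l1
  | (?k *: ?a)%R => nc_atoms T a l
  | 0%R => l
  | 1%R => l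
  | _ => nc_add T t l
  end.

Ltac nc_index x l :=
  lazymatch l with
  | x :: _ => constr:(O)
  | _ :: ?l' => let n := nc_index x l' in constr:(S n)
  end.

Ltac nc_reify K t l :=
  lazymatch t with
  | (?a + ?b)%R => let u := nc_reify K a l in let v := nc_reify K b l in
      constr:(@NcAdd K u v)
  | (- ?a)%R => let u := nc_reify K a l in constr:(@NcOpp K u)
  | (?a * ?b)%R => let u := nc_reify K a l in let v := nc_reify K b l in
      constr:(@NcMul K u v)
  | (?k *: ?a)%R => let u := nc_reify K a l in constr:(@NcScale K k u)
  | 0%R => constr:(@NcZero K)
  | 1%R => constr:(@NcOne K)
  | _ => let n := nc_index t l in constr:(@NcVar K n)
  end.

Ltac nc_coef := first [by ring | by field].

Ltac nc :=
  lazymatch goal with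
  | |- @eq _ ?a ?b =>
    let T := type of a in
    let l1 := nc_atoms T a (@nil T) in
    let l := nc_atoms T b l1 in
    let R0 := open_constr:(_ : realType) in
    let A0 := open_constr:(_ : wprob_space R0) in
    let _ := lazymatch goal with _ => unify T (walg A0) end in
    let K := constr:((complex (Real.sort R0)) : comNzRingType) in
    let u := nc_reify K a l in let v := nc_reify K b l in
    apply: (@nc_correct K (walg A0) l u v);
    cbv [nc_collect nc_insert nc_nf nc_zero nc_eqw nc_eqn flatten foldr map cat fst snd];
    repeat split; try nc_coef
  end.

(** * Square roots and positivity *)

Section square_roots.
Context {R : realType} {A : wprob_space R}.
Local Notation M := (walg A).
Implicit Types (x y z p h : M) (P B D : M -> Prop) (r s e : R).

(** Stands in for functional calculus: an element obtained from [p] by norm limits of real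
    polynomials satisfies every closed predicate that [p] satisfies. The instances of interest are
    membership in the past and commutation with a fixed element. *)
Record closed_alg P : Prop := ClosedAlg {
  cl1 : P 1;
  clD : forall x y, P x -> P y -> P (x + y);
  clZ : forall r x, P x -> P (r%:C *: x);
  clM : forall x y, P x -> P y -> P (x * y);
  clL : forall x, (forall e, 0 < e -> exists2 y, P y & nle (x - y) e) -> P x }.

Lemma clN P : closed_alg P -> forall x, P x -> P (- x).
Proof.
by move=> hP x Px; have := clZ hP (-1) Px; rewrite rmorphN /= rmorph1 scaleN1r.
Qed.

Lemma clB P : closed_alg P -> forall x y, P x -> P y -> P (x - y).
Proof. by move=> hP x y Px Py; apply: (clD hP) => //; exact: clN. Qed.

Lemma nle_sym x y r : nle (x - y) r -> nle (y - x) r.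
Proof. by move=> h; rewrite -opprB; exact: nleN. Qed.

Lemma commutant_closed y : closed_alg (fun x => x * y = y * x).
Proof.
split.
- by rewrite mul1r mulr1.
- by move=> a b ha hb; rewrite mulrDl mulrDr ha hb.
- by move=> r a ha; rewrite -scalerAl -scalerAr ha.
- by move=> a b ha hb; rewrite -mulrA hb mulrA ha mulrA.
- move=> x hx; apply/eqP; rewrite -subr_eq0; apply/eqP; apply: nle_small => r r0.
  have [L L0 hL] := nle_ex y.
  have [a ha hxa] := hx (r / (2 * L)) ltac:(by rewrite divr_gt0 // mulr_gt0).
  have -> : x * y - y * x = (x - a) * y - y * (x - a).
    by rewrite mulrBl mulrBr ha opprB addrA subrK.
  apply: (@nle_le _ _ _ (r / (2 * L) * L + L * (r / (2 * L)))).
    by rewrite le_eqVlt; apply/orP; left; apply/eqP; field; lra.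
  apply: nleB; apply: nleM => //; first by rewrite ltW // divr_gt0 // mulr_gt0.
  exact: ltW.
Qed.

Lemma star_lim x : (forall e, 0 < e -> exists2 y, star y = y & nle (x - y) e) ->
  star x = x.
Proof.
move=> hx; apply/eqP; rewrite -subr_eq0; apply/eqP; apply: nle_small => r r0.
have [y sy hy] := hx (r / 2) ltac:(lra).
have -> : star x - x = star (x - y) - (x - y).
  by rewrite starB sy opprB addrA subrK.
by rewrite [r]splitr; apply: nleB => //; exact: nle_star.
Qed.

(** Iteration for the fixed point [1 - sqrt (1 - c)] of [u = (c + u^2) / 2]. The scalar sequence
    [sqrt_itr] is the case [c = 1]; it dominates the operator iterates and their increments in norm,
    so the borderline [c] of norm 1 is allowed. *)
Fixpoint sqrt_it (c : M) (n : nat) : M :=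
  if n is m.+1 then (2^-1)%:C *: (c + sqrt_it c m * sqrt_it c m) else 0.
Fixpoint sqrt_itr (n : nat) : R :=
  if n is m.+1 then 2^-1 * (1 + sqrt_itr m * sqrt_itr m) else 0.

Lemma sqrt_itr_bd n : 0 <= sqrt_itr n <= 1.
Proof. by elim: n => [|n /andP[h1 h2]] /=; apply/andP; split; nra. Qed.

Lemma sqrt_itr_le n : sqrt_itr n <= sqrt_itr n.+1.
Proof. by have := sqrt_itr_bd n; rewrite /= => /andP[h1 h2]; nra. Qed.

(** The defect [t = 1 - sqrt_itr n] is replaced by [t - t^2 / 2] at each step, which forces a decay
    like [2 / n]. *)
Lemma sqrt_itr_rate n : 1 - sqrt_itr n <= 2 / n.+1%:R.
Proof.
elim: n => [|n IH]; first by rewrite /= divr1; lra.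
have /andP[h1 h2] := sqrt_itr_bd n.
have n1 : 1 <= n.+1%:R :> R by rewrite ler1n.
have e : n.+2%:R = n.+1%:R + 1 :> R by rewrite -[in LHS]natr1.
rewrite e /=; move: IH; set m := n.+1%:R in n1 *; rewrite ler_pdivlMr; last lra.
move=> IH; rewrite ler_pdivlMr; last lra.
set t := 1 - sqrt_itr n in IH *.
have -> : sqrt_itr n = 1 - t by rewrite /t; lra.
have t0 : 0 <= t by rewrite /t; lra.
have t1 : t <= 1 by rewrite /t; lra.
have [ht|ht] := leP (t * (m + 1)) 2; first nra.
nra.
Qed.

Variable c : M.
Hypothesis sc : star c = c.
Hypothesis c1 : nle c 1.

Lemma sqrt_it_nle n : nle (sqrt_it c n) (sqrt_itr n).
Proof.
elim: n => [|n IH] /=; first exact: nle0.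
have /andP[h1 h2] := sqrt_itr_bd n.
by apply: nleZr; [lra|apply: nleD => //; exact: nleM].
Qed.

(** Symmetrised, so that it holds without [x] and [y] commuting. *)
Lemma sqr_diff x y : x * x - y * y =
  (2^-1)%:C *: ((x + y) * (x - y) + (x - y) * (x + y)).
Proof.
by nc.
Qed.

Lemma sqrt_it_step n : nle (sqrt_it c n.+1 - sqrt_it c n) (sqrt_itr n.+1 - sqrt_itr n).
Proof.
elim: n => [|n IH].
  rewrite /= subr0 subr0 !mulr0 !addr0; apply: nleZr => //; lra.
have -> : sqrt_it c n.+2 - sqrt_it c n.+1 =
  (2^-1)%:C *: (sqrt_it c n.+1 * sqrt_it c n.+1 - sqrt_it c n * sqrt_it c n).
  by rewrite [in LHS]/= -scalerBr opprD addrACA subrr add0r.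
have := sqrt_it_nle n.+1; have := sqrt_it_nle n.
have := sqrt_itr_bd n; have := sqrt_itr_bd n.+1; have := sqrt_itr_le n.
have : sqrt_itr n.+2 = 2^-1 * (1 + sqrt_itr n.+1 * sqrt_itr n.+1) by [].
have : sqrt_itr n.+1 = 2^-1 * (1 + sqrt_itr n * sqrt_itr n) by [].
move: IH; rewrite sqr_diff.
set x := sqrt_it c n.+1; set y := sqrt_it c n.
set r2 := sqrt_itr n.+2; set r1 := sqrt_itr n.+1; set r0 := sqrt_itr n.
move=> IH e1 e2 le1 /andP[b1 b2] /andP[b3 b4] hy hx.
have hD : nle (x + y) (r1 + r0) by exact: nleD.
apply: (@nle_le _ _ _ (2^-1 * (2^-1 * ((r1 + r0) * (r1 - r0) + (r1 - r0) * (r1 + r0))))).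
  by rewrite e2; nra.
apply: nleZr; first lra; apply: nleZr; first lra.
apply: nleD; apply: nleM => //; lra.
Qed.

Lemma sqrt_it_diff n k : nle (sqrt_it c (n + k) - sqrt_it c n) (sqrt_itr (n + k) - sqrt_itr n).
Proof.
elim: k => [|k IH]; first by rewrite addn0 !subrr; exact: nle0.
rewrite addnS -(subrK (sqrt_it c (n + k)) (sqrt_it c (n + k).+1)) -addrA.
rewrite -(subrK (sqrt_itr (n + k)) (sqrt_itr (n + k).+1)) -[X in nle _ X]addrA.
by apply: nleD => //; exact: sqrt_it_step.
Qed.

Lemma inv_nat_small e : 0 < e -> exists N, forall n, (N <= n)%N -> 2 / n.+1%:R <= e.
Proof.
move=> e0; exists (Num.truncn (2 / e)).+1 => n hn.
have h : 2 / e < n.+1%:R.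
  apply: (lt_le_trans (truncnS_gt _)); rewrite ler_nat.
  by rewrite (leq_trans hn).
by move: h; rewrite ltr_pdivrMr // => h; rewrite ler_pdivrMr //; lra.
Qed.

Lemma sqrt_it_cauchy e : 0 < e -> exists N, forall m n, (N <= m)%N -> (N <= n)%N ->
  nle (sqrt_it c m - sqrt_it c n) e.
Proof.
move=> /inv_nat_small[N hN]; exists N.
have key m n : (N <= n)%N -> (n <= m)%N -> nle (sqrt_it c m - sqrt_it c n) e.
  move=> hn /subnKC <-; apply: nle_le (sqrt_it_diff n (m - n)).
  have /andP[_ h] := sqrt_itr_bd (n + (m - n)).
  by apply: (le_trans _ (hN n hn)); apply: le_trans (sqrt_itr_rate n); rewrite lerB.
move=> m n hm hn; have [h|/ltnW h] := leqP n m; first exact: key.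
by apply: nle_sym; exact: key.
Qed.

Lemma one_sub_sqrt : exists U, [/\ star U = U, nle U 1, (1 - U) * (1 - U) = 1 - c &
  forall P, closed_alg P -> P c -> P U].
Proof.
have [U hU] := walg_complete sqrt_it_cauchy.
exists U.
have n1 : nle U 1.
  move=> u; apply/ler_addgt0Pr => e e0.
  have d0 : 0 < e / (hnm u + 1) by rewrite divr_gt0 //; have := hnm_ge0 u; lra.
  have [N /(_ N (leqnn _)) hN] := hU _ d0.
  rewrite -(subrK (sqrt_it c N) U) operDE (le_trans (hnmD _ _)) // addrC lerD //.
    apply: (le_trans (sqrt_it_nle N u)); apply: ler_wpM2r; first exact: hnm_ge0.
    by have /andP[] := sqrt_itr_bd N.
  apply: (le_trans (hN u)); rewrite mulrAC ler_pdivrMr; have := hnm_ge0 u; nra.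
split=> //.
- apply: star_lim => e /hU[N /(_ N (leqnn _)) hN]; exists (sqrt_it c N) => //.
  by elim: N {hN} => [|N IH] /=; [exact: star0|rewrite starZr starD starM IH sc].
- have e : U = (2^-1)%:C *: (c + U * U).
    apply/eqP; rewrite -subr_eq0; apply/eqP; apply: nle_small => r r0.
    have [N hN] := hU (r / 2) ltac:(lra).
    have hN1 := hN N (leqnn _); have hN2 := hN N.+1 (leqnSn _).
    have -> : U - (2^-1)%:C *: (c + U * U) = (U - sqrt_it c N.+1) -
       (2^-1)%:C *: (U * U - sqrt_it c N * sqrt_it c N).
      by rewrite [sqrt_it c N.+1]/=; nc.
    rewrite sqr_diff.
    have hM : nle (U + sqrt_it c N) 2.
      rewrite (_ : 2 = 1 + 1) //; apply: nleD => //.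
      apply: nle_le (sqrt_it_nle N); by have /andP[] := sqrt_itr_bd N.
    apply: (@nle_le _ _ _ (r / 2 + 2^-1 * (2^-1 * (2 * (r / 2) + (r / 2) * 2)))); first lra.
    apply: nleB => //; apply: nleZr; first lra; apply: nleZr; first lra.
    by apply: nleD; apply: nleM => //; lra.
  rewrite mulrBl !mulrBr !mul1r !mulr1.
  have e2 : U + U = c + U * U.
    rewrite {1 2}e -scalerDl -rmorphD.
    by rewrite (_ : 2^-1 + 2^-1 = 1) ?rmorph1 ?scale1r //; lra.
  have -> : U * U = U + U - c by rewrite e2 addrC addKr.
  by nc.
- move=> P hP Pc; apply: (clL hP) => e /hU[N /(_ N (leqnn _)) hN].
  exists (sqrt_it c N) => //; elim: N {hN} => [|N IH] /=.
    by rewrite -(subrr 1); apply: clB => //; exact: cl1.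
  by apply: (clZ hP); apply: (clD hP) => //; exact: clM.
Qed.

End square_roots.

(** * Square roots, positivity tests and inverses by means of the trace *)

Section trace_positivity.
Context {R : realType} {A : wprob_space R}.
Local Notation M := (walg A).
Implicit Types (x y z p h : M) (P B D : M -> Prop) (r s e : R).

Lemma rtrD x y : rtr (x + y) = rtr x + rtr y.
Proof. by rewrite /rtr trD raddfD. Qed.
Lemma rtrN x : rtr (- x) = - rtr x.
Proof. by rewrite /rtr trN raddfN. Qed.
Lemma rtrB x y : rtr (x - y) = rtr x - rtr y.
Proof. by rewrite rtrD rtrN. Qed.
Lemma rtrZ r x : rtr (r%:C *: x) = r * rtr x.
Proof. by rewrite /rtr trZ ReM_real. Qed.
Lemma rtr0 : rtr (0 : M) = 0.
Proof. by rewrite /rtr tr0. Qed.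
Lemma rtr1 : rtr (1 : M) = 1.
Proof. by rewrite /rtr tr1. Qed.
Lemma rtrC x y : rtr (x * y) = rtr (y * x).
Proof. by rewrite /rtr trC. Qed.
Lemma rtr_star x : rtr (star x) = rtr x.
Proof. by rewrite /rtr tr_star; case: (tr x). Qed.
Lemma rtr_ge0 x : 0 <= rtr (star x * x).
Proof. by have := tr_ge0 x; rewrite lecE /= => /andP[]. Qed.
Lemma tr_sa x : star x = x -> tr x = (rtr x)%:C.
Proof.
move=> sx; have := tr_star x; rewrite sx /rtr; case: (tr x) => a b [] hb.
by apply/eqP; rewrite eq_complex /= eqxx /=; apply/eqP; lra.
Qed.
Lemma rtr_eq0 x : rtr (star x * x) = 0 -> x = 0.
Proof.
move=> h; apply: tr_eq0; rewrite tr_sa ?h //.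
by rewrite starM starK.
Qed.

(** Division by a norm bound [L] makes [c = 1 - p / L] an element of norm at most 1. The iteration
    gives [U] with [(1 - U)^2 = p / L], and the root is [sqrt L (1 - U)]. *)
Lemma pos_sqrt p : pos p -> exists q, [/\ pos q, q * q = p &
  forall P, closed_alg P -> P p -> P q].
Proof.
move=> pp; have sp : star p = p by case: pp.
have [L L0 hL] := nle_ex p.
pose c := 1 - (L^-1)%:C *: p.
have sc : star c = c by rewrite /c starB starZr star1 sp.
have hc : nle c 1.
  apply: pos_nle => //; rewrite rmorph1 scale1r /c.
    by rewrite opprB addrC subrK; apply: posZ => //; rewrite invr_ge0 ltW.
  have := posZ (_ : 0 <= L^-1) (nle_pos_sub sp hL).
  rewrite invr_ge0 ltW // => /(_ isT); rewrite scalerBr scalerA -rmorphM.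
  rewrite mulVf ?gt_eqF // rmorph1 scale1r => h.
  by apply: posD => //; exact: pos1.
have [U [sU nU eU hU]] := one_sub_sqrt sc hc.
have pU : pos (1 - U).
  by have := nle_pos_sub sU nU; rewrite rmorph1 scale1r.
exists ((Num.sqrt L)%:C *: (1 - U)); split.
- by apply: posZ => //; rewrite sqrtr_ge0.
- rewrite -scalerAl -scalerAr eU /c opprB addrC subrK !scalerA -!rmorphM.
  by rewrite -expr2 sqr_sqrtr ?ltW // divff ?gt_eqF // rmorph1 scale1r.
- move=> P hP Pp; apply: (clZ hP); apply: (clB hP); first exact: cl1.
  apply: hU => //; apply: clB => //; first exact: cl1.
  exact: clZ.
Qed.

Lemma rtr_pos p : pos p -> 0 <= rtr p.
Proof.
by move=> /pos_sqrt[q [[sq _] <- _]]; rewrite -{1}sq; exact: rtr_ge0.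
Qed.

(** [p q] itself need not be positive, but with [p = s s] its trace is that of [s q s]. *)
Lemma rtr_posM p q : pos p -> pos q -> 0 <= rtr (p * q).
Proof.
move=> /pos_sqrt[s [[ss _] <- _]] hq.
rewrite -mulrA rtrC -{1}ss -mulrA; apply: rtr_pos; rewrite mulrA.
exact: pos_conj.
Qed.

Lemma rtr_nle x r : nle x r -> rtr x <= r.
Proof.
move=> hx; pose y := (2^-1)%:C *: (x + star x).
have hy : nle y r.
  rewrite [r](_ : _ = 2^-1 * (r + r)); last by field.
  by apply: nleZr; [lra|apply: nleD => //; exact: nle_star].
have sy : star y = y by rewrite /y starZr starD starK addrC.
have := rtr_pos (nle_pos_sub sy hy); rewrite rtrB rtrZ rtr1 mulr1 /y rtrZ rtrD.
by rewrite rtr_star; lra.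
Qed.

Lemma sqr0_sa x : star x = x -> x * x = 0 -> x = 0.
Proof. by move=> sx h; apply: rtr_eq0; rewrite sx h rtr0. Qed.

(* Elements approximable by multipliers of D form a closed algebra, so the
   negative part of h may be used as a test element. *)
Lemma pos_test D h : star h = h -> D 1 ->
  (forall x y, D x -> D y -> D (x + y)) -> (forall r x, D x -> D (r%:C *: x)) ->
  (forall x, D x -> D (h * x)) ->
  (forall y, D y -> 0 <= rtr (star y * h * y)) -> pos h.
Proof.
move=> sh D1 DD DZ Dh hD.
pose P x := forall e, 0 < e -> exists2 y, (forall z, D z -> D (y * z)) & nle (x - y) e.
have hP : closed_alg P.
  split.
  - move=> e e0; exists 1; first by move=> z; rewrite mul1r.
    by rewrite subrr; apply: nle0; exact: ltW.
  - move=> x y hx hy e e0; have e2 : 0 < e / 2 by lra.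
    have [a ha xa] := hx _ e2; have [b hb yb] := hy _ e2; exists (a + b).
      by move=> z Dz; rewrite mulrDl; apply: DD; [exact: ha|exact: hb].
    rewrite [e]splitr; have -> : x + y - (a + b) = (x - a) + (y - b) by nc.
    exact: nleD.
  - move=> r x hx e e0.
    have r1 : 0 < `|r| + 1 by have := normr_ge0 r; lra.
    have [a ha xa] := hx (e / (`|r| + 1)) ltac:(by rewrite divr_gt0).
    exists (r%:C *: a); first by move=> z Dz; rewrite -scalerAl; apply: DZ; exact: ha.
    rewrite -scalerBr; apply: nle_le (nleZ r%:C xa).
    rewrite normc_def /= expr0n addr0 sqrtr_sqr mulrA ler_pdivrMr //.
    by rewrite mulrC ler_wpM2l ?ltW //; lra.
  - move=> x y hx hy e e0.
    have [L L0 hL] := nle_ex x; have [K K0 hK] := nle_ex y.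
    pose d := e / (L + K + e + 1).
    have d0 : 0 < d by rewrite divr_gt0 //; lra.
    have [a ha xa] := hx _ d0; have [b hb yb] := hy _ d0; exists (a * b).
      by move=> z Dz; rewrite -mulrA; apply: ha; exact: hb.
    have -> : x * y - a * b = (x - a) * y + x * (y - b) - (x - a) * (y - b) by nc.
    apply: (@nle_le _ _ _ (d * K + L * d + d * d)).
      have d1 : d <= e.
        rewrite /d ler_pdivrMr; last lra. by nra.
      have : d * (L + K + e + 1) = e by rewrite /d mulfVK // gt_eqF //; lra.
      by nra.
    by apply: nleB; [apply: nleD|]; apply: nleM => //; exact: ltW.
  - move=> x hx e e0; have e2 : 0 < e / 2 by lra.
    have [y hy xy] := hx _ e2; have [z hz yz] := hy _ e2; exists z => //.
    rewrite [e]splitr; have -> : x - z = (x - y) + (y - z) by nc.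
    exact: nleD.
have Ph : P h.
  by move=> e e0; exists h => //; rewrite subrr; apply: nle0; exact: ltW.
have Pge x : P x -> 0 <= rtr (star x * h * x).
  move=> Px; rewrite leNgt; apply/negP => lt0.
  have [L L0 hL] := nle_ex x; have [K K0 hK] := nle_ex h.
  pose e := - rtr (star x * h * x).
  have e0 : 0 < e by rewrite /e oppr_gt0.
  pose d := e / (2 * L * K + K * e + e + 1).
  have den : 0 < 2 * L * K + K * e + e + 1.
    by have := mulr_gt0 L0 K0; have := mulr_gt0 K0 e0; nra.
  have d0 : 0 < d by rewrite divr_gt0.
  have [a ha xa] := Px _ d0.
  have := hD _ (ha _ D1); rewrite mulr1 => h1.
  have : nle (star a * h * a - star x * h * x) (d * K * L + L * K * d + d * K * d).
    have -> : star a * h * a - star x * h * x =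
      - (star (x - a) * h * x) - (star x * h * (x - a)) + star (x - a) * h * (x - a).
      by rewrite starB; nc.
    have xa' : nle (star (x - a)) d by exact: nle_star.
    have hL' : nle (star x) L by exact: nle_star.
    have dK : 0 <= d * K by rewrite mulr_ge0 ?ltW.
    have LK : 0 <= L * K by rewrite mulr_ge0 ?ltW.
    apply: nleD; [apply: nleB; [apply: nleN|]|]; apply: nleM => //; apply: nleM => //; exact: ltW.
  move=> /rtr_nle; rewrite rtrB.
  have : d * (2 * L * K + K * e + e + 1) = e by rewrite /d mulfVK // gt_eqF.
  have d1 : d <= 1 by rewrite /d ler_pdivrMr // mul1r; have := mulr_gt0 L0 K0; have := mulr_gt0 K0 e0; nra.
  have de : d <= e by rewrite /d ler_pdivrMr //; have := mulr_gt0 L0 K0; have := mulr_gt0 K0 e0; nra.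
  have := mulr_gt0 L0 K0; rewrite -/e in h1 *.
  move=> LK de2 h2.
  have : d * K * d <= d * K * e by rewrite ler_wpM2l // mulr_ge0 ?ltW.
  nra.
(* [a] is the modulus of [h] and [n = a - h] is twice its negative part. Since [n n = 2 n a], one
   gets [n h n = - n a n], whose trace is nonnegative because [n] is a limit of multipliers; hence
   [n] vanishes and [h = a]. *)
have hh : pos (h * h) by rewrite -{1}sh; exact: pos_star_mul.
have [a [pa aa hPa]] := pos_sqrt hh.
have sa : star a = a by case: pa.
have Pa : P a := hPa P hP (clM hP Ph Ph).
have cah : a * h = h * a.
  by apply: (hPa _ (commutant_closed h)); rewrite mulrA.
have [v [pv vv hPv]] := pos_sqrt pa.
have sv : star v = v by case: pv.
pose n := a - h.
have sn : star n = n by rewrite /n starB sa sh.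
have Pn : P n := clB hP Pa Ph.
have nn : n * n = 2%:C *: (n * a).
  have -> : n * n = n * (2%:C *: a) - (a * a - h * h) - (a * h - h * a).
    by rewrite /n; nc.
  by rewrite aa cah !subrr !subr0 -scalerAr.
have nhn : star n * h * n = - (star (v * n) * (v * n)).
  rewrite starM sv sn -[RHS]mulNr.
  have -> : n * h * n = n * a * n - n * n * n by rewrite /n; nc.
  by rewrite nn -vv; nc.
have vn : v * n = 0.
  apply: rtr_eq0; apply/eqP; rewrite eq_le rtr_ge0 andbT -oppr_ge0 -rtrN -nhn.
  exact: Pge.
have n3 : n * n * n = 0.
  by rewrite nn -vv -scalerAl -!mulrA vn !mulr0 scaler0.
have n2 : n * n = 0.
  by apply: sqr0_sa; [rewrite starM sn|rewrite mulrA n3 mul0r].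
have n0 : n = 0 by apply: sqr0_sa.
by have -> : h = a by apply/eqP; rewrite eq_sym -subr_eq0 -/n n0.
Qed.

Lemma geometric_small (q e : R) : 0 <= q -> q < 1 -> 0 < e ->
  exists N, forall n, (N <= n)%N -> q ^+ n <= e.
Proof.
move=> q0 q1 e0.
have /cvgrPdist_le /(_ _ e0)[N _ hN] := @cvg_expr R q ltac:(by rewrite ger0_norm).
exists N => n /hN; rewrite sub0r normrN ger0_norm // exprn_ge0 //.
Qed.

Lemma pos_lower x r u : pos (x - r%:C *: 1) -> r * hnm u ^+ 2 <= rdot (oper x u) u.
Proof.
by move=> [_ /(_ u)]; rewrite operBE rdotBl operZE rdotZl oper1E rdot_sqr subr_ge0.
Qed.

(** Neumann series in [c = 1 - h / L], of norm at most [q = 1 - g / L < 1]. The bound [g^-1] does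
    not come from the series but from the lower bound on [h], once the inverse exists. *)
Lemma pos_inv h g : 0 < g -> star h = h -> pos (h - g%:C *: 1) ->
  exists G, [/\ G * h = 1, h * G = 1, pos G, nle G g^-1 &
    forall P, closed_alg P -> P h -> P G].
Proof.
move=> g0 sh hg.
have [L' L'0 hL'] := nle_ex h.
pose L := L' + g; have L0 : 0 < L by rewrite /L; lra.
have gL : g < L by rewrite /L; lra.
have hL : nle h L by apply: nle_le hL'; rewrite /L; lra.
pose c := 1 - (L^-1)%:C *: h; pose q := 1 - g / L.
have q0 : 0 < q by rewrite /q subr_gt0 ltr_pdivrMr // mul1r.
have q1 : q < 1 by rewrite /q gtrBl divr_gt0.
have L1 : 0 <= L^-1 by rewrite invr_ge0 ltW.
have hc : nle c q.
  apply: pos_nle => //.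
    have -> : q%:C *: 1 - c = (L^-1)%:C *: (h - g%:C *: 1).
      by rewrite /q /c; nc.
    exact: posZ.
  have -> : q%:C *: 1 + c = (L^-1)%:C *: (L%:C *: 1 - h) + q%:C *: 1.
    rewrite /c scalerBr scalerA -rmorphM mulVf ?gt_eqF // rmorph1 scale1r.
    by rewrite addrC.
  by apply: posD; [apply: posZ => //; exact: nle_pos_sub|apply: pos_real; exact: ltW].
pose F := fix F n : M := if n is m.+1 then 1 + c * F m else 0.
have stepF n : nle (F n.+1 - F n) (q ^+ n).
  elim: n => [|n IH].
    by rewrite /= mulr0 addr0 subr0 expr0; exact: nle1.
  have -> : F n.+2 - F n.+1 = c * (F n.+1 - F n) by rewrite /=; nc.
  by rewrite exprS; apply: nleM => //; exact: ltW.
have diffF n k : nle (F (n + k)%N - F n) ((q ^+ n - q ^+ (n + k)) / (1 - q)).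
  elim: k => [|k IH]; first by rewrite addn0 !subrr mul0r; exact: nle0.
  rewrite addnS.
  have -> : F (n + k).+1 - F n = (F (n + k).+1 - F (n + k)%N) + (F (n + k)%N - F n) by nc.
  apply: (@nle_le _ _ _ (q ^+ (n + k) + (q ^+ n - q ^+ (n + k)) / (1 - q))).
    rewrite le_eqVlt; apply/orP; left; apply/eqP; rewrite exprS; field; lra.
  by apply: nleD.
have cauchyF e : 0 < e -> exists N, forall m n, (N <= m)%N -> (N <= n)%N ->
    nle (F m - F n) e.
  move=> e0; have [|N' hN'] := geometric_small (ltW q0) q1 (_ : 0 < e * (1 - q)).
    by rewrite mulr_gt0 //; lra.
  exists N'.
  have key m n : (N' <= n)%N -> (n <= m)%N -> nle (F m - F n) e.
    move=> hn /subnKC <-; apply: nle_le (diffF n (m - n)%N).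
    rewrite ler_pdivrMr; last by lra.
    have := hN' n hn; have := exprn_ge0 (n + (m - n)) (ltW q0); lra.
  move=> m n hm hn; have [h'|/ltnW h'] := leqP n m; first exact: key.
  by apply: nle_sym; exact: key.
have [G0 hG0] := walg_complete cauchyF.
have eG : G0 = 1 + c * G0.
  apply/eqP; rewrite -subr_eq0; apply/eqP; apply: nle_small => r r0.
  have [N hN] := hG0 (r / 2) ltac:(lra).
  have hN1 := hN N (leqnn _); have hN2 := hN N.+1 (leqnSn _).
  have -> : G0 - (1 + c * G0) = (G0 - F N.+1) - c * (G0 - F N) by rewrite /=; nc.
  apply: (@nle_le _ _ _ (r / 2 + q * (r / 2))); first by nra.
  by apply: nleB => //; apply: nleM => //; exact: ltW.
have hPG P : closed_alg P -> P h -> P G0.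
  move=> hP Ph; apply: (clL hP) => e /hG0[N /(_ N (leqnn _)) hN].
  have P1 : P 1 by exact: cl1.
  exists (F N) => //; elim: N {hN} => [|N IH] /=.
    by rewrite -(subrr 1); apply: clB.
  apply: (clD hP) => //; apply: (clM hP) => //; apply: clB => //.
  exact: clZ.
pose G := (L^-1)%:C *: G0.
have hG : h * G = 1.
  rewrite /G; have -> : h * ((L^-1)%:C *: G0) = G0 - c * G0 by rewrite /c; nc.
  by rewrite {1}eG addrK.
have Gh : G * h = 1.
  have ch : G0 * h = h * G0 by apply: (hPG _ (commutant_closed h)).
  by rewrite -hG /G -scalerAl -scalerAr ch.
have sG : star G = G.
  have e : star G * star h = 1 by rewrite -starM hG star1.
  by rewrite -[LHS]mulr1 -hG mulrA; rewrite sh in e; rewrite e mul1r.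
exists G; split => //.
- split=> // u; have := pos_lower (oper G u) hg; rewrite -operME hG oper1E.
  rewrite rdotC => h1; apply: le_trans h1.
  by rewrite mulr_ge0 ?sqr_ge0 ?ltW.
- move=> u; have := pos_lower (oper G u) hg; rewrite -operME hG oper1E => h1.
  have h2 := le_trans h1 (rdot_cs _ _).
  have := hnm_ge0 (oper G u); rewrite le_eqVlt => /orP[/eqP<-|p0].
    by rewrite mulr_ge0 ?hnm_ge0 // invr_ge0 ltW.
  move: h2; rewrite expr2 mulrA ler_pM2r // => h2.
  by rewrite mulrC ler_pdivlMr // mulrC.
- by move=> P hP Ph; apply: (clZ hP); exact: hPG.
Qed.

End trace_positivity.

(** * The L2 inner product *)

Section l2_structure.
Context {R : realType} {A : wprob_space R}.
Local Notation M := (walg A).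
Implicit Types (x y z p h : M) (P B D : M -> Prop) (r s e : R).

Definition ip x y : R := rtr (star x * y).
Definition n2 x : R := ip x x.

Lemma ipC x y : ip x y = ip y x.
Proof. by rewrite /ip -rtr_star starM starK. Qed.
Lemma ipDl x y z : ip (x + y) z = ip x z + ip y z.
Proof. by rewrite /ip starD mulrDl rtrD. Qed.
Lemma ipDr x y z : ip x (y + z) = ip x y + ip x z.
Proof. by rewrite /ip mulrDr rtrD. Qed.
Lemma ipNl x y : ip (- x) y = - ip x y.
Proof. by rewrite /ip starN mulNr rtrN. Qed.
Lemma ipNr x y : ip x (- y) = - ip x y.
Proof. by rewrite /ip mulrN rtrN. Qed.
Lemma ipBl x y z : ip (x - y) z = ip x z - ip y z.
Proof. by rewrite ipDl ipNl. Qed.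
Lemma ipBr x y z : ip x (y - z) = ip x y - ip x z.
Proof. by rewrite ipDr ipNr. Qed.
Lemma ipZl r x y : ip (r%:C *: x) y = r * ip x y.
Proof. by rewrite /ip starZr -scalerAl rtrZ. Qed.
Lemma ipZr r x y : ip x (r%:C *: y) = r * ip x y.
Proof. by rewrite /ip -scalerAr rtrZ. Qed.
Lemma ip0l x : ip 0 x = 0.
Proof. by rewrite /ip star0 mul0r rtr0. Qed.
Lemma ip0r x : ip x 0 = 0.
Proof. by rewrite /ip mulr0 rtr0. Qed.
Lemma ipM x y z : ip (x * y) z = ip y (star x * z).
Proof. by rewrite /ip starM mulrA. Qed.
Lemma ip1 x : ip 1 x = rtr x.
Proof. by rewrite /ip star1 mul1r. Qed.

Lemma n2_ge0 x : 0 <= n2 x.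
Proof. exact: rtr_ge0. Qed.
Lemma n2_eq0 x : n2 x = 0 -> x = 0.
Proof. exact: rtr_eq0. Qed.
Lemma n2_0 : n2 0 = 0.
Proof. exact: ip0l. Qed.
Lemma n2_1 : n2 1 = 1.
Proof. by rewrite /n2 ip1 rtr1. Qed.
Lemma n2N x : n2 (- x) = n2 x.
Proof. by rewrite /n2 ipNl ipNr opprK. Qed.
Lemma n2Z r x : n2 (r%:C *: x) = r ^+ 2 * n2 x.
Proof. by rewrite /n2 ipZl ipZr mulrA. Qed.
Lemma n2_star x : n2 (star x) = n2 x.
Proof. by rewrite /n2 /ip starK rtrC. Qed.
Lemma n2DE x y : n2 (x + y) = n2 x + n2 y + 2 * ip x y.
Proof. by rewrite /n2 ipDl !ipDr (ipC y x); ring. Qed.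
Lemma n2BE x y : n2 (x - y) = n2 x + n2 y - 2 * ip x y.
Proof. by rewrite n2DE n2N ipNr mulrN. Qed.
Lemma n2D_le x y : n2 (x + y) <= 2 * (n2 x + n2 y).
Proof. by have := n2_ge0 (x - y); rewrite n2BE n2DE; lra. Qed.
Lemma n2B_le x y : n2 (x - y) <= 2 * (n2 x + n2 y).
Proof. by rewrite -(n2N y); exact: n2D_le. Qed.

Lemma ip_cs x y : ip x y ^+ 2 <= n2 x * n2 y.
Proof.
have [e|n0] := eqVneq (n2 y) 0.
  by rewrite (n2_eq0 e) ip0r expr0n /= n2_0 mulr0.
have p : 0 < n2 y by rewrite lt_neqAle eq_sym n0 n2_ge0.
have := n2_ge0 ((n2 y)%:C *: x - (ip x y)%:C *: y).
rewrite n2BE !n2Z ipZl ipZr => h.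
rewrite -(ler_pM2l p); nra.
Qed.

Lemma ip_pos_ge0 p y : pos p -> 0 <= ip y (p * y).
Proof.
by move=> hp; rewrite /ip mulrA; apply: rtr_pos; exact: pos_conj.
Qed.

Lemma n2_mull b r x : 0 <= r -> nle b r -> n2 (b * x) <= r ^+ 2 * n2 x.
Proof.
move=> r0 hb; have : pos ((r ^+ 2)%:C *: 1 - star b * b).
  by split; [rewrite starB starZr star1 starM starK|apply/nle_sqP].
move=> /(ip_pos_ge0 x); rewrite mulrBl ipBr -scalerAl mul1r ipZr.
by rewrite (_ : ip x (star b * b * x) = n2 (b * x)) ?subr_ge0 // /n2 ipM mulrA.
Qed.

Lemma n2_mulr b r x : 0 <= r -> nle b r -> n2 (x * b) <= r ^+ 2 * n2 x.
Proof.
move=> r0 /nle_star hb; rewrite -n2_star starM -(n2_star x).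
exact: n2_mull.
Qed.

Lemma n2_nle x r : 0 <= r -> nle x r -> n2 x <= r ^+ 2.
Proof. by move=> r0 h; have := n2_mull 1 r0 h; rewrite mulr1 n2_1 mulr1. Qed.

(* The operator-norm unit ball of self-adjoint elements is closed in L2. *)
Lemma pos_l2_lim h : star h = h ->
  (forall e, 0 < e -> exists2 p, pos p & n2 (h - p) <= e) -> pos h.
Proof.
move=> sh hh; apply: (@pos_test _ _ (fun=> True)) => // y _.
rewrite leNgt; apply/negP => lt0.
have [L L0 hL] := nle_ex y.
pose d := - rtr (star y * h * y).
have d0 : 0 < d by rewrite /d oppr_gt0.
have [p hp hd] := hh (d ^+ 2 / (2 * L ^+ 4)) ltac:(by rewrite divr_gt0 ?mulr_gt0 ?exprn_gt0).
have p0 := rtr_pos (pos_conj y hp).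
have : rtr (star y * (p - h) * y) ^+ 2 <= L ^+ 4 * n2 (h - p).
  rewrite -mulrA -/(ip y _); apply: (le_trans (ip_cs _ _)).
  have h1 := n2_nle (ltW L0) hL.
  have h2 := n2_mulr (p - h) (ltW L0) hL.
  have -> : n2 (h - p) = n2 (p - h) by rewrite -opprB n2N.
  have -> : L ^+ 4 * n2 (p - h) = L ^+ 2 * (L ^+ 2 * n2 (p - h)) by ring.
  have := n2_ge0 y; have := n2_ge0 ((p - h) * y).
  move=> h3 h4.
  by apply: ler_pM.
have -> : rtr (star y * (p - h) * y) = rtr (star y * p * y) + d.
  by rewrite mulrBr mulrBl rtrB /d.
move=> h1; have h2 : L ^+ 4 * n2 (h - p) <= d ^+ 2 / 2.
  apply: (le_trans (ler_wpM2l _ hd)); first by rewrite exprn_ge0 // ltW.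
  suff -> : L ^+ 4 * (d ^+ 2 / (2 * L ^+ 4)) = d ^+ 2 / 2 by [].
  by field; rewrite gt_eqF.
have := exprn_gt0 2 d0; have := mulr_ge0 p0 (ltW d0); nra.
Qed.

(** A uniform norm bound survives although the approximation is only in L2. This is how the
    martingale estimate reaches the Riemann sums. *)
Lemma nle_l2_lim x r : star x = x -> 0 < r ->
  (forall e, 0 < e -> exists y, [/\ star y = y, nle y r & n2 (x - y) <= e]) -> nle x r.
Proof.
move=> sx r0 hx; apply: pos_nle => //; apply: pos_l2_lim.
- by rewrite starB starZr star1 sx.
- move=> e /hx[y [sy ny hy]]; exists (r%:C *: 1 - y); first exact: nle_pos_sub.
  have -> : r%:C *: 1 - x - (r%:C *: 1 - y) = - (x - y) by nc.
  by rewrite n2N.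
- by rewrite starD starZr star1 sx.
- move=> e /hx[y [sy ny hy]]; exists (r%:C *: 1 + y); first exact: nle_pos_add.
  by have -> : r%:C *: 1 + x - (r%:C *: 1 + y) = x - y by nc.
Qed.

(** Compared with [closed_alg], adjoints and complex scalars are added. They could not be asked of
    [closed_alg], since the commutant of a single element need not contain adjoints. *)
Record subalg B : Prop := Subalg {
  sub1 : B 1;
  subD : forall x y, B x -> B y -> B (x + y);
  subZ : forall c x, B x -> B (c *: x);
  subM : forall x y, B x -> B y -> B (x * y);
  sub_star : forall x, B x -> B (star x);
  subL : forall x, (forall e, 0 < e -> exists2 y, B y & nle (x - y) e) -> B x }.

Lemma subalg_closed B : subalg B -> closed_alg B.
Proof. by case=> h1 hD hZ hM _ hL; split => // r x; exact: hZ. Qed.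

Lemma subN B : subalg B -> forall x, B x -> B (- x).
Proof. by move=> hB x Bx; rewrite -scaleN1r; exact: subZ. Qed.
Lemma subB B : subalg B -> forall x y, B x -> B y -> B (x - y).
Proof. by move=> hB x y Bx By; apply: subD => //; exact: subN. Qed.
Lemma sub0 B : subalg B -> B 0.
Proof. by move=> hB; rewrite -(scale0r 1); apply: subZ => //; exact: sub1. Qed.

Lemma star_oper (V : set (op A)) (hV : von_neumann_algebra V) x :
  V (oper x) -> V (oper (star x)).
Proof.
move=> /(vN_star hV)[S VS hS]; suff -> : oper (star x) = S by [].
apply/funext => v; apply: hdot_eq => z.
by rewrite hdotC -starP hS -hdotC.
Qed.

Lemma vN_subalg (V : set (op A)) : von_neumann_algebra V -> subalg (fun x => V (oper x)).
Proof.
move=> hV; split.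
- exact: vN_id.
- by move=> x y hx hy; have := vN_lin hV 1 hx hy; rewrite scale1r.
- move=> c x hx.
  have h0 : V (0 : op A).
    by have := vN_lin hV (-1) (vN_id hV) (vN_id hV); rewrite scaleN1r addNr.
  by have := vN_lin hV c hx h0; rewrite addr0.
- by move=> x y; exact: vN_comp.
- by move=> x; exact: star_oper.
- move=> x hx; apply: (vN_closed hV) => e /hx[y Vy hy].
  by exists (oper y).
Qed.

Definition generated (G : set (op A)) : M -> Prop := fun x => vN_generated G (oper x).

Lemma generated_subalg G : subalg (generated G).
Proof.
split.
- by move=> V hV _; exact: vN_id.
- by move=> x y hx hy V hV hG; apply: (subD (vN_subalg hV)); [exact: hx|exact: hy].
- by move=> c x hx V hV hG; apply: (subZ (vN_subalg hV)); exact: hx.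
- by move=> x y hx hy V hV hG; apply: (subM (vN_subalg hV)); [exact: hx|exact: hy].
- by move=> x hx V hV hG; apply: (sub_star (vN_subalg hV)); exact: hx.
- move=> x hx V hV hG; apply: (subL (vN_subalg hV)) => e /hx[y hy xy].
  by exists y => //; exact: hy.
Qed.

End l2_structure.

(** * Chebyshev polynomials and creation operators *)

Section chebyshev.
Context {R : realType}.
Implicit Types (d : R) (p q : {poly R}).

(* cheb d n is d^(n/2) U_n(x / (2 sqrt d)), with U_n the Chebyshev polynomials
   of the second kind: the monic orthogonal polynomials of the semicircle law of
   variance d. *)
Fixpoint cheb2 d n : {poly R} * {poly R} :=
  if n is m.+1 then ((cheb2 d m).2, 'X * (cheb2 d m).2 - d *: (cheb2 d m).1)
  else (1, 'X).
Definition cheb d n := (cheb2 d n).1.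

Lemma cheb0 d : cheb d 0 = 1. Proof. by []. Qed.
Lemma cheb1 d : cheb d 1 = 'X. Proof. by []. Qed.
Lemma chebSS d n : cheb d n.+2 = 'X * cheb d n.+1 - d *: cheb d n.
Proof. by []. Qed.

(** Two consecutive values of [m] are treated together because the recurrence has order two. In the
    Fock module this identity lowers the degree on both sides of an inner product at once. *)
Lemma cheb_lin d m n :
  cheb d m.+1 * cheb d n.+1 = cheb d (m + n).+2 + d *: (cheb d m * cheb d n).
Proof.
suff [] : cheb d m.+1 * cheb d n.+1 = cheb d (m + n).+2 + d *: (cheb d m * cheb d n) /\
   cheb d m.+2 * cheb d n.+1 = cheb d (m + n).+3 + d *: (cheb d m.+1 * cheb d n) by [].
elim: m => [|m [IH1 IH2]].
  split; first by rewrite cheb1 cheb0 mul1r add0n chebSS subrK.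
  rewrite !chebSS cheb1 cheb0 add0n -!mul_polyC; ring.
split; first by rewrite addSn.
rewrite (chebSS d m.+1) mulrBl -mulrA IH2 -scalerAl IH1 !addSn.
rewrite (chebSS d (m + n).+2) (chebSS d m) -!mul_polyC; ring.
Qed.

(** Expresses [(4 d - x^2) U'] without derivatives, which turns integration by parts into a
    recurrence between moments. *)
Lemma cheb_ode d n : (4 * d)%:P * (cheb d n.+1)^`() - 'X ^+ 2 * (cheb d n.+1)^`() =
  - (n.+1%:R *: ('X * cheb d n.+1)) + (2 * n.+2%:R * d) *: cheb d n.
Proof.
suff [] : (4 * d)%:P * (cheb d n.+1)^`() - 'X ^+ 2 * (cheb d n.+1)^`() =
  - (n.+1%:R *: ('X * cheb d n.+1)) + (2 * n.+2%:R * d) *: cheb d n /\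
  (4 * d)%:P * (cheb d n.+2)^`() - 'X ^+ 2 * (cheb d n.+2)^`() =
  - (n.+2%:R *: ('X * cheb d n.+2)) + (2 * n.+3%:R * d) *: cheb d n.+1 by [].
elim: n => [|n [IH1 IH2]].
  rewrite !chebSS cheb1 cheb0 !poly.derivE /= -!mul_polyC !rmorphM /= !rmorph_nat.
  by split; ring.
split=> //.
have e1 : (4 * d)%:P * (cheb d n.+3)^`() - 'X ^+ 2 * (cheb d n.+3)^`() =
   ((4 * d)%:P - 'X ^+ 2) * cheb d n.+2
   + 'X * ((4 * d)%:P * (cheb d n.+2)^`() - 'X ^+ 2 * (cheb d n.+2)^`())
   - d%:P * ((4 * d)%:P * (cheb d n.+1)^`() - 'X ^+ 2 * (cheb d n.+1)^`()).
  by rewrite (chebSS d n.+1) !poly.derivE /= -!mul_polyC; ring.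
rewrite e1 IH1 IH2.
have e2 : d%:P * cheb d n = 'X * cheb d n.+1 - cheb d n.+2.
  by rewrite (chebSS d n) -mul_polyC; ring.
have -> : (2 * n.+2%:R * d) *: cheb d n = (2 * n.+2%:R) *: ('X * cheb d n.+1 - cheb d n.+2).
  by rewrite -e2 -!mul_polyC; ring.
rewrite (chebSS d n.+1) -!mul_polyC !rmorphM /= !rmorph_nat.
ring.
Qed.

(** The last hypothesis is integration by parts against [(4 d - x^2)^(1/2)]. For [q = cheb d n.+1]
    it becomes [(n + 4) L (cheb d n.+2) = n d L (cheb d n)], whose right-hand side vanishes at
    [n = 0]; [q = 1] starts the odd indices. *)
Lemma cheb_moment d (L : {poly R} -> R) :
  (forall p q, L (p + q) = L p + L q) -> (forall r p, L (r *: p) = r * L p) ->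
  (forall q, L ((4 * d)%:P * q^`() - 'X ^+ 2 * q^`() - 3 *: ('X * q)) = 0) ->
  forall n, L (cheb d n.+1) = 0.
Proof.
move=> LD LZ LO.
have L1 : L (cheb d 1) = 0.
  have := LO 1; rewrite poly.derivE !mulr0 subrr sub0r -scaleNr LZ mulr1 cheb1.
  by move=> /eqP; rewrite mulf_eq0 oppr_eq0 pnatr_eq0 /= => /eqP.
have rec n : (n.+1 + 3)%:R * L (cheb d n.+2) = n%:R * (d * L (cheb d n)).
  have := LO (cheb d n.+1); rewrite cheb_ode.
  have -> : 'X * cheb d n.+1 = cheb d n.+2 + d *: cheb d n.
    by rewrite (chebSS d n) subrK.
  rewrite -!scaleNr !scalerDr !LD !LZ; rewrite natrD -[n.+2%:R]natr1 -natr1; lra.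
suff h n : L (cheb d n.+1) = 0 /\ L (cheb d n.+2) = 0 by move=> n; have [] := h n.
elim: n => [|n [IH1 IH2]]; split => //.
  have /eqP := rec 0%N; rewrite mul0r mulf_eq0 pnatr_eq0 /=; exact: eqP.
have /eqP := rec n.+1; rewrite IH1 !mulr0 mulf_eq0 pnatr_eq0 /=; exact: eqP.
Qed.

End chebyshev.

(** * Real polynomials in an operator *)

Section polynomial_calculus.
Context {R : realType} {A : wprob_space R}.
Local Notation M := (walg A).
Implicit Types (x y : M) (p q : {poly R}).

Definition peval p x : M := horner_alg x (map_poly (real_complex R) p).

Lemma pevalD p q x : peval (p + q) x = peval p x + peval q x.
Proof. by rewrite /peval !rmorphD. Qed.
Lemma pevalB p q x : peval (p - q) x = peval p x - peval q x.
Proof. by rewrite /peval !rmorphB. Qed.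
Lemma pevalM p q x : peval (p * q) x = peval p x * peval q x.
Proof. by rewrite /peval !rmorphM. Qed.
Lemma pevalZ r p x : peval (r *: p) x = r%:C *: peval p x.
Proof.
by rewrite /peval -mul_polyC rmorphM /= map_polyC /= rmorphM /= horner_algC -scalerAl mul1r. Qed.
Lemma peval1 x : peval 1 x = 1.
Proof. by rewrite /peval !rmorph1. Qed.
Lemma pevalX x : peval 'X x = x.
Proof. by rewrite /peval map_polyX horner_algX. Qed.
Lemma pevalC r x : peval r%:P x = r%:C *: 1.
Proof. by rewrite -[r%:P]mulr1 mul_polyC pevalZ peval1. Qed.
Lemma pevalXn p x n : peval (p ^+ n) x = peval p x ^+ n.
Proof. by rewrite /peval !rmorphXn. Qed.

Lemma peval_ind x (P : M -> Prop) : P 1 -> (forall a b, P a -> P b -> P (a + b)) ->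
  (forall (r : R) a, P a -> P (r%:C *: a)) -> (forall a, P a -> P (a * x)) ->
  forall p, P (peval p x).
Proof.
move=> P1 PD PZ PM p; elim/poly_ind: p => [|p c IH].
  by rewrite -(scale0r 1) pevalZ; apply: PZ; rewrite peval1.
rewrite pevalD pevalM pevalX pevalC; apply: PD; [exact: PM|exact: PZ].
Qed.

Lemma star_peval p x : star x = x -> star (peval p x) = peval p x.
Proof.
move=> sx.
suff [] : star (peval p x) = peval p x /\ peval p x * x = x * peval p x by [].
apply: (@peval_ind x (fun a => star a = a /\ a * x = x * a)) =>
  [|a b [h1 h2] [h3 h4]|r a [h1 h2]|a [h1 h2]].
- by rewrite star1 mul1r mulr1.
- by rewrite starD h1 h3 mulrDl mulrDr h2 h4.
- by rewrite starZr h1 -scalerAl -scalerAr h2.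
- by rewrite starM sx h1 mulrA h2.
Qed.

Lemma peval_closed (P : M -> Prop) p x : closed_alg P -> P x -> P (peval p x).
Proof.
move=> hP Px; apply: peval_ind => [|a b ha hb|r a ha|a ha].
- exact: cl1.
- exact: clD.
- exact: clZ.
- exact: clM.
Qed.

End polynomial_calculus.

(** * The creation operator of a free semicircular element *)

Section free_semicircular.
Context {R : realType} {A : wprob_space R}.
Local Notation M := (walg A).
Implicit Types (x y z w p b : M) (B : M -> Prop) (d : R).

(* lp y z says that z is the creation operator l* of s applied to y in the free
   Fock module over B; it is used as a relation to avoid a completion. *)
Record creation B s d (lp : M -> M -> Prop) : Prop := Creation {
  lpD : forall y z y' z', lp y z -> lp y' z' -> lp (y + y') (z + z');
  lpZ : forall c y z, lp y z -> lp (c *: y) (c *: z);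
  lp_base : forall b, B b -> lp b (s * b);
  lp_mull : forall b y z, B b -> lp y z -> exists z', lp (b * y) z';
  lp_mul : forall y z, lp y z -> exists z', lp (s * y) z';
  lp_adj : forall y z y' z', lp y z -> lp y' z' ->
    ip y' (s * y) = ip y' z + ip z' y;
  lp_dot : forall x y z y' z', B x -> star x = x -> lp y z -> lp y' z' ->
    ip z (x * z') = d * rtr x * ip y y';
  lp_next : forall x y z, B x -> lp y z -> exists z',
    lp (x * z) z' /\ s * (x * z) = z' + (d%:C * tr x) *: y;
  lp_orth : forall x y z, B x -> lp y z -> rtr (x * z) = 0 }.

Inductive alternating (B C : M -> Prop) : bool -> M -> Prop :=
  | alt_one c x : (if c then C x else B x) -> tr x = 0 -> alternating B C c x
  | alt_mul c x y : (if c then C x else B x) -> tr x = 0 ->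
      alternating B C (~~ c) y -> alternating B C c (x * y).

Definition free_from (B C : M -> Prop) := forall c x, alternating B C c x -> tr x = 0.

(** Linear combinations written as plain sums: scalars can be absorbed into the first factor. *)
Inductive alt_span (B C : M -> Prop) (c : bool) : M -> Prop :=
  | alt_span0 : alt_span B C c 0
  | alt_spanD x y : alternating B C c x -> alt_span B C c y -> alt_span B C c (x + y).

Variables (B : M -> Prop) (C : M -> Prop) (s : M) (d : R).
Hypothesis hB : subalg B.
Hypothesis hC : subalg C.
Hypothesis Cs : C s.
Hypothesis ss : star s = s.
Hypothesis hfree : free_from B C.
Local Notation U n := (peval (cheb d n) s).
Hypothesis hU : forall n, tr (U n.+1) = 0.
Local Notation alt := (alternating B C).
Local Notation sp := (alt_span B C).

Lemma alt_scale c k x : alt c x -> alt c (k *: x).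
Proof.
have h c' z : (if c' then C z else B z) -> if c' then C (k *: z) else B (k *: z).
  by case: c' => ?; apply: subZ.
case=> {c x} [c x hx tx|c x y hx tx hy].
  by apply: alt_one; [exact: h|rewrite trZ tx mulr0].
by rewrite scalerAl; apply: alt_mul => //; [exact: h|rewrite trZ tx mulr0].
Qed.

Lemma sp_tr c x : sp c x -> tr x = 0.
Proof.
by elim=> [|{}x y hx _ IH]; rewrite ?tr0 // trD IH (hfree hx) addr0.
Qed.

Lemma sp_scale c k x : sp c x -> sp c (k *: x).
Proof.
elim=> [|{}x y hx _ IH]; first by rewrite scaler0; exact: alt_span0.
by rewrite scalerDr; apply: alt_spanD => //; exact: alt_scale.
Qed.

Lemma spD c x y : sp c x -> sp c y -> sp c (x + y).
Proof.
move=> + hy; elim=> [|{}x z hx _ IH]; first by rewrite add0r.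
by rewrite -addrA; exact: alt_spanD.
Qed.

Lemma sp_alt c x : alt c x -> sp c x.
Proof. by move=> h; rewrite -[x]addr0; apply: alt_spanD => //; exact: alt_span0. Qed.

Lemma sp_mulB x y : B x -> tr x = 0 -> sp true y -> sp false (x * y).
Proof.
move=> Bx tx; elim=> [|{}y z hy _ IH]; first by rewrite mulr0; exact: alt_span0.
by rewrite mulrDr; apply: alt_spanD => //; exact: alt_mul.
Qed.

Lemma CU n : C (U n).
Proof. by apply: peval_closed => //; exact: subalg_closed. Qed.

Lemma sp_mulU n y : sp false y -> sp true (U n.+1 * y).
Proof.
elim=> [|{}y z hy _ IH]; first by rewrite mulr0; exact: alt_span0.
by rewrite mulrDr; apply: alt_spanD => //; apply: alt_mul => //; exact: CU.
Qed.

Lemma spU n : sp true (U n.+1).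
Proof. by apply: sp_alt; apply: alt_one => //; exact: CU. Qed.

(** All coefficients are centred except the last one. With this convention the products [U n * w]
    play the role of the elementary tensors of the Fock module, [U n] carrying the powers of [s] on
    the left. *)
Inductive word : M -> Prop :=
  | word_base b : B b -> word b
  | word_mul b n w : B b -> tr b = 0 -> word w -> word (b * U n.+1 * w).

Lemma word_split w : word w -> exists c y, w = c *: 1 + y /\ sp false y.
Proof.
elim=> [b Bb|b n {}w Bb tb _ [c [y [-> hy]]]].
  exists (tr b), (b - tr b *: 1); split; first by rewrite addrC subrK.
  apply: sp_alt; apply: alt_one.
    by apply: subB => //; apply: subZ => //; exact: sub1.
  by rewrite trB trZ tr1 mulr1 subrr.
exists 0, (c *: (b * U n.+1) + b * (U n.+1 * y)); split.
  by rewrite scale0r add0r mulrDr -scalerAr mulr1 mulrA.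
apply: spD; first by apply: sp_scale; apply: sp_mulB => //; exact: spU.
by apply: sp_mulB => //; exact: sp_mulU.
Qed.

Lemma sp_Uword n w : word w -> sp true (U n.+1 * w).
Proof.
move=> /word_split[c [y [-> hy]]]; rewrite mulrDr -scalerAr mulr1.
by apply: spD; [apply: sp_scale; exact: spU|exact: sp_mulU].
Qed.

(** The letters of [w] are moved onto [y] one after the other, and the product keeps alternating.
    Only the last letter may fail to be centred; it is split into its trace and a centred part. *)
Lemma word_orth w y : word w -> sp true y -> tr (star w * y) = 0.
Proof.
move=> hw; elim: hw y => {w} [b Bb|b n w Bb tb _ IH] y hy.
  have -> : star b * y = tr (star b) *: y + (star b - tr (star b) *: 1) * y by nc.
  have Bsb : B (star b) by exact: sub_star.
  rewrite trD trZ (sp_tr hy) mulr0 add0r; apply: (@sp_tr false).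
  apply: sp_mulB => //.
    by apply: subB => //; apply: subZ => //; exact: sub1.
  by rewrite trB trZ tr1 mulr1 subrr.
rewrite !starM star_peval // -!mulrA; apply: IH.
apply: sp_mulU; apply: sp_mulB => //; first exact: sub_star.
by rewrite tr_star tb conjc0.
Qed.

Lemma word_scale c w : word w -> word (c *: w).
Proof.
elim=> [b Bb|b n {}w Bb tb _ IH]; first by apply: word_base; exact: subZ.
by rewrite scalerAr; exact: word_mul.
Qed.

(** Graph of [U n w |-> U (n + 1) w], generated by sums. That it is single-valued is not built in:
    it follows from the isometry [lp_dot]. *)
Inductive fock_creation : M -> M -> Prop :=
  | fock_gen n w : word w -> fock_creation (U n * w) (U n.+1 * w)
  | fock_add y z y' z' : fock_creation y z -> fock_creation y' z' ->
      fock_creation (y + y') (z + z').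

Lemma U0 : U 0 = 1.
Proof. by rewrite cheb0 peval1. Qed.
Lemma U1 : U 1 = s.
Proof. by rewrite cheb1 pevalX. Qed.
Lemma sU n : s * U n.+1 = U n.+2 + d%:C *: U n.
Proof. by rewrite chebSS pevalB pevalM pevalX pevalZ subrK. Qed.
Lemma UU m n : U m.+1 * U n.+1 = U (m + n).+2 + d%:C *: (U m * U n).
Proof. by rewrite -!pevalM cheb_lin pevalD pevalZ. Qed.

Lemma fock_scale c y z : fock_creation y z -> fock_creation (c *: y) (c *: z).
Proof.
elim=> [n w hw|y1 z1 y2 z2 _ h1 _ h2]; last by rewrite !scalerDr; exact: fock_add.
by rewrite !scalerAr; apply: fock_gen; exact: word_scale.
Qed.

Lemma fock_word w : word w -> fock_creation w (s * w).
Proof. by move=> hw; have := fock_gen 0 hw; rewrite U0 U1 mul1r. Qed.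

Lemma centredB x : B x -> B (x - tr x *: 1) /\ tr (x - tr x *: 1) = 0.
Proof.
move=> Bx; split; last by rewrite trB trZ tr1 mulr1 subrr.
by apply: subB => //; apply: subZ => //; exact: sub1.
Qed.

(** The domain is stable under [B]. When [b] meets a power of [s] it is split into its trace and a
    centred letter; when it meets the first letter of a word, the product of the two has to be
    centred anew. *)
Lemma fock_mull b y z : B b -> fock_creation y z -> exists z', fock_creation (b * y) z'.
Proof.
move=> Bb; elim=> [n w hw|y1 z1 y2 z2 _ [z3 h1] _ [z4 h2]]; last first.
  by exists (z3 + z4); rewrite mulrDr; exact: fock_add.
case: n => [|n].
  rewrite U0 mul1r; case: hw => [b' Bb'|b' n {}w Bb' tb' hw].
    by exists (s * (b * b')); apply: fock_word; apply: word_base; exact: subM.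
  have [Bx tx] := centredB (subM hB Bb Bb').
  have -> : b * (b' * U n.+1 * w) = tr (b * b') *: (U n.+1 * w) +
     (b * b' - tr (b * b') *: 1) * U n.+1 * w by nc.
  by eexists; apply: fock_add; [apply: fock_scale; exact: fock_gen|
    apply: fock_word; exact: word_mul].
have [Bx tx] := centredB Bb.
have -> : b * (U n.+1 * w) = tr b *: (U n.+1 * w) + (b - tr b *: 1) * U n.+1 * w by nc.
by eexists; apply: fock_add; [apply: fock_scale; exact: fock_gen|
  apply: fock_word; exact: word_mul].
Qed.

Lemma fock_mul y z : fock_creation y z -> exists z', fock_creation (s * y) z'.
Proof.
elim=> [n w hw|y1 z1 y2 z2 _ [z3 h1] _ [z4 h2]]; last first.
  by exists (z3 + z4); rewrite mulrDr; exact: fock_add.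
rewrite mulrA; case: n => [|n].
  by rewrite U0 mulr1 -U1; eexists; exact: fock_gen.
rewrite sU mulrDl -scalerAl; eexists; apply: fock_add; first exact: fock_gen.
by apply: fock_scale; exact: fock_gen.
Qed.

(** Weak form of [s] being creation plus annihilation. The terms of highest degree are orthogonal to
    words, and what is left matches the product formula [UU] with the three-term recurrence [sU]. *)
Lemma fock_adj y z y' z' : fock_creation y z -> fock_creation y' z' ->
  ip y' (s * y) = ip y' z + ip z' y.
Proof.
move=> h h'; elim: h => {y z} [n w hw|y1 z1 y2 z2 _ h1 _ h2]; last first.
  by rewrite mulrDr !ipDr h1 h2; ring.
elim: h' => {y' z'} [m w' hw'|y1 z1 y2 z2 _ h1 _ h2]; last first.
  by rewrite !ipDl h1 h2; ring.
have e k y : ip (U k * w') y = rtr (star w' * (U k * y)).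
  by rewrite /ip starM star_peval // mulrA.
rewrite !e; case: n => [|n].
  rewrite U0 !mul1r U1.
  by rewrite [X in _ + X](_ : _ = 0) ?addr0 // /rtr word_orth //; exact: sp_Uword.
have -> : rtr (star w' * (U m.+1 * (U n.+1 * w))) =
   rtr (star w' * (U m * (d%:C *: (U n * w)))).
  have -> : star w' * (U m.+1 * (U n.+1 * w)) = star w' * (U (m + n).+2 * w) +
     star w' * (U m * (d%:C *: (U n * w))).
    by rewrite (mulrA (U m.+1)) UU; nc.
  by rewrite /rtr trD word_orth ?add0r //; exact: sp_Uword.
by rewrite -rtrD -!mulrDr (mulrA s) sU mulrDl -scalerAl.
Qed.

(** Annihilation after [x] after creation is multiplication by [d tr x]: the centred part of [x]
    only produces alternating products, of trace 0, and the scalar part is evaluated by [UU]. *)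
Lemma fock_dot x y z y' z' : B x -> star x = x -> fock_creation y z ->
  fock_creation y' z' -> ip z (x * z') = d * rtr x * ip y y'.
Proof.
move=> Bx sx h h'; elim: h => {y z} [n w hw|y1 z1 y2 z2 _ h1 _ h2]; last first.
  by rewrite !ipDl h1 h2; ring.
elim: h' => {y' z'} [m w' hw'|y1 z1 y2 z2 _ h1 _ h2]; last first.
  by rewrite mulrDr !ipDr h1 h2; ring.
have e k y : ip (U k * w) y = rtr (star w * (U k * y)).
  by rewrite /ip starM star_peval // mulrA.
rewrite !e; have [Bx0 tx0] := centredB Bx.
have -> : star w * (U n.+1 * (x * (U m.+1 * w'))) =
   star w * (U n.+1 * ((x - tr x *: 1) * (U m.+1 * w'))) +
   tr x *: (star w * (U (n + m).+2 * w')) +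
   (d%:C * tr x) *: (star w * (U n * (U m * w'))).
  have -> : U (n + m).+2 = U n.+1 * U m.+1 - d%:C *: (U n * U m) by rewrite UU addrK.
  by nc.
have z1 : rtr (star w * (U n.+1 * ((x - tr x *: 1) * (U m.+1 * w')))) = 0.
  rewrite /rtr word_orth //; apply: sp_mulU; apply: sp_mulB => //.
  exact: sp_Uword.
have z2 : rtr (star w * (U (n + m).+2 * w')) = 0.
  by rewrite /rtr word_orth //; exact: sp_Uword.
by rewrite 2!rtrD z1 add0r tr_sa // -rmorphM !rtrZ z2 mulr0 add0r.
Qed.

(** Annihilation sees only the scalar part of [x]. On the centred part [s] acts as creation alone,
    since [(x - tr x) U w] is again a word. *)
Lemma fock_next x y z : B x -> fock_creation y z -> exists z',
  fock_creation (x * z) z' /\ s * (x * z) = z' + (d%:C * tr x) *: y.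
Proof.
move=> Bx; elim=> [n w hw|y1 z1 y2 z2 _ [z3 [h1 e1]] _ [z4 [h2 e2]]]; last first.
  exists (z3 + z4); rewrite !mulrDr e1 e2; split; first exact: fock_add.
  by rewrite scalerDr addrACA.
have [Bx0 tx0] := centredB Bx.
exists (tr x *: (U n.+2 * w) + s * ((x - tr x *: 1) * U n.+1 * w)); split.
  have -> : x * (U n.+1 * w) = tr x *: (U n.+1 * w) + (x - tr x *: 1) * U n.+1 * w by nc.
  by apply: fock_add; [apply: fock_scale; exact: fock_gen|apply: fock_word; exact: word_mul].
have -> : U n.+2 = s * U n.+1 - d%:C *: U n by rewrite sU addrK.
by nc.
Qed.

Lemma fock_orth x y z : B x -> fock_creation y z -> rtr (x * z) = 0.
Proof.
move=> Bx; elim=> [n w hw|y1 z1 y2 z2 _ h1 _ h2]; last by rewrite mulrDr rtrD h1 h2 addr0.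
rewrite -[x]starK /rtr word_orth //; last exact: sp_Uword.
by apply: word_base; exact: sub_star.
Qed.

Lemma fock_creationP : creation B s d fock_creation.
Proof.
split.
- exact: fock_add.
- exact: fock_scale.
- by move=> b Bb; apply: fock_word; exact: word_base.
- exact: fock_mull.
- exact: fock_mul.
- exact: fock_adj.
- exact: fock_dot.
- exact: fock_next.
- exact: fock_orth.
Qed.

End free_semicircular.

(** * Subordination *)

Section l2_limits.
Context {R : realType} {A : wprob_space R}.
Local Notation M := (walg A).
Implicit Types (x y : M).

Lemma n2_lim_le x (C : R) : 0 <= C ->
  (forall e : R, 0 < e -> exists2 y, n2 y <= C & n2 (x - y) <= e) -> n2 x <= C.
Proof.
move=> C0 hx; rewrite leNgt; apply/negP => lt.
pose D := n2 x - C; have D0 : 0 < D by rewrite subr_gt0.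
have den : 0 < 16 * (C + D + 1) by lra.
(* With this tolerance the squared error is at most [D / 16] and the cross term at most [D / 2],
   together less than the assumed excess [D]. *)
have [y hy hd] := hx (D ^+ 2 / (16 * (C + D + 1))) ltac:(by rewrite divr_gt0 ?exprn_gt0).
have := ip_cs y (x - y).
have : n2 x = n2 y + n2 (x - y) + 2 * ip y (x - y) by rewrite -n2DE addrC subrK.
move: hd; rewrite ler_pdivlMr //; have := n2_ge0 y; have := n2_ge0 (x - y).
set a := n2 y in hy *; set b := n2 (x - y); set i := ip y _ => b0 a0 hb e hi.
have eD : n2 x = C + D by rewrite /D addrC subrK.
have b1 : b * 16 <= D by nra.
have h2 : i <= D / 4.
  rewrite leNgt; apply/negP => hlt.
  have : (D / 4) ^+ 2 < i ^+ 2 by rewrite ltr_sqr ?nnegrE //; lra.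
  nra.
by move: e; rewrite eD; nra.
Qed.

Lemma n2_lim_ge x (C : R) :
  (forall e : R, 0 < e -> exists2 y, C <= n2 y & n2 (x - y) <= e) -> C <= n2 x.
Proof.
move=> hx; rewrite leNgt; apply/negP => lt.
pose D := C - n2 x; have D0 : 0 < D by rewrite subr_gt0.
have x0 := n2_ge0 x.
have den : 0 < 16 * (n2 x + D + 1) by lra.
have [y hy hd] := hx (D ^+ 2 / (16 * (n2 x + D + 1))) ltac:(by rewrite divr_gt0 ?exprn_gt0).
have := ip_cs (- x) (x - y); rewrite n2N ipNl sqrrN.
have : n2 y = n2 x + n2 (x - y) - 2 * ip x (x - y) by rewrite -n2BE subKr.
move: hd; rewrite ler_pdivlMr //; have := n2_ge0 (x - y).
set b := n2 (x - y); set i := ip x _ => b0 hb e hi.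
have eD : C = n2 x + D by rewrite /D addrC subrK.
have b1 : b * 16 <= D by nra.
have h2 : - i <= D / 4.
  rewrite leNgt; apply/negP => hlt.
  have : (D / 4) ^+ 2 < (- i) ^+ 2 by rewrite ltr_sqr ?nnegrE //; lra.
  rewrite sqrrN; nra.
nra.
Qed.

End l2_limits.

Section subordination.
Context {R : realType} {A : wprob_space R}.
Local Notation M := (walg A).
Implicit Types (x y z b : M).

Variables (B : M -> Prop) (s : M) (d : R) (lp : M -> M -> Prop).
Hypothesis hB : subalg B.
Hypothesis ss : star s = s.
Hypothesis d0 : 0 <= d.
Hypothesis hl : creation B s d lp.

(** [z - z'] is an image of 0, and the isometry gives it norm 0. *)
Lemma lp_uniq y z z' : lp y z -> lp y z' -> z = z'.
Proof.
move=> h h'; apply/eqP; rewrite -subr_eq0; apply/eqP; apply: n2_eq0.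
have h0 : lp (y + (-1) *: y) (z + (-1) *: z').
  by apply: (lpD hl) => //; exact: (lpZ hl).
have := lp_dot hl (sub1 hB) star1 h0 h0.
by rewrite !scaleN1r subrr mul1r ip0l mulr0.
Qed.

Definition cre y : M := xget 0 [set z | lp y z].

Lemma creP y : (exists z, lp y z) -> lp y (cre y).
Proof. by move=> h; rewrite /cre; case: xgetP => // hn; case: h => z /hn. Qed.

Variables (h G c : M) (g0 k q : R).
Hypothesis Bh : B h.
Hypothesis sh : star h = h.
Hypothesis g0_gt0 : 0 < g0.
Hypothesis hh : pos (h - g0%:C *: 1).
Hypothesis hG : h * G = 1.
Hypothesis Gh : G * h = 1.
Hypothesis BG : B G.
Hypothesis sG : star G = G.
Hypothesis Bc : B c.
Hypothesis sc : star c = c.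
Hypothesis k0 : 0 <= k.
Hypothesis ck : nle c k.
Hypothesis q_gt0 : 0 < q.
Hypothesis q_lt1 : q < 1.
Hypothesis hq : d * k ^+ 2 * rtr (c * G * G * c) <= q ^+ 2.

(** [c s c] is the increment and [d tr(c G c) c^2] its compensator, chosen so that the inverse keeps
    the same trace against the past. *)
Definition sub_den : M := h + (d * rtr (c * G * c))%:C *: (c * c) - c * s * c.
Local Notation K := sub_den.

Let sG2 : star (c * G * G * c) = c * G * G * c.
Proof. by rewrite !starM sc sG !mulrA. Qed.
Let BG2 : B (c * G * G * c).
Proof. by do ! apply: (subM hB). Qed.
Let sG1 : star (c * G * c) = c * G * c.
Proof. by rewrite !starM sc sG !mulrA. Qed.
Let BG1 : B (c * G * c).
Proof. by do ! apply: (subM hB). Qed.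

Lemma rtrG2_ge0 : 0 <= rtr (c * G * G * c).
Proof.
have -> : c * G * G * c = star (G * c) * (G * c) by rewrite starM sc sG !mulrA.
exact: rtr_ge0.
Qed.

Lemma n2_creation y z : lp (c * y) z ->
  n2 (G * c * z) = d * rtr (c * G * G * c) * n2 (c * y).
Proof.
move=> hz; rewrite -(lp_dot hl BG2 sG2 hz hz) /n2 ipM; congr ip.
by rewrite starM sc sG !mulrA.
Qed.

Lemma n2_creation_le y z : lp (c * y) z -> n2 (G * c * z) <= q ^+ 2 * n2 y.
Proof.
move=> /n2_creation ->; have := n2_mull y k0 ck; have := n2_ge0 y.
have := hq; have := rtrG2_ge0; set r := rtr _; move=> r0 hq' y0 h1.
have : d * r * n2 (c * y) <= d * r * (k ^+ 2 * n2 y) by rewrite ler_wpM2l // mulr_ge0.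
nra.
Qed.

Lemma star_sub_den : star K = K.
Proof.
rewrite /sub_den starB starD starZr !starM sh ss sc.
by rewrite !mulrA.
Qed.

(* The quadratic form of K completes to the square of h^(1/2) (y - G c l*(c y)). *)
Lemma sub_den_form y z : lp (c * y) z -> ip y (K * y) = ip (y - G * c * z) (h * (y - G * c * z)).
Proof.
move=> hz; have := lp_adj hl hz hz; rewrite (ipC z) => e1.
have := lp_dot hl BG1 sG1 hz hz => e2.
have -> : h * (y - G * c * z) = h * y - c * z by rewrite mulrBr !mulrA hG mul1r.
rewrite ipBl !ipBr.
have -> : ip (G * c * z) (h * y) = ip (c * y) z.
  by rewrite ipM starM sc sG ipC -!mulrA (mulrA G) Gh mul1r.
have -> : ip (G * c * z) (c * z) = ip z (c * G * c * z).
  by rewrite ipM starM sc sG !mulrA.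
have -> : ip y (c * z) = ip (c * y) z by rewrite ipM sc.
rewrite e2 /sub_den mulrBl mulrDl ipBr ipDr -scalerAl ipZr.
have -> : ip y (c * c * y) = ip (c * y) (c * y) by rewrite ipM sc mulrA.
have -> : ip y (c * s * c * y) = ip (c * y) (s * (c * y)) by rewrite ipM sc !mulrA.
by rewrite e1; ring.
Qed.

(** The form of [K] at [y] is that of [h] at [y - v], where the L2 norm of [v] is at most [q] times
    that of [y]. The completed square is available on the domain of [lp] only, which is why
    [pos_test] is used. *)
Lemma sub_den_pos : pos (K - (g0 * (1 - q) ^+ 2)%:C *: 1).
Proof.
pose D y := exists z, lp y z.
have D1 : D 1 by exists (s * 1); apply: (lp_base hl); exact: sub1.
have DB b y : B b -> D y -> D (b * y) by move=> Bb [z hz]; exact: (lp_mull hl Bb hz).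
have Ds y : D y -> D (s * y) by move=> [z hz]; exact: (lp_mul hl hz).
have DD x y : D x -> D y -> D (x + y).
  by move=> [z hz] [z' hz']; exists (z + z'); exact: (lpD hl).
have DZ a x : D x -> D (a *: x) by move=> [z hz]; exists (a *: z); exact: (lpZ hl).
apply: (@pos_test _ _ D) => //.
- by rewrite starB star_sub_den starZr star1.
- by move=> r x; exact: DZ.
- move=> y Dy.
  have -> : (K - (g0 * (1 - q) ^+ 2)%:C *: 1) * y = h * y +
     ((d * rtr (c * G * c))%:C *: (c * (c * y)) +
     ((-1) *: (c * (s * (c * y))) + (- (g0 * (1 - q) ^+ 2)%:C) *: y)).
    by rewrite /sub_den; nc.
  apply: (DD); first exact: DB.
  apply: (DD); first by apply: (DZ); apply: (DB) => //; exact: DB.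
  apply: (DD); last exact: DZ.
  by apply: (DZ); apply: (DB) => //; apply: Ds; exact: DB.
- move=> y Dy; have [z hz] := DB c y Bc Dy.
  rewrite -mulrA -/(ip y _) mulrBl -scalerAl mul1r ipBr ipZr (sub_den_form hz).
  have hv := n2_creation_le hz.
  set v := G * c * z in hv *.
  have := ip_pos_ge0 (y - v) hh; rewrite mulrBl ipBr -scalerAl mul1r ipZr -/(n2 _).
  rewrite -/(n2 y) => h1.
  (* Reverse triangle inequality without square roots, from the positivity of [n2 (q y - v)]. *)
  have h2 : (1 - q) ^+ 2 * n2 y <= n2 (y - v).
    have := n2_ge0 (q%:C *: y - v); rewrite !n2BE n2Z ipZl.
    have := n2_ge0 y; have := n2_ge0 v.
    move: hv; set a := n2 v; set b := n2 y; set i := ip y v => hv a0 b0 h3.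
    have h5 : 0 <= (1 - q) * (q ^+ 2 * b - a) by rewrite mulr_ge0 // subr_ge0 // ltW.
    rewrite -(ler_pM2l q_gt0); nra.
  have := ler_wpM2l (ltW g0_gt0) h2; lra.
Qed.

Lemma sub_inv : exists P, [/\ P * K = 1, K * P = 1, pos P,
   nle P (g0 * (1 - q) ^+ 2)^-1 & forall Q, closed_alg Q -> Q K -> Q P].
Proof.
apply: pos_inv; last exact: sub_den_pos; last exact: star_sub_den.
by rewrite mulr_gt0 // exprn_gt0 // subr_gt0.
Qed.

(** The terms [V^n G], with [V y = G c cre (c y)], of the series for the inverse of [K]. *)
Definition sub_term n : M := iter n (fun y => G * c * cre (c * y)) G.
Local Notation Q := sub_term.
Local Notation zz n := (cre (c * Q n)).

Lemma sub_termS n : Q n.+1 = G * c * zz n.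
Proof. by []. Qed.

Lemma sub_term_lp n : lp (c * Q n) (zz n).
Proof.
elim: n => [|n IH].
  by apply: creP; exists (s * (c * G)); apply: (lp_base hl); exact: subM.
apply: creP; rewrite sub_termS.
have [z' [h1 _]] := lp_next hl (subM hB Bc (subM hB BG Bc)) IH.
by exists z'; rewrite !mulrA; rewrite !mulrA in h1.
Qed.

Lemma sub_term1 : Q 1 = G * c * s * c * G.
Proof.
have e : zz 0 = s * (c * G).
  by apply: (lp_uniq (sub_term_lp 0)); apply: (lp_base hl); exact: subM.
by rewrite sub_termS e !mulrA.
Qed.

Lemma sub_term_orth n b : B b -> rtr (b * Q n.+1) = 0.
Proof.
move=> Bb; rewrite sub_termS !mulrA.
by apply: (lp_orth hl (subM hB (subM hB Bb BG) Bc) (sub_term_lp n)).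
Qed.

(** Each use of [lp_dot] removes one [V] from both sides and leaves the weight [c^2], hence the
    general weight [x]. Once one side is exhausted, the other is a creation multiplied by the past,
    orthogonal to the past. *)
Lemma sub_term_ip x n m : B x -> star x = x -> n != m -> ip (Q n) (x * Q m) = 0.
Proof.
elim: n m x => [|n IH] [|m] x // Bx sx nm.
- by rewrite /ip sG mulrA; apply: sub_term_orth; exact: subM.
- rewrite ipC /ip starM sG sx; apply: sub_term_orth; exact: subM.
- rewrite !sub_termS ipM.
  have -> : star (G * c) * (x * (G * c * zz m)) = c * G * x * G * c * zz m.
    by rewrite starM sc sG !mulrA.
  rewrite (lp_dot hl _ _ (sub_term_lp n) (sub_term_lp m)).
  + rewrite ipM sc mulrA IH ?mulr0 //; first exact: subM.
    by rewrite starM sc.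
  + by do ! apply: (subM hB).
  + by rewrite !starM sc sG sx !mulrA.
Qed.

Lemma n2_sub_termS n : n2 (Q n.+1) <= q ^+ 2 * n2 (Q n).
Proof. by apply: n2_creation_le; exact: sub_term_lp. Qed.

Lemma n2_sub_term n m : n2 (Q (n + m)%N) <= (q ^+ 2) ^+ m * n2 (Q n).
Proof.
elim: m => [|m IH]; first by rewrite addn0 expr0 mul1r.
rewrite addnS; apply: (le_trans (n2_sub_termS _)).
by rewrite (exprS (q ^+ 2)) -mulrA; apply: ler_wpM2l => //; exact: sqr_ge0.
Qed.

Lemma n2_sub_sum m n :
  n2 (\sum_(i < n) Q (m + i)%N) = \sum_(i < n) n2 (Q (m + i)%N).
Proof.
elim: n => [|n IH]; first by rewrite !big_ord0 n2_0.
rewrite !big_ord_recr /= n2DE IH.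
suff -> : ip (\sum_(i < n) Q (m + i)%N) (Q (m + n)%N) = 0 by rewrite mulr0 addr0.
rewrite /ip star_sum mulr_suml.
have big0 (F : 'I_n -> M) : (forall i, rtr (F i) = 0) -> rtr (\sum_(i < n) F i) = 0.
  by move=> hF; rewrite /rtr tr_sum raddf_sum big1 // => i _; exact: hF.
apply: big0 => i.
have := @sub_term_ip 1 (m + i)%N (m + n)%N (sub1 hB) star1.
by rewrite mul1r; apply; rewrite eqn_add2l neq_ltn ltn_ord.
Qed.

(** A telescoping sum: [h Q_(N+1)] cancels the creation left over by [Q_N], and the annihilation
    part of [c s c Q_(N+1)] cancels the compensator of [Q_N]. Only the last term leaves a
    remainder. *)
Lemma sub_sum_den N : K * \sum_(i < N.+1) Q i =
  1 - c * zz N + (d * rtr (c * G * c))%:C *: (c * c * Q N).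
Proof.
have hz n : zz n.+1 = s * (c * Q n.+1) - (d * rtr (c * G * c))%:C *: (c * Q n).
  have [z' [h1 e1]] := lp_next hl BG1 (sub_term_lp n).
  have e2 : c * Q n.+1 = c * G * c * zz n by rewrite sub_termS !mulrA.
  rewrite e2 e1 rmorphM /= -tr_sa // addrK.
  by rewrite -e2; apply: (lp_uniq (sub_term_lp n.+1)); rewrite e2.
elim: N => [|N IH].
  rewrite big_ord_recl big_ord0 addr0.
  have -> : zz 0 = s * (c * G).
    by apply: (lp_uniq (sub_term_lp 0)); apply: (lp_base hl); exact: subM.
  have -> : K * Q 0 = h * G + (d * rtr (c * G * c))%:C *: (c * c * G) - c * (s * (c * G)).
    by rewrite /sub_den /sub_term /=; nc.
  by rewrite hG addrAC.
rewrite big_ord_recr /= mulrDr IH -/(sub_term N.+1) (hz N).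
have e : h * Q N.+1 = c * zz N by rewrite sub_termS !mulrA hG mul1r.
have -> : K * Q N.+1 = h * Q N.+1 + (d * rtr (c * G * c))%:C *: (c * c * Q N.+1)
  - c * s * c * Q N.+1 by rewrite /sub_den; nc.
by rewrite -?sub_termS e; nc.
Qed.

(** The rest of the series is the bounded operator [P] applied to the remainder in [sub_sum_den],
    which is of the size of the last term and decays geometrically. *)
Lemma sub_rest_small P : P * K = 1 -> forall e : R, 0 < e ->
  exists N, forall n, (N <= n)%N -> n2 (P - \sum_(i < n.+1) Q i) <= e.
Proof.
move=> PK e e0; have [L L0 hL] := nle_ex P.
set r := d * rtr (c * G * c).
pose C := L ^+ 2 * (2 * (k ^+ 2 * (d * k ^+ 2) + r ^+ 2 * k ^+ 4)) * n2 G.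
have C0 : 0 <= C.
  apply: (mulr_ge0 _ (n2_ge0 _)); apply: (mulr_ge0 (sqr_ge0 _)); apply: mulr_ge0 => //.
  apply: addr_ge0; first by rewrite mulr_ge0 ?sqr_ge0 // mulr_ge0 // sqr_ge0.
  by rewrite mulr_ge0 ?sqr_ge0 // exprn_ge0.
have q2 : q ^+ 2 < 1 by rewrite expr_lt1 // ltW.
have e1 : 0 < e / (C + 1) by rewrite divr_gt0 //; lra.
have [N hN] := geometric_small (sqr_ge0 q) q2 e1.
exists N => n /hN hn.
have -> : P - \sum_(i < n.+1) Q i = P * (c * zz n - r%:C *: (c * c * Q n)).
  have := congr1 (fun x => P * x) (sub_sum_den n).
  by rewrite mulrA PK mul1r => ->; rewrite -/r; nc.
have hQ := n2_sub_term 0 n; rewrite add0n in hQ.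
have zn : n2 (zz n) <= d * k ^+ 2 * n2 (Q n).
  have := lp_dot hl (sub1 hB) star1 (sub_term_lp n) (sub_term_lp n).
  rewrite mul1r rtr1 mulr1 -/(n2 _) -/(n2 _) => ->.
  by rewrite -mulrA ler_wpM2l //; exact: n2_mull.
have e1' : n2 (c * zz n) <= k ^+ 2 * (d * k ^+ 2 * n2 (Q n)).
  by apply: (le_trans (n2_mull _ k0 ck)); rewrite ler_wpM2l // sqr_ge0.
have e2 : n2 (r%:C *: (c * c * Q n)) <= r ^+ 2 * (k ^+ 4 * n2 (Q n)).
  rewrite n2Z ler_wpM2l ?sqr_ge0 // -mulrA.
  apply: (le_trans (n2_mull _ k0 ck)).
  rewrite (_ : k ^+ 4 = k ^+ 2 * k ^+ 2); last by ring.
  by rewrite -mulrA ler_wpM2l ?sqr_ge0 //; exact: n2_mull.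
apply: (le_trans (n2_mull _ (ltW L0) hL)).
have e3 := n2B_le (c * zz n) (r%:C *: (c * c * Q n)).
have e4 : n2 (c * zz n - r%:C *: (c * c * Q n)) <=
   2 * (k ^+ 2 * (d * k ^+ 2) + r ^+ 2 * k ^+ 4) * n2 (Q n) by nra.
set X := 2 * (k ^+ 2 * (d * k ^+ 2) + r ^+ 2 * k ^+ 4) in e4.
apply: (le_trans (ler_wpM2l (sqr_ge0 L) e4)); rewrite mulrA; have X0 : 0 <= L ^+ 2 * X.
  apply: (mulr_ge0 (sqr_ge0 _)); apply: mulr_ge0 => //.
  apply: addr_ge0; first by rewrite mulr_ge0 ?sqr_ge0 // mulr_ge0 // sqr_ge0.
  by rewrite mulr_ge0 ?sqr_ge0 // exprn_ge0.
apply: (le_trans (ler_wpM2l X0 hQ)).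
have -> : L ^+ 2 * X * ((q ^+ 2) ^+ n * n2 (Q 0)) = C * (q ^+ 2) ^+ n.
  by rewrite /C -/X; ring.
apply: (le_trans (ler_wpM2l C0 hn)); rewrite mulrA ler_pdivrMr; nra.
Qed.

Lemma n2_sub_sum_le m n : n2 (\sum_(i < n) Q (m + i)%N) <= n2 (Q m) / (1 - q ^+ 2).
Proof.
have q2 : q ^+ 2 < 1 by rewrite expr_lt1 // ltW.
have q20 := sqr_ge0 q.
rewrite n2_sub_sum ler_pdivlMr; last lra.
have : \sum_(i < n) n2 (Q (m + i)%N) <= \sum_(i < n) (q ^+ 2) ^+ i * n2 (Q m).
  by apply: ler_sum => i _; exact: n2_sub_term.
rewrite -mulr_suml => h1.
have : (\sum_(i < n) (q ^+ 2) ^+ i) * (1 - q ^+ 2) <= 1.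
  elim: n {h1} => [|n IH]; first by rewrite big_ord0 mul0r.
  rewrite big_ord_recl expr0.
  under eq_bigr do rewrite lift0 exprS.
  by rewrite -mulr_sumr; nra.
have := n2_ge0 (Q m); set S := \sum_(i < n) (q ^+ 2) ^+ i in h1 *.
move=> Q0 h2; have : S * n2 (Q m) * (1 - q ^+ 2) <= n2 (Q m) by nra.
nra.
Qed.

Lemma sub_trace P b : P * K = 1 -> B b -> rtr (b * P) = rtr (b * G).
Proof.
move=> PK Bb; apply/eqP; rewrite -subr_eq0 -rtrB -mulrBr.
suff /eqP : rtr (b * (P - G)) ^+ 2 = 0 by rewrite sqrf_eq0.
apply/eqP; rewrite eq_le sqr_ge0 andbT; apply/ler_addgt0Pr => e e0.
have e1 : 0 < e / (n2 (star b) + 1).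
  by rewrite divr_gt0 //; have := n2_ge0 (star b); lra.
have [N hN] := sub_rest_small PK e1.
have := hN N (leqnn _) => h1.
have -> : rtr (b * (P - G)) = ip (star b) (P - \sum_(i < N.+1) Q i).
  rewrite /ip starK big_ord_recl /=.
  have -> : P - (G + \sum_(i < N) Q (lift ord0 i)) = (P - G) - \sum_(i < N) Q (lift ord0 i).
    by nc.
  rewrite [in RHS]mulrBr rtrB mulr_sumr.
  suff -> : rtr (\sum_(i < N) b * Q (lift ord0 i)) = 0 by rewrite subr0.
  rewrite /rtr tr_sum raddf_sum big1 // => i _.
  exact: sub_term_orth.
apply: (le_trans (ip_cs _ _)); rewrite add0r.
apply: (le_trans (ler_wpM2l (n2_ge0 _) h1)).
by rewrite mulrA ler_pdivrMr; have := n2_ge0 (star b); nra.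
Qed.

Lemma sub_n2 P : P * K = 1 -> n2 P <= n2 G / (1 - q ^+ 2).
Proof.
move=> PK; have q2 : q ^+ 2 < 1 by rewrite expr_lt1 // ltW.
apply: n2_lim_le; first by rewrite divr_ge0 ?n2_ge0 // subr_ge0 ltW.
move=> e e0; have [N hN] := sub_rest_small PK e0.
by exists (\sum_(i < N.+1) Q i); [exact: (n2_sub_sum_le 0 N.+1)|exact: hN].
Qed.

Lemma sub_n2_second P : P * K = 1 ->
  n2 (P - G - G * c * s * c * G) <= q ^+ 4 * n2 G / (1 - q ^+ 2).
Proof.
move=> PK; have q2 : q ^+ 2 < 1 by rewrite expr_lt1 // ltW.
have bd : n2 (Q 2) / (1 - q ^+ 2) <= q ^+ 4 * n2 G / (1 - q ^+ 2).
  rewrite ler_pM2r ?invr_gt0 ?subr_gt0 //.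
  by have := n2_sub_term 0 2; rewrite add0n -exprM.
apply: (le_trans _ bd); apply: n2_lim_le.
  by rewrite divr_ge0 ?n2_ge0 // subr_ge0 ltW.
move=> e e0; have [N hN] := sub_rest_small PK e0.
exists (\sum_(i < N) Q (2 + i)%N); first exact: n2_sub_sum_le.
have e1 : \sum_(i < N.+2) Q i = G + Q 1 + \sum_(i < N) Q (2 + i)%N.
  by rewrite 2!big_ord_recl addrA.
have := hN N.+1 (leqnSn _); rewrite e1 sub_term1.
by set S := \sum_(i < N) _; congr (n2 _ <= _); nc.
Qed.

(** If [c] scales L2 norms exactly, the squared norms of the terms form an exact geometric
    progression. This lower bound is the source of the blow-up at the critical time. *)
Lemma sub_n2_ge P N : P * K = 1 -> (forall y, n2 (c * y) = k ^+ 2 * n2 y) ->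
  \sum_(i < N) (d * k ^+ 2 * rtr (c * G * G * c)) ^+ i * n2 G <= n2 P.
Proof.
move=> PK hc; apply: n2_lim_ge => e e0; have [n hn] := sub_rest_small PK e0.
exists (\sum_(i < (n + N).+1) Q i); last by apply: hn; rewrite leq_addr.
have := n2_sub_sum 0 (n + N).+1.
under eq_bigr do rewrite add0n.
under [in X in _ = X -> _]eq_bigr do rewrite add0n.
move=> ->.
have hQ i : n2 (Q i) = (d * k ^+ 2 * rtr (c * G * G * c)) ^+ i * n2 G.
  elim: i => [|i IH]; first by rewrite expr0 mul1r.
  rewrite sub_termS (n2_creation (sub_term_lp i)) hc IH (exprS _ i).
  by set X := (d * _ * _) ^+ i; ring.
rewrite (eq_bigr (fun i : 'I_N => n2 (Q i))); last by move=> i _; rewrite hQ.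
rewrite (_ : (n + N).+1 = N + n.+1)%N; last by rewrite addnS addnC.
rewrite big_split_ord /= lerDl; apply: sumr_ge0 => i _; exact: n2_ge0.
Qed.

Lemma subordination : exists P g', [/\ [/\ 0 < g', pos (K - g'%:C *: 1) & g' = g0 * (1 - q) ^+ 2],
  [/\ P * K = 1, K * P = 1, star P = P & nle P g'^-1],
  forall Q, closed_alg Q -> Q K -> Q P,
  forall b, B b -> rtr (b * P) = rtr (b * G) &
  n2 P <= n2 G / (1 - q ^+ 2) /\
  n2 (P - G - G * c * s * c * G) <= q ^+ 4 * n2 G / (1 - q ^+ 2)].
Proof.
have [P [PK KP [sP _] nP hP]] := sub_inv.
exists P, (g0 * (1 - q) ^+ 2); split => //.
- split => //; last exact: sub_den_pos.
  by rewrite mulr_gt0 // exprn_gt0 // subr_gt0.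
- by move=> b; exact: sub_trace.
- by split; [exact: sub_n2|exact: sub_n2_second].
Qed.

End subordination.

(** Creation changes sign with [s]. This serves martingale steps with a minus sign, two-sided bounds
    on increments, and negative [k]. *)
Lemma creation_opp {R : realType} {A : wprob_space R} (B : walg A -> Prop) s d lp :
  creation B s d lp -> creation B (- s) d (fun y z => lp y (- z)).
Proof.
move=> h; split.
- by move=> y z y' z' h1 h2; rewrite opprD; exact: (lpD h).
- by move=> c y z h1; rewrite -scalerN; exact: (lpZ h).
- by move=> b Bb; rewrite mulNr opprK; exact: (lp_base h).
- move=> b y z Bb h1; have [z' h2] := lp_mull h Bb h1.
  by exists (- z'); rewrite opprK.
- move=> y z h1; have [z' h2] := lp_mul h h1.
  exists z'; rewrite mulNr -scaleN1r -[- z']scaleN1r; exact: (lpZ h).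
- move=> y z y' z' h1 h2; have := lp_adj h h1 h2.
  by rewrite mulNr !ipNr ipNl => ->; rewrite opprD !opprK.
- move=> x y z y' z' Bx sx h1 h2; rewrite -(lp_dot h Bx sx h1 h2).
  by rewrite mulrN ipNl ipNr opprK.
- move=> x y z Bx h1; have [z' [h2 e]] := lp_next h Bx h1.
  exists z'; split.
    have := lpZ h (-1) h2; rewrite !scaleN1r => h3.
    by rewrite mulrN opprK in h3.
  by rewrite -e !mulrN mulNr.
- by move=> x y z Bx h1; have := lp_orth h Bx h1; rewrite mulrN rtrN => /eqP; rewrite oppr_eq0 => /eqP.
Qed.

(** * Free Brownian motion *)

Section densities.
Context {R : realType}.
Local Notation leb := (@lebesgue_measure R).
Local Notation T := (measurableTypeR R).
Implicit Types (mu : probability T R) (f g : T -> R).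

Lemma integrable_density mu f : measurable_fun setT f -> (forall x, 0 <= f x) ->
  has_density f mu -> leb.-integrable setT (EFin \o f).
Proof.
move=> mf f0 hf; apply/integrableP; split; first exact/measurable_EFinP.
have := hf setT measurableT; rewrite probability_setT => h.
under eq_integral do rewrite /= ger0_norm //.
by rewrite -h ltry.
Qed.

Lemma density_dominates mu f : measurable_fun setT f ->
  has_density f mu -> mu `<< leb.
Proof.
move=> mf hf; apply/null_content_dominatesP => A mA A0; rewrite hf //.
apply: null_set_integral => //; apply/measurable_EFinP; exact: measurable_funTS.
Qed.

(** [has_density] speaks about sets. The Radon-Nikodym derivative, almost everywhere equal to [f],
    carries it over to integrals of functions. *)
Lemma density_integral mu f g (a b : R) : measurable_fun setT f -> (forall x, 0 <= f x) ->
  (forall x, ~ (a <= x <= b) -> f x = 0) ->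
  has_density f mu -> mu.-integrable setT (EFin \o g) ->
  \int[mu]_(x in setT) g x = \int[leb]_(x in `[a, b]) (g x * f x).
Proof.
move=> mf f0 fab hf ig.
have dom := density_dominates mf hf.
have fi := integrable_density mf f0 hf.
have mg : measurable_fun setT g by apply/measurable_EFinP; exact: measurable_int ig.
rewrite [RHS]Rintegral_mkcond /Rintegral; congr fine.
rewrite -(Radon_Nikodym_change_of_variables dom measurableT ig).
apply: ae_eq_integral => //.
- apply: emeasurable_funM; first exact: measurable_int ig.
  by apply: measurable_int; apply: Radon_Nikodym_integrable.
- apply/measurable_EFinP; apply/measurable_restrict => //; rewrite setTI.
  apply: measurable_funTS; exact: measurable_funM.
have ae : ae_eq leb setT (Radon_Nikodym (charge_of_finite_measure mu) leb) (EFin \o f).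
  apply: integral_ae_eq => //.
  - by apply: Radon_Nikodym_integrable.
  - exact/measurable_EFinP.
  - by move=> E _ mE; rewrite -Radon_Nikodym_integral // -hf.
move: ae; apply: filterS => x /(_ I) /= ->.
move=> _; rewrite -EFinM patchE; case: ifPn => // xab.
rewrite fab ?mulr0 // => h; move/negP: xab; apply; rewrite inE /= in_itv /=.
exact: h.
Qed.

Lemma semicircle_density_ge0 (v x : R) : 0 < v -> 0 <= semicircle_density v x.
Proof.
by move=> v0; rewrite divr_ge0 ?sqrtr_ge0 // !mulr_ge0 ?pi_ge0 // ltW.
Qed.

Lemma continuous_sqrt_comp (h : R -> R) : continuous h -> continuous (fun x => Num.sqrt (h x)).
Proof.
move=> ch x; apply: (@continuous_comp _ _ _ h Num.sqrt); first exact: ch.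
exact: sqrt_continuous.
Qed.

Lemma semicircle_poly (v x : R) : 4 * v - x ^+ 2 = ((4 * v)%:P - 'X ^+ 2).[x].
Proof. by rewrite !hornerE. Qed.

Lemma continuous_semicircle (v : R) : continuous (semicircle_density v).
Proof.
move=> x; rewrite /semicircle_density; apply: cvgMr_tmp.
apply: (continuous_sqrt_comp (h := fun x => 4 * v - x ^+ 2)).
under eq_fun do rewrite semicircle_poly.
exact: continuous_horner.
Qed.

Lemma semicircle_density_out (v x : R) : 0 <= v ->
  ~ (- (2 * Num.sqrt v) <= x <= 2 * Num.sqrt v) -> semicircle_density v x = 0.
Proof.
move=> v0 h; rewrite /semicircle_density ler0_sqrtr ?mul0r //.
rewrite subr_le0 leNgt; apply/negP => h2; apply: h.
rewrite -ler_norml -(ler_sqr (normr_ge0 x)) ?nnegrE ?mulr_ge0 ?sqrtr_ge0 //.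
by rewrite real_normK ?num_real // exprMn sqr_sqrtr // (_ : 2 ^+ 2 = 4) ?ltW //; ring.
Qed.

(** The integrand is the derivative of [q (4 v - x^2)^(3/2) / (2 pi v)], which vanishes at both
    ends. It is differentiated in the open interval only, where the square root is smooth. *)
Lemma semicircle_by_parts (v : R) (q : {poly R}) : 0 < v ->
  \int[leb]_(x in `[- (2 * Num.sqrt v), 2 * Num.sqrt v])
    (((4 * v)%:P * q^`() - 'X ^+ 2 * q^`() - 3 *: ('X * q)).[x] * semicircle_density v x) = 0.
Proof.
move=> v0; set a := 2 * Num.sqrt v.
have a0 : 0 < a by rewrite mulr_gt0 // sqrtr_gt0.
have av : a ^+ 2 = 4 * v by rewrite exprMn sqr_sqrtr ?ltW //; ring.
pose w x := 4 * v - x ^+ 2 : R.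
pose P := (4 * v)%:P * q^`() - 'X ^+ 2 * q^`() - 3 *: ('X * q).
pose F x := (q * ((4 * v)%:P - 'X ^+ 2)).[x] * semicircle_density v x.
have cF : continuous F.
  move=> x; apply: cvgM; [exact: continuous_horner|exact: continuous_semicircle].
have scw x : w x = ((4 * v)%:P - 'X ^+ 2).[x] by rewrite /w semicircle_poly.
have dF x : - a < x < a -> is_derive x 1 F (P.[x] * semicircle_density v x).
  move=> /andP[x1 x2].
  have w0 : 0 < w x.
    by rewrite /w -av subr_sqr mulr_gt0 //; lra.
  have dw : is_derive x 1 w (- (2 * x)).
    have -> : w = horner ((4 * v)%:P - 'X ^+ 2) by apply/funext => y; rewrite scw.
    have -> : - (2 * x) = x *- 2 by rewrite mulr_natl.
    have := is_derive_poly ((4 * v)%:P - 'X ^+ 2 : {poly R}) x.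
    rewrite poly.derivB poly.derivC poly.derivXn sub0r hornerN hornerMn hornerXn expr1.
    exact.
  have ds : is_derive x 1 (Num.sqrt \o w) ((2 * Num.sqrt (w x))^-1 * - (2 * x)).
    by apply: is_derive1_comp; exact: is_derive1_sqrt.
  have dp := is_derive_poly (q * ((4 * v)%:P - 'X ^+ 2)) x.
  have := is_deriveM dp (is_deriveM ds (is_derive_cst (2 * pi * v)^-1 x 1)).
  have eF : F = (horner (q * ((4 * v)%:P - 'X ^+ 2)) *
     ((Num.sqrt \o w) * cst (2 * pi * v)^-1)) by apply/funext.
  rewrite -eF => h; apply: (is_derive_eq h).
  have s0 : Num.sqrt (w x) != 0 by rewrite gt_eqF // sqrtr_gt0.
  have sw : w x = Num.sqrt (w x) ^+ 2 by rewrite sqr_sqrtr ?ltW.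
  have pv : pi != 0 :> R by rewrite gt_eqF // pi_gt0.
  have v1 : v != 0 by rewrite gt_eqF.
  have e1 : (q * ((4 * v)%:P - 'X ^+ 2)).[x] = q.[x] * Num.sqrt (w x) ^+ 2.
    by rewrite hornerM -scw -sw.
  have e2 : (q * ((4 * v)%:P - 'X ^+ 2))^`().[x] =
      q^`().[x] * Num.sqrt (w x) ^+ 2 - 2 * x * q.[x].
    rewrite derivM hornerD !hornerM -scw -sw.
    rewrite poly.derivB poly.derivC poly.derivXn sub0r hornerN hornerMn hornerXn expr1.
    by ring.
  have e3 : P.[x] = q^`().[x] * Num.sqrt (w x) ^+ 2 - 3 * (x * q.[x]).
    rewrite /P -mulrBl hornerD hornerN hornerZ !hornerM hornerX -scw -sw.
    by ring.
  rewrite scaler0 add0r e1 e2 e3 /semicircle_density -/(w x) /= /GRing.scale /=.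
  have -> : ((Num.sqrt \o w) * cst (2 * pi * v)^-1) x = Num.sqrt (w x) / (2 * pi * v) by [].
  set s := Num.sqrt (w x) in s0 *; set K := (2 * pi * v)^-1.
  by field.
have aa : - a < a by lra.
rewrite /Rintegral (@continuous_FTC2 _ _ F) //.
- by rewrite /F -EFinB /= !hornerM -!scw /w sqrrN av subrr !mulr0 !mul0r subrr.
- apply: continuous_subspaceT => x; apply: cvgM; first exact: continuous_horner.
  exact: continuous_semicircle.
- split.
  + by move=> x; rewrite in_itv /= => /dF h; exact: ex_derive.
  + by apply: cvg_at_right_filter; exact: cF.
  + by apply: cvg_at_left_filter; exact: cF.
- by move=> x; rewrite in_itv /= => /dF h; rewrite derive1E; exact: derive_val.
Qed.

End densities.

(** * Moments, freeness and creation operators of the increments *)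

Section brownian_motion.
Context {R : realType} {A : wprob_space R}.
Local Notation M := (walg A).
Implicit Types (x y z b : M) (s t r : R).

Lemma oper_expr x n : oper (x ^+ n) = iter n (oper x).
Proof.
by apply/funext => u; elim: n => [//|n IH]; rewrite exprS iterS -IH.
Qed.

Lemma spectral_peval x (mu : probability (measurableTypeR R) R) (p : {poly R}) :
  spectral_distribution (oper x) mu ->
  mu.-integrable setT (fun u => (p.[u])%:E) /\
  rtr (peval p x) = \int[mu]_(u in setT) p.[u].
Proof.
move=> [_ _ hmu].
have hm n : rtr (x ^+ n) = \int[mu]_(u in setT) (u ^+ n).
  by rewrite /rtr /tr oper_expr; have [_ ->] := hmu n.
(* The extra power absorbs the factor ['X] that each induction step on the polynomial splits off. *)
suff h n : mu.-integrable setT (fun u => (p.[u] * u ^+ n)%:E) /\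
    rtr (peval p x * x ^+ n) = \int[mu]_(u in setT) (p.[u] * u ^+ n).
  have [h1 h2] := h 0%N; rewrite expr0 mulr1 in h2; split.
    by apply: eq_integrable h1 => // u _; rewrite expr0 mulr1.
  by rewrite h2; apply: eq_Rintegral => u _; rewrite expr0 mulr1.
elim/poly_ind: p n => [|p c IH] n.
  split.
    by apply: eq_integrable (integrable0 mu setT) => // u _; rewrite horner0 mul0r.
  rewrite [peval 0 x]/peval !rmorph0 mul0r rtr0.
  by under eq_Rintegral do rewrite horner0 mul0r; rewrite Rintegral_cst // mul0r.
have [i1 e1] := IH n.+1.
have [i2 _] := hmu n.
have i3 : mu.-integrable setT (fun u => (c * u ^+ n)%:E).
  by under eq_fun do rewrite EFinM; exact: integrableZl.
have eh u : (p * 'X + c%:P).[u] * u ^+ n = p.[u] * u ^+ n.+1 + c * u ^+ n.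
  by rewrite !hornerE exprS; ring.
split.
  by under eq_fun do rewrite eh EFinD; exact: integrableD.
under eq_Rintegral do rewrite eh.
rewrite RintegralD // RintegralZl // -e1 -hm.
rewrite pevalD pevalM pevalX pevalC mulrDl -mulrA -exprS.
by rewrite -scalerAl mul1r rtrD rtrZ.
Qed.

Lemma semicircle_cheb x (v : R) n : 0 < v ->
  spectral_law (oper x) (has_density (semicircle_density v)) ->
  tr (peval (cheb v n.+1) x) = 0.
Proof.
move=> v0 [[mu hmu] hd]; have {hd} hd := hd _ hmu.
have sx : star x = x by apply: star_uniq; case: hmu.
rewrite tr_sa ?star_peval //.
rewrite (_ : rtr _ = 0) ?rmorph0 //.
apply: (@cheb_moment _ v (fun p => rtr (peval p x))).
- by move=> p q; rewrite pevalD rtrD.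
- by move=> r p; rewrite pevalZ rtrZ.
move=> q; have [i1 ->] := spectral_peval ((4 * v)%:P * q^`() - 'X ^+ 2 * q^`() - 3 *: ('X * q)) hmu.
rewrite -[RHS](semicircle_by_parts q v0).
apply: density_integral => //.
- by apply: continuous_measurable_fun; exact: continuous_semicircle.
- by move=> y; exact: semicircle_density_ge0.
- by move=> y; apply: semicircle_density_out; exact: ltW.
Qed.

Lemma alternating_word (F : bool -> set (op A)) c x :
  alternating (fun y => F false (oper y)) (fun y => F true (oper y)) c x ->
  exists n (i : nat -> bool) (X : nat -> op A),
  [/\ i 0%N = c, forall j, (j <= n)%N -> F (i j) (X j) /\ wp_expect (X j) = 0,
      forall j, (j < n)%N -> i j <> i j.+1 &
      oper x = \big[(fun S T : op A => S \o T)/idfun]_(j < n.+1) X j].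
Proof.
elim=> {c x} [c x Fx tx|c x y Fx tx _ [n [i [X [i0 hX hi e]]]]].
  exists 0%N, (fun=> c), (fun=> oper x); split => //.
    by move=> [|//] _; split => //; case: c Fx.
  by rewrite big_ord_recl big_ord0.
exists n.+1, (fun j => if j is j'.+1 then i j' else c),
  (fun j => if j is j'.+1 then X j' else oper x); split => //.
- by move=> [|j] hj; [split => //; case: c Fx {i0}|exact: hX].
- by move=> [|j] hj; [rewrite i0; case: c {Fx i0}|exact: hi].
- by rewrite big_ord_recl /=; rewrite e.
Qed.

Lemma free_free_from (F : bool -> set (op A)) : Defs.free F ->
  free_from (fun y => F false (oper y)) (fun y => F true (oper y)).
Proof.
move=> hF c x /alternating_word[n [i [X [_ hX hi e]]]].
by rewrite /tr e; apply: (hF n i X).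
Qed.

Variable W : R -> op A.
Hypothesis hW : free_brownian_motion W.

(** [W t] is known to lie in the algebra for nonnegative [t] only, hence a default value. *)
Definition bm t : M := if pselect (wp_alg (W t)) is left h then WAlg h else 0.
Definition past s : M -> Prop := generated [set W r | r in [set r | 0 <= r <= s]].

Lemma bmE t : 0 <= t -> oper (bm t) = W t.
Proof.
move=> t0; rewrite /bm; case: pselect => // h; exfalso; apply: h.
by case: hW => h _ _; exact: h.
Qed.

Lemma bm0 : bm 0 = 0.
Proof. by apply: oper_inj; rewrite bmE //; case: hW. Qed.

Lemma past_subalg s : subalg (past s).
Proof. exact: generated_subalg. Qed.

Lemma past_le s t x : s <= t -> past s x -> past t x.
Proof.
move=> st hx V hV hG; apply: hx => // _ [r /= /andP[r0 rs] <-].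
by apply: hG; exists r => //=; rewrite r0 (le_trans rs).
Qed.

Lemma past_bm r s : 0 <= r -> r <= s -> past s (bm r).
Proof.
move=> r0 rs V hV hG; rewrite bmE //; apply: hG; exists r => //=.
by rewrite r0.
Qed.

Lemma past_wp_alg s T : 0 <= s -> filtration W s T -> wp_alg T.
Proof.
move=> s0 h; apply: h; first exact: wp_algP.
by move=> _ [r /= /andP[r0 _] <-]; case: hW => h _ _; exact: h.
Qed.

Lemma bm_inc_law s t : 0 <= s -> s < t ->
  spectral_law (oper (bm t - bm s)) (has_density (semicircle_density (t - s))).
Proof.
move=> s0 st; have [_ _ /(_ s t s0 st)[_]] := hW.
have -> : oper (bm t - bm s) = oper (bm t) - oper (bm s) by [].
by rewrite !bmE // (le_trans s0) // ltW.
Qed.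

Lemma bm_inc_sa s t : 0 <= s -> s <= t -> star (bm t - bm s) = bm t - bm s.
Proof.
move=> s0; rewrite le_eqVlt => /predU1P[->|st]; first by rewrite subrr star0.
have [[mu [_ h _]] _] := bm_inc_law s0 st.
exact: star_uniq.
Qed.

Lemma bm_sa t : 0 <= t -> star (bm t) = bm t.
Proof. by move=> t0; have := bm_inc_sa (lexx 0) t0; rewrite bm0 subr0. Qed.

(** For [s < t] this is the free semicircular construction. For [s = t] increment and variance
    vanish, and creation is the zero map. *)
Lemma bm_creation s t : 0 <= s -> s <= t ->
  exists lp, creation (past s) (bm t - bm s) (t - s) lp.
Proof.
move=> s0; rewrite le_eqVlt => /predU1P[->|st].
  exists (fun _ z => z = 0); rewrite !subrr; split.
  - by move=> y z y' z' -> ->; rewrite addr0.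
  - by move=> c y z ->; rewrite scaler0.
  - by move=> b _; rewrite mul0r.
  - by move=> b y z _ _; exists 0.
  - by move=> y z _; exists 0.
  - by move=> y z y' z' -> ->; rewrite mul0r !ip0r ip0l addr0.
  - by move=> x y z y' z' _ _ -> ->; rewrite mulr0 ip0r !mul0r.
  - by move=> x y z _ _; exists 0; rewrite !mul0r scale0r addr0.
  - by move=> x y z _ ->; rewrite mulr0 rtr0.
pose C := generated [set W t - W s].
exists (fock_creation (past s) (bm t - bm s) (t - s)).
apply: (@fock_creationP _ _ (past s) C).
- exact: past_subalg.
- exact: generated_subalg.
- move=> V hV hG; apply: hG => /=.
  by rewrite !bmE // (le_trans s0) // ltW.
- by apply: bm_inc_sa => //; exact: ltW.
- by have [_ _ /(_ s t s0 st)[/free_free_from h _]] := hW; exact: h.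
- move=> n; apply: semicircle_cheb; first by rewrite subr_gt0.
  exact: bm_inc_law.
Qed.

End brownian_motion.

(** * Free martingales and the resolvent *)

Section martingale_bound.
Context {R : realType} {A : wprob_space R}.
Local Notation M := (walg A).
Implicit Types (x y z b c D : M) (s t e : R).
Variable W : R -> op A.
Hypothesis hW : free_brownian_motion W.
Local Notation w := (bm W).
Local Notation past := (past W).

(* Only the symmetric steps c S c fit the resolvent recursion that bounds the
   operator norm; steps p S q are polarised into differences of these. *)
Inductive mart (e s : R) : R -> M -> Prop :=
  | mart_nil : mart e s s 0
  | mart_add t t' D c : mart e s t D -> t <= t' -> past t c -> star c = c -> nle c e ->
      mart e s t' (D + c * (w t' - w t) * c)
  | mart_sub t t' D c : mart e s t D -> t <= t' -> past t c -> star c = c -> nle c e ->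
      mart e s t' (D - c * (w t' - w t) * c).

Lemma mart_le e s t D : mart e s t D -> s <= t.
Proof. by elim=> // t0 t' *; exact: (@le_trans _ _ t0). Qed.

Lemma mart_opp e s t D : mart e s t D -> mart e s t (- D).
Proof.
elim=> [|t0 t' D0 c _ h tt pc sc nc|t0 t' D0 c _ h tt pc sc nc].
- by rewrite oppr0; exact: mart_nil.
- by rewrite opprD; exact: mart_sub.
- by rewrite opprB addrC; exact: mart_add.
Qed.

Lemma mart_cat e s t t' D D' : mart e s t D -> mart e t t' D' -> mart e s t' (D + D').
Proof.
move=> h; elim=> [|t0 t1 D0 c _ h0 tt pc sc nc|t0 t1 D0 c _ h0 tt pc sc nc].
- by rewrite addr0.
- by rewrite addrA; exact: mart_add.
- by rewrite addrA; exact: mart_sub.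
Qed.

Lemma past_inc s t : 0 <= s -> s <= t -> past t (w t - w s).
Proof.
move=> s0 st; apply: (subB (past_subalg W t)).
  by apply: past_bm => //; exact: le_trans st.
exact: past_bm.
Qed.

Lemma past_closed t : closed_alg (past t).
Proof. by apply: subalg_closed; exact: past_subalg. Qed.

Lemma mart_past e s t D : 0 <= s -> mart e s t D -> past t D /\ star D = D.
Proof.
move=> s0.
have key t0 t' c : s <= t0 -> t0 <= t' -> past t0 c -> star c = c ->
   past t' (c * (w t' - w t0) * c) /\ star (c * (w t' - w t0) * c) = c * (w t' - w t0) * c.
  move=> st tt pc sc; have t00 := le_trans s0 st.
  have pc' := past_le tt pc; split.
    by have hS := past_subalg W t'; apply: (subM hS) => //; apply: (subM hS) => //; exact: past_inc.
  by rewrite !starM sc bm_inc_sa // mulrA.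
elim=> [|t0 t' D0 c hm [p0 sD] tt pc sc nc|t0 t' D0 c hm [p0 sD] tt pc sc nc].
- by split; [exact: sub0 (past_subalg W s)|exact: star0].
- have [h1 h2] := key _ _ _ (mart_le hm) tt pc sc; split.
    by apply: (subD (past_subalg W t')) => //; exact: past_le p0.
  by rewrite starD sD h2.
- have [h1 h2] := key _ _ _ (mart_le hm) tt pc sc; split.
    by apply: (subB (past_subalg W t')) => //; exact: past_le p0.
  by rewrite starB sD h2.
Qed.

(** An upper barrier for [D]: [a] is the compensator accumulated since time [s], and [G] the
    resolvent at level [l]. The trace of [G] is conserved and its L2 bound follows an exact
    recursion, whereas the gap [g] only has to stay positive. *)
Definition barrier (e s l t : R) (D : M) := exists a G g,
  [/\ past t a /\ star a = a,
      pos (((t - s) * e ^+ 4 / l)%:C *: 1 - a),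
      0 < g /\ pos (l%:C *: 1 + a - D - g%:C *: 1),
      [/\ (l%:C *: 1 + a - D) * G = 1, G * (l%:C *: 1 + a - D) = 1, star G = G & past t G] &
      rtr G = l^-1 /\ n2 G <= (l ^+ 2 - e ^+ 4 * (t - s))^-1].

(** One subordination with [q^2 = e^4 d / X]. It turns the bound [X^-1] on the squared L2 norm into
    [(X - e^4 d)^-1], which is the same bound at the later time; no loss accumulates with the number
    of steps. *)
Lemma barrier_step e s l t t' D c S lp : 0 <= s -> s <= t -> t < t' -> 0 < e -> 0 < l ->
  e ^+ 4 * (t' - s) < l ^+ 2 -> past t D -> star D = D -> star S = S -> past t' S ->
  creation (past t) S (t' - t) lp ->
  past t c -> star c = c -> nle c e ->
  barrier e s l t D -> barrier e s l t' (D + c * S * c).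
Proof.
move=> s0 st tt e0 l0 hl pD sD sS pS hS pc sc ce [a [G [g [[pa sa] ua [g0 hg] [hG Gh sG pG] [tG nG]]]]].
have B := past_subalg W t.
have d0 : 0 < t' - t by rewrite subr_gt0.
set d := t' - t in d0 hS *.
set X := l ^+ 2 - e ^+ 4 * (t - s) in nG.
have e4 : 0 < e ^+ 4 by rewrite exprn_gt0.
have dX : e ^+ 4 * d < X by rewrite /X /d; lra.
have X0 : 0 < X by apply: lt_trans dX; rewrite mulr_gt0.
pose q := Num.sqrt (e ^+ 4 * d / X).
have q2 : q ^+ 2 = e ^+ 4 * d / X by rewrite sqr_sqrtr // ltW // divr_gt0 // mulr_gt0.
have q0 : 0 < q by rewrite sqrtr_gt0 divr_gt0 // mulr_gt0.
have q1 : q < 1.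
  by rewrite -(ltr_sqr (_ : q \is Num.nneg)) ?nnegrE ?ltW // q2 expr1n ltr_pdivrMr // mul1r.
have nGc : rtr (c * G * G * c) <= e ^+ 2 * X^-1.
  have -> : rtr (c * G * G * c) = n2 (G * c) by rewrite /n2 /ip starM sc sG !mulrA.
  by apply: (le_trans (n2_mulr G (ltW e0) ce)); rewrite ler_wpM2l // sqr_ge0.
have hq : d * e ^+ 2 * rtr (c * G * G * c) <= q ^+ 2.
  rewrite q2; apply: (le_trans (ler_wpM2l _ nGc)); first by rewrite mulr_ge0 ?sqr_ge0 // ltW.
  rewrite le_eqVlt; apply/orP; left; apply/eqP; ring.
have shh : star (l%:C *: 1 + a - D) = l%:C *: 1 + a - D.
  by rewrite starB starD starZr star1 sa sD.
have ph : past t (l%:C *: 1 + a - D).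
  apply: (subB B) => //; apply: (subD B) => //; apply: (subZ B); exact: sub1.
have [P [g' [[g'0 hg' _] [PK KP sP _] hP tP [nP _]]]] :=
  subordination B sS (ltW d0) hS ph shh g0 hg hG Gh pG sG pc sc (ltW e0) ce q0 q1 hq.
have tGc0 : 0 <= rtr (c * G * c).
  have pG' : pos G.
    have := pos_conj G (posD hg (pos_real (ltW g0))).
    by rewrite subrK sG -mulrA hG mulr1.
  by rewrite -{1}sc; apply: rtr_pos; exact: pos_conj.
have ecc : pos ((e ^+ 2)%:C *: 1 - c * c).
  split; first by rewrite starB starZr star1 starM sc.
  by have := (nle_sqP c (ltW e0)).1 ce; rewrite sc.
have tGc : rtr (c * G * c) <= e ^+ 2 * l^-1.
  have pG' : pos G.
    have := pos_conj G (posD hg (pos_real (ltW g0))).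
    by rewrite subrK sG -mulrA hG mulr1.
  have := rtr_posM ecc pG'; rewrite mulrBl -scalerAl mul1r rtrB rtrZ tG subr_ge0.
  by rewrite [rtr (c * G * c)]rtrC mulrA.
pose a' := a + (d * rtr (c * G * c))%:C *: (c * c).
have eK : sub_den S d (l%:C *: 1 + a - D) G c = l%:C *: 1 + a' - (D + c * S * c).
  by rewrite /sub_den /a'; nc.
rewrite eK in hg' PK KP hP.
have pa' : past t a'.
  by apply: (subD B) => //; apply: (subZ B); exact: (subM B).
have B' := past_subalg W t'.
exists a', P, g'; split.
- by split; [exact: (past_le (ltW tt))|rewrite /a' starD starZr starM sc sa].
- have -> : ((t' - s) * e ^+ 4 / l)%:C *: 1 - a' =
     (((t - s) * e ^+ 4 / l)%:C *: 1 - a) +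
     (((d * rtr (c * G * c))%:C *: ((e ^+ 2)%:C *: 1 - c * c)) +
      (d * e ^+ 2 * (e ^+ 2 / l - rtr (c * G * c)))%:C *: 1).
    have -> : (t' - s) * e ^+ 4 / l = (t - s) * e ^+ 4 / l + d * rtr (c * G * c) * e ^+ 2 +
       d * e ^+ 2 * (e ^+ 2 / l - rtr (c * G * c)).
      by rewrite /d; field; rewrite gt_eqF.
    by rewrite /a'; nc.
  apply: posD => //; apply: posD.
    by apply: posZ => //; rewrite mulr_ge0 // ltW.
  by apply: pos_real; rewrite !mulr_ge0 ?sqr_ge0 ?subr_ge0 // ltW.
- by split.
- split => //; apply: (hP (past t') (past_closed t')).
  have tt' := ltW tt.
  apply: (subB B').
    apply: (subD B'); last exact: past_le pa'.
    by apply: (subZ B'); exact: sub1.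
  apply: (subD B'); first exact: past_le pD.
  have pc' := past_le tt' pc.
  by apply: (subM B') => //; exact: (subM B').
- split; first by have := tP 1 (sub1 B); rewrite !mul1r => ->.
  apply: (le_trans nP); rewrite q2.
  have X1 : 0 < X - e ^+ 4 * d by rewrite subr_gt0.
  have -> : l ^+ 2 - e ^+ 4 * (t' - s) = X - e ^+ 4 * d by rewrite /X /d; ring.
  have -> : (X - e ^+ 4 * d)^-1 = X^-1 / (1 - e ^+ 4 * d / X).
    by field; rewrite !gt_eqF.
  rewrite ler_wpM2r // invr_ge0 subr_ge0 ler_pdivrMr // mul1r ltW //.
Qed.

Lemma mart_barrier e s l t D : 0 <= s -> 0 < e -> 0 < l -> mart e s t D ->
  e ^+ 4 * (t - s) < l ^+ 2 -> barrier e s l t D.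
Proof.
move=> s0 e0 l0; elim=> [|t0 t' D0 c hm IH tt pc sc nc|t0 t' D0 c hm IH tt pc sc nc] hl.
- exists 0, (l^-1%:C *: 1), l; rewrite subrr !mul0r scale0r mulr0 subr0.
  have eL : l%:C *: 1 + 0 - 0 = l%:C *: 1 :> M by rewrite addr0 subr0.
  have B := past_subalg W s.
  have l1 : l != 0 by rewrite gt_eqF.
  have e1 : l%:C *: 1 * (l^-1%:C *: 1) = 1 :> M.
    by rewrite -scalerAl -scalerAr mulr1 scalerA -rmorphM mulfV // rmorph1 scale1r.
  have e2 : l^-1%:C *: 1 * (l%:C *: 1) = 1 :> M.
    by rewrite -scalerAl -scalerAr mulr1 scalerA -rmorphM mulVf // rmorph1 scale1r.
  rewrite eL subrr; split => //.
  + by split; [exact: sub0|exact: star0].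
  + exact: pos0.
  + by split => //; exact: pos0.
  + by split => //; [rewrite starZr star1|apply: (subZ B); exact: sub1].
  + by rewrite rtrZ rtr1 mulr1 n2Z n2_1 mulr1 exprVn subr0.
- have st := mart_le hm; have [pD sD] := mart_past s0 hm.
  have t00 := le_trans s0 st.
  move: tt; rewrite le_eqVlt => /predU1P[et|tt].
    by rewrite -et subrr mulr0 mul0r addr0; apply: IH; rewrite et.
  have IH' : barrier e s l t0 D0.
    by apply: IH; apply: le_lt_trans hl; apply: ler_wpM2l; [by rewrite exprn_ge0 // ltW|by rewrite lerD2r ltW].
  have [lp hlp] := bm_creation hW t00 (ltW tt).
  apply: (barrier_step _ st tt _ _ hl pD sD _ _ hlp) => //.
    by apply: bm_inc_sa => //; exact: ltW.
  by apply: past_inc => //; exact: ltW.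
- have st := mart_le hm; have [pD sD] := mart_past s0 hm.
  have t00 := le_trans s0 st.
  move: tt; rewrite le_eqVlt => /predU1P[et|tt].
    by rewrite -et subrr mulr0 mul0r subr0; apply: IH; rewrite et.
  have IH' : barrier e s l t0 D0.
    by apply: IH; apply: le_lt_trans hl; apply: ler_wpM2l; [by rewrite exprn_ge0 // ltW|by rewrite lerD2r ltW].
  have [lp hlp] := bm_creation hW t00 (ltW tt).
  have -> : D0 - c * (w t' - w t0) * c = D0 + c * - (w t' - w t0) * c by nc.
  apply: (barrier_step _ st tt _ _ hl pD sD _ _ (creation_opp hlp)) => //.
    by rewrite starN bm_inc_sa // ltW.
  by apply: (subN (past_subalg W t')); apply: past_inc => //; exact: ltW.
Qed.

Lemma mart_upper e s t D : 0 <= s -> 0 < e -> mart e s t D ->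
  pos ((2 * (e ^+ 2 * (1 + (t - s))))%:C *: 1 - D).
Proof.
move=> s0 e0 hm; have st := mart_le hm; set v := t - s.
have v0 : 0 <= v by rewrite subr_ge0.
(* Any [l] with [e^4 v < l^2] keeps the barrier alive; this one also makes the compensator, bounded
   by [v e^4 / l], at most [l]. *)
pose l := e ^+ 2 * (1 + v).
have e2 : 0 < e ^+ 2 by rewrite exprn_gt0.
have l0 : 0 < l by rewrite mulr_gt0 //; lra.
have hl : e ^+ 4 * v < l ^+ 2.
  rewrite /l exprMn (_ : (e ^+ 2) ^+ 2 = e ^+ 4); last by ring.
  by rewrite ltr_pM2l ?exprn_gt0 //; nra.
have [a [G [g [_ ua [g0 hg] _ _]]]] := mart_barrier s0 e0 l0 hm hl.
rewrite -/v in ua.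
have vl : v * e ^+ 4 / l <= l.
  by rewrite ler_pdivrMr // -expr2 ltW // mulrC.
have -> : (2 * l)%:C *: 1 - D = ((l%:C *: 1 + a - D - g%:C *: 1) + g%:C *: 1) +
   (((v * e ^+ 4 / l)%:C *: 1 - a) + (l - v * e ^+ 4 / l)%:C *: 1).
  set u := v * e ^+ 4 / l; nc.
apply: posD; first by apply: posD => //; apply: pos_real; exact: ltW.
by apply: posD => //; apply: pos_real; rewrite subr_ge0.
Qed.

(** The bound involves the size of the coefficients and the elapsed time but not the number of
    steps, so it is stable under refinement. *)
Lemma mart_nle e s t D : 0 <= s -> 0 < e -> mart e s t D ->
  nle D (2 * (e ^+ 2 * (1 + (t - s)))).
Proof.
move=> s0 e0 hm; apply: pos_nle.
- by have := mart_le hm => st; rewrite !mulr_gt0 ?exprn_gt0 //; lra.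
- exact: mart_upper.
- by rewrite -[D]opprK; apply: mart_upper => //; exact: mart_opp.
Qed.

End martingale_bound.

(** * The resolvent of free Brownian motion *)

Section resolvent_process.
Context {R : realType} {A : wprob_space R}.
Local Notation M := (walg A).
Implicit Types (x y z b c D : M) (s t r e q : R).
Variable W : R -> op A.
Hypothesis hW : free_brownian_motion W.
Variable k : R.
Local Notation w := (bm W).
Local Notation past := (past W).

(** Subordination with [c = 1] and the scalar denominator [2 sqrt d]: then [q = 1/2] and the
    compensator is [sqrt d / 2], so that [5/2 sqrt d] already bounds the increment. The sharp
    constant 2 would correspond to the excluded value [q = 1]. *)
Lemma bm_inc_nle s t : 0 <= s -> s <= t -> nle (w t - w s) (3 * Num.sqrt (t - s)).
Proof.
move=> s0; rewrite le_eqVlt => /predU1P[->|st].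
  by rewrite !subrr sqrtr0 mulr0; apply: nle0.
set d := t - s; have d0 : 0 < d by rewrite subr_gt0.
have rd : 0 < Num.sqrt d by rewrite sqrtr_gt0.
have rd2 : Num.sqrt d ^+ 2 = d by rewrite sqr_sqrtr // ltW.
pose l := 2 * Num.sqrt d; have l0 : 0 < l by rewrite mulr_gt0.
have hB := past_subalg W s.
have key S lp : star S = S -> creation (past s) S d lp -> pos ((3 * Num.sqrt d)%:C *: 1 - S).
  move=> sS hl.
  have hh : pos (l%:C *: 1 - l%:C *: 1 : M) by rewrite subrr; exact: pos0.
  have hG : l%:C *: 1 * (l^-1%:C *: 1) = 1 :> M.
    by rewrite -scalerAl -scalerAr mulr1 scalerA -rmorphM mulfV ?gt_eqF // rmorph1 scale1r.
  have Gh : l^-1%:C *: 1 * (l%:C *: 1) = 1 :> M.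
    by rewrite -scalerAl -scalerAr mulr1 scalerA -rmorphM mulVf ?gt_eqF // rmorph1 scale1r.
  have pr (u : R) : past s (u%:C *: 1) by apply: (subZ hB); exact: sub1.
  have sr (u : R) : star (u%:C *: 1) = u%:C *: 1 :> M by rewrite starZr star1.
  have hq : d * 1 ^+ 2 * rtr (1 * (l^-1%:C *: 1) * (l^-1%:C *: 1) * 1 : M) <= (2^-1) ^+ 2.
    have -> : 1 * (l^-1%:C *: 1) * (l^-1%:C *: 1) * 1 = (l^-1 * l^-1)%:C *: 1 :> M by nc.
    rewrite rtrZ rtr1 expr1n !mulr1 /l -{1}rd2.
    by rewrite le_eqVlt; apply/orP; left; apply/eqP; field; rewrite gt_eqF.
  have h20 : 0 < 2^-1 :> R by lra.
  have h21 : 2^-1 < 1 :> R by lra.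
  have [P [g' [[g'0 hg' _] _ _ _ _]]] := subordination hB sS (ltW d0) hl (pr l) (sr l) l0 hh hG Gh
    (pr _) (sr _) (sub1 hB) star1 ler01 nle1 h20 h21 hq.
  move: hg'; rewrite /sub_den !mul1r !mulr1 rtrZ rtr1 mulr1 => hg'.
  have := posD hg' (pos_real (ltW g'0)); rewrite subrK => h1.
  have -> : (3 * Num.sqrt d)%:C *: 1 - S = (l%:C *: 1 + (d / l)%:C *: 1 - S) +
     (Num.sqrt d / 2)%:C *: 1.
    have -> : 3 * Num.sqrt d = l + d / l + Num.sqrt d / 2.
      by rewrite /l -{3}rd2; field; rewrite gt_eqF.
    by nc.
  by apply: posD => //; apply: pos_real; rewrite divr_ge0 // ltW.
have [lp hlp] := bm_creation hW s0 (ltW st).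
have sS := bm_inc_sa hW s0 (ltW st).
apply: pos_nle; first by rewrite mulr_gt0.
  exact: key hlp.
rewrite -[w t - w s]opprK; apply: (key _ _ _ (creation_opp hlp)).
by rewrite starN sS.
Qed.

(** Here [k] stands for the product [a k] of the theorem. *)
Definition den t : M := (1 + k ^+ 2 * t)%:C *: 1 - k%:C *: w t.

Lemma den0 : den 0 = 1.
Proof. by rewrite /den (bm0 hW) mulr0 addr0 scaler0 subr0 scale1r. Qed.

Lemma den_past t : 0 <= t -> past t (den t).
Proof.
move=> t0; have B := past_subalg W t.
apply: (subB B); first by apply: (subZ B); exact: sub1.
by apply: (subZ B); exact: past_bm.
Qed.

Lemma star_den t : 0 <= t -> star (den t) = den t.
Proof. by move=> t0; rewrite /den starB !starZr star1 bm_sa. Qed.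

(** [c] is the scalar [sqrt |k|], and the sign of [k] goes into the increment. As [tr G = 1], the
    compensator is exactly [k^2 (t - s)], so subordination leads from [den s] to [den t]. *)
Lemma den_step s t G g q : 0 <= s -> s <= t -> 0 < g -> pos (den s - g%:C *: 1) ->
  den s * G = 1 -> G * den s = 1 -> past s G -> star G = G -> rtr G = 1 ->
  0 < q -> q < 1 -> (t - s) * k ^+ 2 * n2 G <= q ^+ 2 ->
  exists P, [/\ pos (den t - (g * (1 - q) ^+ 2)%:C *: 1),
    [/\ P * den t = 1, den t * P = 1, star P = P, past t P & nle P (g * (1 - q) ^+ 2)^-1],
    forall b, past s b -> rtr (b * P) = rtr (b * G),
    n2 P <= n2 G / (1 - q ^+ 2) /\
    n2 (P - G - k%:C *: (G * (w t - w s) * G)) <= q ^+ 4 * n2 G / (1 - q ^+ 2) &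
    forall N, \sum_(i < N) ((t - s) * k ^+ 2 * n2 G) ^+ i * n2 G <= n2 P].
Proof.
move=> s0 st g0 hg hG Gh pG sG tG q0 q1 hq.
have hB := past_subalg W s.
have t0 := le_trans s0 st.
have [S [lp [hS sS eS]]] : exists S lp, [/\ creation (past s) S (t - s) lp, star S = S &
    `|k|%:C *: S = k%:C *: (w t - w s)].
  have [lp hlp] := bm_creation hW s0 st; have sS := bm_inc_sa hW s0 st.
  have [k0|k0] := leP 0 k.
    by exists (w t - w s), lp; rewrite ger0_norm.
  exists (- (w t - w s)), (fun y z => lp y (- z)); split.
  - exact: creation_opp.
  - by rewrite starN sS.
  - by rewrite ltr0_norm // rmorphN /= scaleNr scalerN opprK.
pose rk := Num.sqrt `|k|; pose c : M := rk%:C *: 1.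
have rk0 : 0 <= rk by exact: sqrtr_ge0.
have rk2 : rk * rk = `|k| by rewrite -expr2 sqr_sqrtr.
have k2 : `|k| * `|k| = k ^+ 2 by rewrite -expr2 real_normK // num_real.
have pc : past s c by apply: (subZ hB); exact: sub1.
have sc : star c = c by rewrite /c starZr star1.
have nc' : nle c rk by have := nleZr rk0 (@nle1 _ A); rewrite mulr1.
have ecc x : c * x * c = `|k|%:C *: x.
  by rewrite /c -scalerAl -scalerAr mul1r mulr1 scalerA -rmorphM rk2.
have cGGc : rtr (c * G * G * c) = `|k| * n2 G.
  by rewrite -[c * G * G]mulrA ecc rtrZ /n2 /ip sG.
have d0 : 0 <= t - s by rewrite subr_ge0.
have eqq : (t - s) * rk ^+ 2 * rtr (c * G * G * c) = (t - s) * k ^+ 2 * n2 G.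
  by rewrite cGGc expr2 rk2 -k2; ring.
have hq' : (t - s) * rk ^+ 2 * rtr (c * G * G * c) <= q ^+ 2 by rewrite eqq.
have shs := star_den s0; have phs := den_past s0.
have eK : sub_den S (t - s) (den s) G c = den t.
  rewrite /sub_den !ecc rtrZ tG -[c * c](mulr1) -mulrA (_ : c * (c * 1) = `|k|%:C *: 1); last first.
    by rewrite -(ecc 1) !mulr1.
  have -> : ((t - s) * (`|k| * 1))%:C *: (`|k|%:C *: 1) = ((t - s) * k ^+ 2)%:C *: 1 :> M.
    by rewrite scalerA -rmorphM /= mulr1 -mulrA k2.
  rewrite eS /den.
  have -> : 1 + k ^+ 2 * t = 1 + k ^+ 2 * s + (t - s) * k ^+ 2 by ring.
  by nc.
have [P [g' [[g'0 hg' eg] [PK KP sP nP] hP tP [n2P n2P']]]] :=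
  subordination hB sS d0 hS phs shs g0 hg hG Gh pG sG pc sc rk0 nc' q0 q1 hq'.
rewrite eK in hg' PK KP hP; subst g'.
exists P; split => //.
- split => //; apply: (hP (past t) (past_closed W t)); exact: den_past.
- split => //; move: n2P'.
  have -> : G * c * S * c * G = k%:C *: (G * (w t - w s) * G).
    have -> : G * c * S * c * G = G * (c * S * c) * G by rewrite !mulrA.
    by rewrite ecc eS -scalerAr -scalerAl.
  exact.
- move=> N; rewrite -eqq; rewrite -eK in PK.
  apply: (@sub_n2_ge _ _ _ _ _ _ hB d0 hS _ _ _ _ _ hG pG sG pc sc rk0 nc' q0 q1 hq' _ N PK).
  by move=> y; rewrite /c -scalerAl mul1r n2Z.
Qed.

Definition res t : M := xget 0 [set P | P * den t = 1 /\ den t * P = 1].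

Lemma res_eq t P : P * den t = 1 -> den t * P = 1 -> res t = P.
Proof.
move=> h1 h2; rewrite /res; case: xgetP => [y _ [h3 h4]|hn]; last by case: (hn P).
by rewrite -[LHS]mulr1 -h2 mulrA h3 mul1r.
Qed.

Lemma res0 : res 0 = 1.
Proof. by apply: res_eq; rewrite den0 mulr1. Qed.

Lemma res_facts t q : 0 <= t -> 0 < q -> q < 1 -> k ^+ 2 * t <= q ^+ 2 ->
  [/\ pos (den t - ((1 - q) ^+ 2)%:C *: 1),
    [/\ res t * den t = 1, den t * res t = 1, star (res t) = res t, past t (res t) &
      nle (res t) ((1 - q) ^+ 2)^-1],
    rtr (res t) = 1, n2 (res t) <= (1 - q ^+ 2)^-1 &
    forall N, \sum_(i < N) (k ^+ 2 * t) ^+ i <= n2 (res t)].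
Proof.
move=> t0 q0 q1 hq.
have B := past_subalg W 0.
have [|||||P [h1 [h2 h3 h4 h5 h6] h7 [h8 _] h9]] := @den_step 0 t 1 1 q (lexx 0) t0 ltr01
   _ _ _ (sub1 B) star1 _ q0 q1 _.
- by rewrite den0 rmorph1 scale1r subrr; exact: pos0.
- by rewrite den0 mulr1.
- by rewrite den0 mulr1.
- exact: rtr1.
- by rewrite subr0 n2_1 mulr1 mulrC.
rewrite (res_eq h2 h3); rewrite mul1r in h1 h6.
split => //.
- by have := h7 1 (sub1 B); rewrite !mul1r rtr1.
- by rewrite n2_1 mul1r in h8.
- move=> N; have := h9 N; rewrite subr0 n2_1 mulr1 (mulrC t).
  by under eq_bigr do rewrite mulr1.
Qed.

End resolvent_process.

(** * Riemann sums of the resolvent and their martingale remainders *)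

Section resolvent_integral.
Context {R : realType} {A : wprob_space R}.
Local Notation M := (walg A).
Implicit Types (x y z b c D : M) (s t r e : R).
Variable W : R -> op A.
Hypothesis hW : free_brownian_motion W.
Variables (k T q : R).
Hypothesis k_neq0 : k != 0.
Hypothesis q_gt0 : 0 < q.
Hypothesis q_lt1 : q < 1.
Hypothesis hT : k ^+ 2 * T <= q ^+ 2.
Local Notation w := (bm W).
Local Notation past := (past W).
Local Notation res := (res W k).
Local Notation den := (den W k).
Local Notation mart := (mart W).
Let L := ((1 - q) ^+ 2)^-1.
Let N := (1 - q ^+ 2)^-1.

Let L_gt0 : 0 < L.
Proof. by rewrite invr_gt0 exprn_gt0 // subr_gt0. Qed.
Let N_gt0 : 0 < N.
Proof. by rewrite invr_gt0 subr_gt0 expr_lt1 // ltW. Qed.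
Let k2_gt0 : 0 < k ^+ 2.
Proof. by rewrite exprn_even_gt0. Qed.

Lemma res_bd t : 0 <= t -> t <= T ->
  [/\ pos (den t - ((1 - q) ^+ 2)%:C *: 1),
    [/\ res t * den t = 1, den t * res t = 1, star (res t) = res t, past t (res t) &
      nle (res t) L],
    rtr (res t) = 1, n2 (res t) <= N &
    forall N, \sum_(i < N) (k ^+ 2 * t) ^+ i <= n2 (res t)].
Proof.
move=> t0 tT; apply: res_facts => //; apply: le_trans hT.
by rewrite ler_wpM2l // ltW.
Qed.

Lemma res_past t s : 0 <= t -> t <= T -> t <= s -> past s (res t).
Proof. by move=> t0 tT ts; have [_ [_ _ _ h _] _ _ _] := res_bd t0 tT; exact: past_le h. Qed.

Lemma star_res t : 0 <= t -> t <= T -> star (res t) = res t.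
Proof. by move=> t0 tT; have [_ [_ _ h _ _] _ _ _] := res_bd t0 tT. Qed.

Lemma res_nle t : 0 <= t -> t <= T -> nle (res t) L.
Proof. by move=> t0 tT; have [_ [_ _ _ _ h] _ _ _] := res_bd t0 tT. Qed.

Lemma past_inc_orth s t b x : 0 <= s -> s <= t -> past s b -> past s x ->
  rtr (b * ((w t - w s) * x)) = 0.
Proof.
move=> s0 st pb px; have [lp hlp] := bm_creation hW s0 st.
exact: (lp_orth hlp pb (lp_base hlp px)).
Qed.

(** [den_step] on [[s, t]] with [q^2 = (t - s) k^2 N]; the assumption [q^2 <= 1/2] accounts for the
    factor 2 in the bound. *)
Lemma res_step s t : 0 <= s -> s <= t -> t <= T -> (t - s) * k ^+ 2 * N <= 2^-1 ->
  (forall b, past s b ->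
     rtr (b * (res t - res s - k%:C *: (res s * (w t - w s) * res s))) = 0) /\
  n2 (res t - res s - k%:C *: (res s * (w t - w s) * res s)) <=
    2 * k ^+ 4 * N ^+ 3 * (t - s) ^+ 2.
Proof.
move=> s0; rewrite le_eqVlt => /predU1P[->|st] tT hst.
  rewrite !subrr mulr0 mul0r scaler0 subrr; split; last first.
    by rewrite n2_0 expr0n /= mulr0.
  by move=> b _; rewrite mulr0 rtr0.
have sT : s <= T by apply: le_trans tT; exact: ltW.
have t0 : 0 <= t by apply: le_trans s0 _; exact: ltW.
have [h1 [h2 h3 h4 h5 h6] h7 h8 _] := res_bd s0 sT.
have d0 : 0 < t - s by rewrite subr_gt0.
set x := (t - s) * k ^+ 2 * N in hst.
have x0 : 0 < x by apply: mulr_gt0 => //; exact: mulr_gt0.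
have sx2 : Num.sqrt x ^+ 2 = x by rewrite sqr_sqrtr // ltW.
have sx0 : 0 < Num.sqrt x by rewrite sqrtr_gt0.
have sx1 : Num.sqrt x < 1.
  by rewrite -(ltr_sqr (_ : Num.sqrt x \is Num.nneg)) ?nnegrE ?ltW // sx2 expr1n; lra.
have g0 : 0 < (1 - q) ^+ 2 by rewrite exprn_gt0 // subr_gt0.
have hx : (t - s) * k ^+ 2 * n2 (res s) <= Num.sqrt x ^+ 2.
  by rewrite sx2 /x; apply: ler_wpM2l => //; rewrite ltW // mulr_gt0.
have [P [_ [PK KP sP pP _] hP [_ hP2] _]] :=
  den_step hW s0 (ltW st) g0 h1 h3 h2 h5 h4 h7 sx0 sx1 hx.
rewrite (res_eq PK KP); split.
  move=> b pb; have B := past_subalg W s.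
  have -> : b * (P - res s - k%:C *: (res s * (w t - w s) * res s)) =
     b * P - b * res s - k%:C *: (b * res s * ((w t - w s) * res s)) by nc.
  rewrite 2!rtrB hP // subrr sub0r rtrZ.
  by rewrite past_inc_orth ?mulr0 ?oppr0 // ?ltW //; apply: (subM B).
apply: (le_trans hP2).
have -> : Num.sqrt x ^+ 4 = x ^+ 2 by rewrite (exprM _ 2 2) sx2.
rewrite sx2 ler_pdivrMr; last lra.
have n0 := n2_ge0 (res s).
have : x ^+ 2 * n2 (res s) <= x ^+ 2 * N by rewrite ler_wpM2l // sqr_ge0.
have -> : 2 * k ^+ 4 * N ^+ 3 * (t - s) ^+ 2 = 2 * (x ^+ 2 * N) by rewrite /x; ring.
have : 0 <= x ^+ 2 * N by rewrite mulr_ge0 ?sqr_ge0 // ltW.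
nra.
Qed.

(** The resolvent identity [Y_t - Y_s = Y_t (den s - den t) Y_s], combined with the norm bound on
    increments. *)
Lemma res_cont s t : 0 <= s -> s <= t -> t <= T ->
  nle (res t - res s) (L ^+ 2 * (k ^+ 2 * (t - s) + `|k| * (3 * Num.sqrt (t - s)))).
Proof.
move=> s0 st tT; have t0 := le_trans s0 st; have sT := le_trans st tT.
have [_ [h1 h2 _ _ h3] _ _ _] := res_bd s0 sT.
have [_ [h4 h5 _ _ h6] _ _ _] := res_bd t0 tT.
have -> : res t - res s = res t * (k%:C *: (w t - w s) - (k ^+ 2 * (t - s))%:C *: 1) * res s.
  have -> : k%:C *: (w t - w s) - (k ^+ 2 * (t - s))%:C *: 1 = den s - den t.
    by rewrite /den; nc.
  by rewrite mulrBr mulrBl h4 mul1r -mulrA h2 mulr1.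
have e : L ^+ 2 * (k ^+ 2 * (t - s) + `|k| * (3 * Num.sqrt (t - s))) =
   L * (`|k| * (3 * Num.sqrt (t - s)) + k ^+ 2 * (t - s)) * L by ring.
have d0 : 0 <= t - s by rewrite subr_ge0.
have n0 : 0 <= `|k| * (3 * Num.sqrt (t - s)) + k ^+ 2 * (t - s).
  apply: addr_ge0; last exact: mulr_ge0 (sqr_ge0 _) d0.
  by apply: mulr_ge0 => //; apply: mulr_ge0 => //; exact: sqrtr_ge0.
rewrite e; apply: nleM => //; first by rewrite mulr_ge0 // ltW.
apply: nleM => //; first exact: ltW.
apply: nleB.
  have := nleZ k%:C (bm_inc_nle hW s0 st).
  by rewrite normc_def /= expr0n addr0 sqrtr_sqr.
by have := nleZr (mulr_ge0 (sqr_ge0 k) d0) (@nle1 _ A); rewrite mulr1.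
Qed.

(** With [u] proportional to [p + x] and [v] to [p - x], the difference of [(u + v) S (u + v)] and
    [(u - v) S (u - v)] is [2 (p S p - x S x)]. The scalings [al] and [be], of product 1, balance
    the large sum against the small difference, so that both coefficients have norm at most [e]. *)
Lemma mart_polar e s t t' p x om D D' : 0 < e -> s <= t -> t <= t' ->
  past t p -> past t x -> star p = p -> star x = x -> nle p L -> nle x L ->
  nle (p - x) om -> 0 <= om -> om <= e ^+ 2 / (4 * L) ->
  mart e s t D -> mart e s t D' ->
  exists Dp Dm, [/\ mart e s t' Dp, mart e s t' Dm &
    Dp - Dm = D - D' + 2%:C *: (p * (w t' - w t) * p - x * (w t' - w t) * x)].
Proof.
move=> e0 st tt pp px sp sx np nx npx om0 hom mD mD'.
have B := past_subalg W t.
pose al := e / (2 * L); pose be := 2 * L / e.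
have al0 : 0 < al by rewrite divr_gt0 // mulr_gt0.
have be0 : 0 < be by rewrite divr_gt0 // mulr_gt0.
have ab : al * be = 1 by rewrite /al /be; field; rewrite !gt_eqF.
pose u := al%:C *: ((2^-1)%:C *: (p + x)); pose v := be%:C *: (p - x).
have nu : nle u (e / 2).
  have -> : e / 2 = al * (2^-1 * (L + L)) by rewrite /al; field; rewrite gt_eqF.
  by apply: nleZr; [exact: ltW|apply: nleZr; [lra|exact: nleD]].
have nv : nle v (e / 2).
  apply: (@nle_le _ _ _ (be * om)); last by apply: nleZr => //; exact: ltW.
  have -> : e / 2 = be * (e ^+ 2 / (4 * L)) by rewrite /be; field; rewrite !gt_eqF.
  by rewrite ler_wpM2l // ltW.
have pu : past t u by do 2 ! apply: (subZ B); exact: (subD B).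
have pv : past t v by apply: (subZ B); exact: (subB B).
have su : star u = u by rewrite /u !starZr starD sp sx.
have sv : star v = v by rewrite /v !starZr starB sp sx.
exists (D + (u + v) * (w t' - w t) * (u + v)), (D' + (u - v) * (w t' - w t) * (u - v)); split.
- apply: mart_add => //; first exact: (subD B).
    by rewrite starD su sv.
  by rewrite [e]splitr; exact: nleD.
- apply: mart_add => //; first exact: (subB B).
    by rewrite starB su sv.
  by rewrite [e]splitr; exact: nleB.
- set S := w t' - w t.
  have -> : D + (u + v) * S * (u + v) - (D' + (u - v) * S * (u - v)) =
     D - D' + (al * be)%:C *: (2%:C *: (p * S * p - x * S * x)) by rewrite /u /v; nc.
  by rewrite ab rmorph1 scale1r.
Qed.

(** The cell is refined into [m] steps. The errors of [res_step] are orthogonal, so their squared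
    norms add up to [m C h^2 = C u^2 / m]. Replacing [res] at the refined points by its value at [r]
    costs terms that [mart_polar] turns into martingales. *)
Lemma res_interval e r s t om eta : 0 < e -> 0 <= r -> r <= s -> s <= t -> t <= T ->
  (forall x : R, s <= x <= t -> nle (res x - res r) om) -> 0 <= om ->
  om <= e ^+ 2 / (4 * L) -> 0 < eta ->
  exists Dp Dm, [/\ mart e s t Dp, mart e s t Dm &
    n2 (res t - res s - k%:C *: (res r * (w t - w s) * res r) -
       (k / 2)%:C *: (Dp - Dm)) <= eta].
Proof.
move=> e0 r0 rs st tT hom om0 home eta0.
have s0 := le_trans r0 rs; have sT := le_trans st tT; have rT := le_trans rs sT.
pose C := 2 * k ^+ 4 * N ^+ 3; pose u := t - s.
have u0 : 0 <= u by rewrite subr_ge0.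
have C0 : 0 <= C.
  apply: mulr_ge0; last by rewrite exprn_ge0 // ltW.
  by apply: mulr_ge0 => //; rewrite exprn_even_ge0.
(* The first condition makes each step short enough for [res_step], the second one makes the
   accumulated error at most [eta]. *)
have [m m0 hm] : exists2 m : nat, (0 < m)%N &
    u * k ^+ 2 * N <= m%:R / 2 /\ C * u ^+ 2 <= m%:R * eta.
  pose z := 2 * (u * k ^+ 2 * N) + C * u ^+ 2 / eta.
  have z1 : 0 <= C * u ^+ 2 / eta.
    by apply: divr_ge0; [exact: mulr_ge0 C0 (sqr_ge0 _)|exact: ltW].
  have z2 : 0 <= 2 * (u * k ^+ 2 * N).
    by apply: mulr_ge0 => //; apply: mulr_ge0; [exact: mulr_ge0 u0 (sqr_ge0 k)|exact: ltW].
  exists (Num.truncn z).+1 => //; have hz := truncnS_gt z.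
  split; first by rewrite ler_pdivlMr //; rewrite /z in hz; lra.
  rewrite -ler_pdivrMr //; rewrite /z in hz; lra.
have mR : 0 < m%:R :> R by rewrite ltr0n.
pose h := u / m%:R; have h0 : 0 <= h by rewrite divr_ge0 // ltW.
have hk : h * k ^+ 2 * N <= 2^-1.
  have -> : h * k ^+ 2 * N = u * k ^+ 2 * N / m%:R by rewrite /h; field; rewrite gt_eqF.
  by rewrite ler_pdivrMr //; case: hm; lra.
pose tj j : R := s + j%:R * h.
have tj_le j : (j <= m)%N -> tj j <= t.
  move=> jm; have -> : t = tj m by rewrite /tj /h /u; field; rewrite gt_eqF.
  by rewrite /tj lerD2l ler_wpM2r // ler_nat.
have tj_ge j : s <= tj j by rewrite /tj lerDl mulr_ge0.
have tjS j : tj j.+1 = tj j + h by rewrite /tj -natr1; ring.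
suff key j : (j <= m)%N -> exists Dp Dm, [/\ mart e s (tj j) Dp, mart e s (tj j) Dm &
    n2 (res (tj j) - res s - k%:C *: (res r * (w (tj j) - w s) * res r) -
       (k / 2)%:C *: (Dp - Dm)) <= j%:R * (C * h ^+ 2)].
  have etm : tj m = t by rewrite /tj /h /u; field; rewrite gt_eqF.
  have [Dp [Dm []]] := key m (leqnn _); rewrite etm => h1 h2 h3.
  exists Dp, Dm; split => //; apply: (le_trans h3).
  have -> : m%:R * (C * h ^+ 2) = C * u ^+ 2 / m%:R by rewrite /h; field; rewrite gt_eqF.
  by rewrite ler_pdivrMr //; case: hm; lra.
elim: j => [|j IH] jm.
  have -> : tj 0 = s by rewrite /tj mul0r addr0.
  exists 0, 0; rewrite !subrr mulr0 mul0r !scaler0 !subrr n2_0 mul0r.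
  by split => //; exact: mart_nil.
have [Dp [Dm [mDp mDm hn]]] := IH (ltnW jm).
have tjT : tj j <= T by apply: le_trans (tj_le _ (ltnW jm)) tT.
have tj0 : 0 <= tj j by exact: le_trans (tj_ge j).
have tjl : tj j <= tj j.+1 by rewrite tjS lerDl.
have tj1T : tj j.+1 <= T by apply: le_trans (tj_le _ jm) tT.
have rj : r <= tj j by exact: le_trans (tj_ge j).
have nj : nle (res (tj j) - res r) om by apply: hom; rewrite tj_ge tj_le // ltnW.
have [Dp' [Dm' [mDp' mDm' eD]]] := mart_polar e0 (tj_ge j) tjl
  (res_past tj0 tjT (lexx _)) (res_past r0 rT rj) (star_res tj0 tjT) (star_res r0 rT)
  (res_nle tj0 tjT) (res_nle r0 rT) nj om0 home mDp mDm.
exists Dp', Dm'; split => //.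
have [] := res_step tj0 tjl tj1T.
  by rewrite tjS addrC addKr.
set E := res (tj j.+1) - _ - _ => orthE nE.
set a := res (tj j) - _ - _ - _ in hn.
have -> : res (tj j.+1) - res s - k%:C *: (res r * (w (tj j.+1) - w s) * res r) -
    (k / 2)%:C *: (Dp' - Dm') = a + E.
  rewrite eD /a /E; set S := w (tj j.+1) - w (tj j).
  have -> : w (tj j.+1) = S + w (tj j) by rewrite subrK.
  by nc.
have pa : past (tj j) a.
  have B := past_subalg W (tj j).
  have pr : past (tj j) (res r) by exact: res_past.
  apply: (subB B); last first.
    apply: (subZ B); apply: (subB B).
      by have [] := mart_past hW s0 mDp.
    by have [] := mart_past hW s0 mDm.
  apply: (subB B).
    by apply: (subB B); exact: res_past.
  apply: (subZ B); apply: (subM B) => //; apply: (subM B) => //; apply: past_inc => //.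
have := orthE _ (sub_star (past_subalg W (tj j)) pa).
rewrite n2DE -/(ip a E) => ->; rewrite mulr0 addr0.
rewrite -natr1 mulrDl mul1r; apply: lerD => //.
by move: nE; rewrite tjS addrC addKr.
Qed.

(** The accuracy [eta] is arbitrary while [e] stays fixed: finer approximation changes the
    martingales but not the bound on their coefficients. *)
Lemma res_partition e om (n : nat) (tt rr : nat -> R) : 0 < e -> 0 <= om ->
  om <= e ^+ 2 / (4 * L) -> tt 0%N = 0 -> tt n <= T ->
  (forall i, (i < n)%N -> [/\ tt i <= tt i.+1, 0 <= rr i <= tt i &
     forall x : R, tt i <= x <= tt i.+1 -> x <= T -> nle (res x - res (rr i)) om]) ->
  forall i, (i <= n)%N -> tt i <= tt n /\ forall eta : R, 0 < eta ->
  exists Dp Dm, [/\ mart e 0 (tt i) Dp, mart e 0 (tt i) Dm &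
    n2 (res (tt i) - 1 -
        k%:C *: (\sum_(j < i) res (rr j) * (w (tt j.+1) - w (tt j)) * res (rr j)) -
       (k / 2)%:C *: (Dp - Dm)) <= eta].
Proof.
move=> e0 om0 home t00 tnT hp.
have mono i : (i <= n)%N -> tt i <= tt n.
  move=> hi; rewrite -(subnKC hi).
  have : (i + (n - i) <= n)%N by rewrite subnKC.
  elim: (n - i)%N => [|j IH]; first by rewrite addn0.
  rewrite addnS => hj; apply: (le_trans (IH (ltnW hj))).
  by have [] := hp _ hj.
move=> i hi; split; first exact: mono.
elim: i hi => [|i IH] hi eta eta0.
  exists 0, 0; rewrite t00 big_ord0 res0 // !subrr !scaler0 !subrr n2_0.
  by split => //; [exact: mart_nil|exact: mart_nil|exact: ltW].
(* [n2D_le] doubles the sum of the two errors, hence a quarter of [eta] for each. *)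
have e4 : 0 < eta / 4 by lra.
have [Dp [Dm [mDp mDm hn]]] := IH (ltnW hi) _ e4.
have [ht /andP[r0 rt] hx] := hp i hi.
have tiT : tt i.+1 <= T by apply: le_trans tnT; exact: mono.
have [Dp' [Dm' [mDp' mDm' hn']]] := res_interval e0 r0 rt ht tiT
  (fun (x : R) hx' => hx x hx' (le_trans (proj2 (andP hx')) tiT)) om0 home e4.
exists (Dp + Dp'), (Dm + Dm'); split; [exact: mart_cat mDp'|exact: mart_cat mDm'|].
rewrite big_ord_recr /=; set X := \sum_(j < i) _ in hn *.
set a := res (tt i) - 1 - _ - _ in hn; set b := res (tt i.+1) - _ - _ - _ in hn'.
have -> : res (tt i.+1) - 1 - k%:C *: (X + res (rr i) * (w (tt i.+1) - w (tt i)) * res (rr i)) -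
   (k / 2)%:C *: (Dp + Dp' - (Dm + Dm')) = a + b.
  by rewrite /a /b; nc.
apply: (le_trans (n2D_le _ _)); lra.
Qed.

End resolvent_integral.

(** * Free stochastic integrals *)

Section existence.
Context {R : realType} {A : wprob_space R}.
Local Notation M := (walg A).
Implicit Types (x y z b c D : M) (s t r e : R).
Variable W : R -> op A.
Hypothesis hW : free_brownian_motion W.
Local Notation w := (bm W).
Local Notation past := (past W).

Definition free_integral (Y Z : R -> M) t (J : M) := forall e, 0 < e -> exists2 d : R, 0 < d &
  forall (n : nat) (tt rr : nat -> R), tt 0%N = 0 -> tt n = t ->
    (forall i, (i < n)%N -> [/\ tt i <= tt i.+1, 0 <= rr i <= tt i & tt i.+1 - rr i < d]) ->
    nle (\sum_(i < n) Y (rr i) * (w (tt i.+1) - w (tt i)) * Z (rr i) - J) e.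

Lemma oper_sum n (F : 'I_n -> M) : oper (\sum_(i < n) F i) = \sum_(i < n) oper (F i).
Proof. exact: (big_morph (@oper R A) (fun _ _ => erefl) erefl). Qed.

Lemma partition_mono n (tt rr : nat -> R) d t : tt 0%N = 0 -> tt n = t ->
  (forall i, (i < n)%N -> [/\ tt i <= tt i.+1, 0 <= rr i <= tt i & tt i.+1 - rr i < d]) ->
  forall i, (i <= n)%N -> 0 <= tt i <= t.
Proof.
move=> t0 tn h i hi; apply/andP; split.
  elim: i hi => [|i IH] hi; first by rewrite t0.
  by have [h1 _ _] := h i hi; exact: le_trans (IH (ltnW hi)) h1.
rewrite -tn -(subnKC hi).
have : (i + (n - i) <= n)%N by rewrite subnKC.
elim: (n - i)%N => [|j IH]; first by rewrite addn0.
rewrite addnS => hj; apply: (le_trans (IH (ltnW hj))).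
by have [] := h _ hj.
Qed.

Lemma free_integralP (Y Z : R -> M) u v t J :
  (forall r, 0 <= r <= t -> u r = oper (Y r)) -> (forall r, 0 <= r <= t -> v r = oper (Z r)) ->
  is_free_integral W u v t (oper J) <-> free_integral Y Z t J.
Proof.
move=> hu hv.
have key n (tt rr : nat -> R) d : tt 0%N = 0 -> tt n = t ->
    (forall i, (i < n)%N -> [/\ tt i <= tt i.+1, 0 <= rr i <= tt i & tt i.+1 - rr i < d]) ->
    \sum_(i < n) (u (rr i) \o (W (tt i.+1) - W (tt i)) \o v (rr i)) - oper J =
    oper (\sum_(i < n) Y (rr i) * (w (tt i.+1) - w (tt i)) * Z (rr i) - J).
  move=> t0 tn h; rewrite [RHS]/= oper_sum; congr (_ - _); apply: eq_bigr => i _.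
  have [h1 /andP[h2 h3] _] := h i (ltn_ord i).
  have /andP[h4 h5] := partition_mono t0 tn h (ltnW (ltn_ord i)).
  have /andP[h6 h7] := partition_mono t0 tn h (ltn_ord i).
  have h8 : 0 <= rr i <= t by rewrite h2 (le_trans h3).
  by rewrite hu // hv //= !(bmE hW).
split=> h e /h[d d0 hd]; exists d => // n tt rr t0 tn hp.
  by apply/nle_opnorm; rewrite -(key n tt rr d) //; exact: hd.
by rewrite (key n tt rr d) //; apply/nle_opnorm; exact: hd.
Qed.

(** Strict subcriticality leaves room for [q^2] halfway between [u] and 1. *)
Lemma sqrt_half_sum (u : R) : 0 <= u -> u < 1 ->
  exists q : R, [/\ 0 < q, q < 1 & u <= q ^+ 2].
Proof.
move=> u0 u1; exists (Num.sqrt ((1 + u) / 2)).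
have h : 0 < (1 + u) / 2 by lra.
have e : Num.sqrt ((1 + u) / 2) ^+ 2 = (1 + u) / 2 by rewrite sqr_sqrtr // ltW.
split; first by rewrite sqrtr_gt0.
  rewrite -(ltr_sqr (_ : Num.sqrt ((1 + u) / 2) \is Num.nneg)) ?nnegrE ?sqrtr_ge0 //.
  by rewrite e expr1n; lra.
rewrite e; lra.
Qed.

Section positive_k.
Variables (k T : R).
Hypothesis k_neq0 : k != 0.
Hypothesis T_ge0 : 0 <= T.
Hypothesis kT : k ^+ 2 * T < 1.
Local Notation res := (res W k).

Lemma res_uniform_cont (om : R) : 0 < om -> exists2 d : R, 0 < d &
  forall s t, 0 <= s -> s <= t -> t <= T -> t - s < d -> nle (res t - res s) om.
Proof.
move=> om0; have [q [q0 q1 hq]] := sqrt_half_sum (mulr_ge0 (sqr_ge0 k) T_ge0) kT.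
set L := ((1 - q) ^+ 2)^-1.
pose c := L ^+ 2 * (k ^+ 2 + 3 * `|k|).
have c0 : 0 <= c.
  apply: mulr_ge0; first exact: sqr_ge0.
  by apply: addr_ge0; [exact: sqr_ge0|exact: mulr_ge0].
have c1 : 0 < c + 1 by lra.
have om1 : 0 < om / (c + 1) by rewrite divr_gt0.
exists (Num.min 1 ((om / (c + 1)) ^+ 2)); first by rewrite lt_min ltr01 exprn_gt0.
move=> s t s0 st tT; rewrite lt_min => /andP[d1 d2].
apply: nle_le (res_cont hW k_neq0 q0 q1 hq s0 st tT); rewrite -/L.
set d := t - s in d1 d2 *; have d0 : 0 <= d by rewrite subr_ge0.
have rd0 := sqrtr_ge0 d.
have rd2 : Num.sqrt d ^+ 2 = d by rewrite sqr_sqrtr.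
have rd1 : Num.sqrt d <= om / (c + 1).
  by rewrite -(ler_sqr (_ : Num.sqrt d \is Num.nneg)) ?nnegrE ?rd2 // ltW.
have rd3 : d <= Num.sqrt d.
  have : Num.sqrt d <= 1 by rewrite -(ler_sqr (_ : Num.sqrt d \is Num.nneg)) ?nnegrE ?rd2 ?expr1n // ltW.
  by move=> h; rewrite -{1}rd2 expr2 ler_piMr.
apply: (@le_trans _ _ (c * Num.sqrt d)).
  rewrite /c -mulrA; apply: ler_wpM2l; first exact: sqr_ge0.
  have := ler_wpM2l (sqr_ge0 k) rd3; have := normr_ge0 k; nra.
apply: (le_trans (ler_wpM2l c0 rd1)); rewrite mulrA ler_pdivrMr //; nra.
Qed.

(** The defect of a Riemann sum is an L2 limit of half differences of martingales whose norm bound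
    is the same along the limit; [nle_l2_lim] makes it a norm bound on the defect. *)
Lemma res_integral t : 0 <= t -> t <= T ->
  free_integral res res t (k^-1%:C *: (res t - 1)).
Proof.
move=> t0 tT e e0; have [q [q0 q1 hq]] := sqrt_half_sum (mulr_ge0 (sqr_ge0 k) T_ge0) kT.
set L := ((1 - q) ^+ 2)^-1.
have L0 : 0 < L by rewrite invr_gt0 exprn_gt0 // subr_gt0.
have t1 : 0 < 1 + t by lra.
(* Each martingale then has norm at most [2 ep^2 (1 + t) = e], and so has half a difference of two
   of them. *)
pose ep := Num.sqrt (e / (2 * (1 + t))).
have ep2 : ep ^+ 2 = e / (2 * (1 + t)) by rewrite sqr_sqrtr // divr_ge0 ?mulr_ge0 // ltW.
have ep0 : 0 < ep by rewrite sqrtr_gt0 divr_gt0 // mulr_gt0.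
pose om := ep ^+ 2 / (4 * L).
have om0 : 0 < om by rewrite divr_gt0 ?exprn_gt0 // mulr_gt0.
have [d d0 hd] := res_uniform_cont om0; exists d => // n tt rr tt0 ttn hp.
have hmono := partition_mono tt0 ttn hp.
have hp' i : (i < n)%N -> [/\ tt i <= tt i.+1, 0 <= rr i <= tt i &
     forall x : R, tt i <= x <= tt i.+1 -> x <= T -> nle (res x - res (rr i)) om].
  move=> hi; have [h1 h2 h3] := hp i hi; split => // x /andP[x1 x2] xT.
  have /andP[h4 h5] := h2; apply: hd => //; first exact: le_trans x1.
  by apply: le_lt_trans h3; rewrite lerD2r.
have tnT : tt n <= T by rewrite ttn.
have [_ hpart] := res_partition hW k_neq0 q0 q1 hq ep0 (ltW om0) (lexx om) tt0 tnT hp' (leqnn n).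
rewrite -opprB; apply: nleN.
have rsa s : 0 <= s -> s <= T -> star (res s) = res s.
  by move=> s0 sT; exact: (star_res hW k_neq0 q0 q1 hq).
apply: nle_l2_lim => //.
  rewrite starB starZr starB star1 rsa // star_sum; congr (_ - _); apply: eq_bigr => i _.
  have [h1 /andP[h2 h3] _] := hp i (ltn_ord i).
  have /andP[h4 h5] := hmono i (ltnW (ltn_ord i)).
  have rT : rr i <= T by apply: le_trans tT; exact: le_trans h5.
  by rewrite !starM (bm_inc_sa hW) // rsa // mulrA.
move=> eta eta0.
have k2 : 0 < k ^+ 2 by rewrite exprn_even_gt0.
have [Dp [Dm [mDp mDm hn]]] := hpart (eta * k ^+ 2) (mulr_gt0 eta0 k2).
exists ((2^-1)%:C *: (Dp - Dm)); split.
- have [_ s1] := mart_past hW (lexx 0) mDp; have [_ s2] := mart_past hW (lexx 0) mDm.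
  by rewrite starZr starB s1 s2.
- have -> : e = 2^-1 * (2 * (ep ^+ 2 * (1 + (tt n - 0))) + 2 * (ep ^+ 2 * (1 + (tt n - 0)))).
    by rewrite ep2 ttn subr0; field; rewrite gt_eqF.
  by apply: nleZr; [lra|apply: nleB; exact: (mart_nle hW)].
- move: hn; rewrite ttn; set X := \sum_(i < n) _ => hn.
  have -> : k^-1%:C *: (res t - 1) - X - (2^-1)%:C *: (Dp - Dm) =
     k^-1%:C *: (res t - 1 - k%:C *: X - (k / 2)%:C *: (Dp - Dm)).
    have kk : k^-1 * k = 1 by rewrite mulVf.
    rewrite !scalerBr !scalerA -!rmorphM mulrA kk mul1r rmorph1 scale1r.
    by rewrite -!scalerBr.
  by rewrite n2Z exprVn mulrC ler_pdivrMr.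
Qed.

End positive_k.

Lemma free_integral_scale (Y Z : R -> M) t J (c : R) :
  free_integral Y Z t J -> free_integral (fun s => c%:C *: Y s) (fun s => c%:C *: Z s) t ((c ^+ 2)%:C *: J).
Proof.
move=> h e e0; have c1 : 0 < c ^+ 2 + 1 by have := sqr_ge0 c; lra.
have [d d0 hd] := h (e / (c ^+ 2 + 1)) ltac:(by rewrite divr_gt0).
exists d => // n tt rr t0 tn hp; have := hd n tt rr t0 tn hp.
move=> /(nleZr (sqr_ge0 c)); rewrite scalerBr scaler_sumr.
rewrite (eq_bigr (fun i : 'I_n => c%:C *: Y (rr i) * (w (tt i.+1) - w (tt i)) * (c%:C *: Z (rr i)))).
  by apply: nle_le; rewrite mulrA ler_pdivrMr //; have := sqr_ge0 c; nra.
by move=> i _; nc.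
Qed.

Definition solution (k a : R) t : M := a%:C *: res W (a * k) t.

(** The case [a k = 0] is separate: the integral of the constant solution cannot be recovered from
    [res - 1]. *)
Lemma res_zero t : res W 0 t = 1.
Proof. by apply: res_eq; rewrite /den expr0n mul0r addr0 !scale0r subr0 scale1r mulr1. Qed.

Lemma free_integral_cst t : 0 <= t -> free_integral (fun=> 1) (fun=> 1) t (w t).
Proof.
move=> t0 e e0; exists 1 => // n tt rr tt0 ttn _.
have -> : \sum_(i < n) 1 * (w (tt i.+1) - w (tt i)) * 1 = w (tt n) - w (tt 0%N).
  elim: n {ttn} => [|n IH]; first by rewrite big_ord0 subrr.
  by rewrite big_ord_recr /= IH mulr1 mul1r addrC addrA subrK.
by rewrite ttn tt0 (bm0 hW) subr0 subrr; apply: nle0; exact: ltW.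
Qed.

Lemma solution_past (k a T t : R) : 0 <= t -> t <= T -> (a * k) ^+ 2 * T < 1 ->
  past t (solution k a t) /\ star (solution k a t) = solution k a t.
Proof.
move=> t0 tT kT; have T0 := le_trans t0 tT; have B := past_subalg W t.
suff [h1 h2] : past t (res W (a * k) t) /\ star (res W (a * k) t) = res W (a * k) t.
  by split; [exact: (subZ B)|rewrite /solution starZr h2].
have [q [q0 q1 hq]] := sqrt_half_sum (mulr_ge0 (sqr_ge0 _) T0) kT.
have hq' : (a * k) ^+ 2 * t <= q ^+ 2.
  by apply: le_trans hq; rewrite ler_wpM2l // sqr_ge0.
by have [_ [_ _ h1 h2 _] _ _ _] := res_facts hW t0 q0 q1 hq'.
Qed.

Lemma nleZ_abs (a r : R) x : nle x r -> nle (a%:C *: x) (`|a| * r).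
Proof.
by move=> h; have := nleZ a%:C h; rewrite normc_def /= expr0n addr0 sqrtr_sqr.
Qed.

Lemma solution_sde (k a T : R) : 0 <= T -> a ^+ 2 * k ^+ 2 * T < 1 ->
  solves_sde W k a T (fun t => oper (solution k a t)).
Proof.
move=> T0; rewrite -exprMn => kT; split.
- by rewrite /solution (res0 hW).
- by move=> t /andP[t0 tT]; have [] := solution_past t0 tT kT.
- move=> t /andP[t0 tT] e e0.
  have [k0|k0] := eqVneq (a * k) 0.
    exists 1 => // s _ _; rewrite /solution k0 !res_zero.
    have h : nle (a%:C *: 1 - a%:C *: 1 : M) e by rewrite subrr; apply: nle0; exact: ltW.
    exact: ((nle_opnorm _ _).1 h).
  have a1 : 0 < `|a| + 1 by have := normr_ge0 a; lra.
  have [d d0 hd] := res_uniform_cont k0 T0 kT (divr_gt0 e0 a1).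
  exists d => // s /andP[s0 sT] hst.
  suff h : nle (solution k a s - solution k a t) e by exact: ((nle_opnorm _ _).1 h).
  rewrite /solution -scalerBr; apply: (@nle_le _ _ _ (`|a| * (e / (`|a| + 1)))).
    by rewrite mulrA ler_pdivrMr //; have := normr_ge0 a; nra.
  apply: nleZ_abs; have [st|/ltW st] := leP s t.
    apply: nle_sym; apply: hd => //.
    by move: hst; rewrite distrC ger0_norm // subr_ge0.
  by apply: hd => //; move: hst; rewrite ger0_norm // subr_ge0.
- move=> t /andP[t0 tT].
  have [k0|k0] := eqVneq (a * k) 0.
    exists (oper ((a ^+ 2)%:C *: w t)).
      apply/(free_integralP (Y := solution k a) (Z := solution k a)) => //.
      have := free_integral_scale a (free_integral_cst t0).
      rewrite /solution k0 (_ : (fun=> _) = (fun s => a%:C *: res W 0 s)) //.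
      by apply/funext => s; rewrite res_zero.
    suff -> : solution k a t = solution k a 0 + k%:C *: ((a ^+ 2)%:C *: w t) by [].
    rewrite /solution k0 !res_zero scalerA -rmorphM expr2 mulrA (mulrC k) k0 mul0r.
    by rewrite scale0r addr0.
  exists (oper ((a ^+ 2)%:C *: ((a * k)^-1%:C *: (res W (a * k) t - 1)))).
    apply/(free_integralP (Y := solution k a) (Z := solution k a)) => //.
    apply: free_integral_scale.
    exact: (res_integral k0 T0 kT).
  suff h : solution k a t = solution k a 0 +
     k%:C *: ((a ^+ 2)%:C *: ((a * k)^-1%:C *: (res W (a * k) t - 1))) by rewrite h.
  rewrite /solution (res0 hW) !scalerA -!rmorphM.
  have -> : k * a ^+ 2 / (a * k) = a.
    by move: k0; rewrite mulf_eq0 negb_or => /andP[h1 h2]; field; rewrite h1 h2.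
  by nc.
Qed.

End existence.

(** * The Ito isometry and L2 estimates of integrals *)

Section uniqueness.
Context {R : realType} {A : wprob_space R}.
Local Notation M := (walg A).
Implicit Types (x y z b c D : M) (s t r e : R).
Variable W : R -> op A.
Hypothesis hW : free_brownian_motion W.
Local Notation w := (bm W).
Local Notation past := (past W).

(** Free Ito isometry for one increment, read off from [lp_dot] with weight [star x * x]. *)
Lemma n2_inc s t x y : 0 <= s -> s <= t -> past s x -> past s y ->
  n2 (x * (w t - w s) * y) = (t - s) * n2 x * n2 y.
Proof.
move=> s0 st px py; have [lp hlp] := bm_creation hW s0 st.
have B := past_subalg W s.
have Bx : past s (star x * x) by apply: (subM B) => //; exact: (sub_star B).
have sx : star (star x * x) = star x * x by rewrite starM starK.
have := lp_dot hlp Bx sx (lp_base hlp py) (lp_base hlp py).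
move=> <-; rewrite /n2 -!mulrA ipM; congr ip; by rewrite !mulrA.
Qed.

Definition mcontinuous (f : R -> M) (T : R) := forall t, 0 <= t <= T -> forall e, 0 < e ->
  exists2 d : R, 0 < d & forall s, 0 <= s <= T -> `|s - t| < d -> nle (f s - f t) e.

Lemma mcontinuousB (f g : R -> M) T : mcontinuous f T -> mcontinuous g T ->
  mcontinuous (fun t => f t - g t) T.
Proof.
move=> hf hg t tT e e0; have e2 : 0 < e / 2 by lra.
have [d d0 hd] := hf t tT _ e2; have [d' d0' hd'] := hg t tT _ e2.
exists (Num.min d d'); first by rewrite lt_min d0.
move=> s sT; rewrite lt_min => /andP[h1 h2].
have -> : f s - g s - (f t - g t) = (f s - f t) - (g s - g t) by nc.
by rewrite [e]splitr; apply: nleB; [exact: hd|exact: hd'].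
Qed.

Lemma n2_continuous (f : R -> M) T : mcontinuous f T ->
  {within `[0, T], continuous (fun t => n2 (f t))}.
Proof.
move=> hf; apply/subspace_continuousP => t /=; rewrite in_itv /= => tT.
apply/cvgrPdist_le => e e0.
have [L L0 hL] := nle_ex (f t).
pose om := Num.min 1 (e / (1 + 2 * L)).
have den : 0 < 1 + 2 * L by lra.
have om0 : 0 < om by rewrite lt_min ltr01 divr_gt0.
have [d d0 hd] := hf t tT om om0.
rewrite /within /=; exists d => //= s hs; rewrite in_itv /= => sT.
have h1 : nle (f s - f t) om by apply: hd => //; rewrite distrC.
have h2 := n2_nle (ltW om0) h1.
have h3 := n2_nle (ltW L0) hL.
have hc := ip_cs (f t) (f s - f t).
have eq : n2 (f s) = n2 (f t) + n2 (f s - f t) + 2 * ip (f t) (f s - f t).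
  by rewrite -n2DE addrC subrK.
have om1 : om <= 1 by rewrite ge_min lexx.
have om2 : om * (1 + 2 * L) <= e by rewrite -ler_pdivlMr // ge_min lexx orbT.
set i := ip _ _ in hc eq; set u := n2 (f s - f t) in h2 hc eq.
have u0 : 0 <= u := n2_ge0 _.
have Lo : 0 <= L * om by rewrite mulr_ge0 // ltW.
have hi : `|i| <= L * om.
  rewrite -ler_sqr ?nnegrE // real_normK ?num_real // exprMn.
  apply: (le_trans hc); apply: ler_pM => //; exact: n2_ge0.
have h4 : u <= om by apply: (le_trans h2); rewrite expr2 ler_piMr // ltW.
move: hi; rewrite !ler_norml => /andP[i1 i2].
by rewrite /from_subspace eq; apply/andP; split; nra.
Qed.

Lemma n2_bounded (f : R -> M) T : 0 <= T -> mcontinuous f T ->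
  exists2 C : R, 0 <= C & forall t, 0 <= t <= T -> n2 (f t) <= C.
Proof.
move=> T0 hf; have [c cT hc] := EVT_max T0 (n2_continuous hf).
exists (n2 (f c)); first exact: n2_ge0.
by move=> t tT; apply: hc; rewrite in_itv.
Qed.

(** Left Riemann sums of an increasing function lie below its integral; [1 + x <= exp x] does the
    work of the integral. *)
Lemma exp_left_sum (l h : R) n : 0 < l -> 0 <= h ->
  \sum_(i < n) h * expR (l * (i%:R * h)) <= expR (l * (n%:R * h)) / l.
Proof.
move=> l0 h0; rewrite ler_pdivlMr //.
suff : (\sum_(i < n) h * expR (l * (i%:R * h))) * l <= expR (l * (n%:R * h)) - 1 by lra.
elim: n => [|n IH]; first by rewrite big_ord0 !mul0r mulr0 expR0 subrr.
rewrite big_ord_recr /= mulrDl.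
have -> : l * (n.+1%:R * h) = l * (n%:R * h) + l * h by rewrite -natr1; ring.
rewrite expRD; have := expR_ge1Dx (l * h); have := expR_gt0 (l * (n%:R * h)).
nra.
Qed.

(** Both integrals are taken on one uniform partition with left evaluation points, where successive
    increments are orthogonal. Splitting each as [(x - y) S x + y S (x - y)] gives two terms, and
    [n2D_le] a further factor 2: this is the constant 4. *)
Lemma free_integral_n2 (x y : R -> M) (c C N l : R) Jx Jy : 0 <= c -> 0 <= C -> 0 <= N -> 0 < l ->
  (forall t, 0 <= t <= c -> past t (x t)) -> (forall t, 0 <= t <= c -> past t (y t)) ->
  (forall t, 0 <= t <= c -> n2 (x t) <= C) -> (forall t, 0 <= t <= c -> n2 (y t) <= C) ->
  (forall t, 0 <= t <= c -> n2 (x t - y t) <= N * expR (l * t)) ->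
  free_integral W x x c Jx -> free_integral W y y c Jy ->
  n2 (Jx - Jy) <= 4 * C * N * (expR (l * c) / l).
Proof.
move=> c0 C0 N0 l0 px py hx hy hxy ix iy.
apply: n2_lim_le.
  by apply: mulr_ge0; [rewrite !mulr_ge0|rewrite divr_ge0 ?expR_ge0 // ltW].
move=> e e0; pose e' := Num.sqrt e / 2.
have e'0 : 0 < e' by rewrite divr_gt0 // sqrtr_gt0.
have [d d0 hd] := ix e' e'0; have [d' d'0 hd'] := iy e' e'0.
pose dm := Num.min d d'; have dm0 : 0 < dm by rewrite lt_min d0.
pose n := (Num.truncn (c / dm)).+1.
have n0 : 0 < n%:R :> R by rewrite ltr0n.
pose h := c / n%:R; have h0 : 0 <= h by rewrite divr_ge0 // ltW.
have hdm : h < dm.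
  by rewrite /h ltr_pdivrMr // mulrC -ltr_pdivrMr // truncnS_gt.
pose tt (i : nat) : R := i%:R * h.
have tt0 : tt 0%N = 0 by rewrite /tt mul0r.
have ttn : tt n = c by rewrite /tt /h; field; rewrite gt_eqF.
have ttS i : tt i.+1 = tt i + h by rewrite /tt -natr1; ring.
have tt_ge i : 0 <= tt i by rewrite mulr_ge0.
have tt_le i : (i <= n)%N -> tt i <= c by move=> hi; rewrite -ttn ler_wpM2r // ler_nat.
have hp del : dm <= del -> forall i, (i < n)%N -> [/\ tt i <= tt i.+1, 0 <= tt i <= tt i & tt i.+1 - tt i < del].
  move=> hdel i hi; split; first by rewrite ttS lerDl.
    by rewrite tt_ge lexx.
  by rewrite ttS addrC addKr; exact: lt_le_trans hdel.
have h1 := hd n tt tt tt0 ttn (hp d ltac:(by rewrite ge_min lexx)).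
have h2 := hd' n tt tt tt0 ttn (hp d' ltac:(by rewrite ge_min lexx orbT)).
set X := \sum_(i < n) _ in h1; set Y := \sum_(i < n) _ in h2.
exists (X - Y); last first.
  have -> : Jx - Jy - (X - Y) = (Y - Jy) - (X - Jx) by nc.
  have h3 : nle ((Y - Jy) - (X - Jx)) (Num.sqrt e) by rewrite [Num.sqrt e]splitr; exact: nleB.
  apply: (le_trans (n2_nle (sqrtr_ge0 e) h3)); rewrite sqr_sqrtr // ltW //.
pose DD i := x (tt i) * (w (tt i.+1) - w (tt i)) * x (tt i) - y (tt i) * (w (tt i.+1) - w (tt i)) * y (tt i).
have itv i : (i < n)%N -> 0 <= tt i <= c by move=> hi; rewrite tt_ge tt_le // ltnW.
have bdD i : (i < n)%N -> n2 (DD i) <= 4 * C * N * (h * expR (l * (i%:R * h))).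
  move=> hi; have hti := itv i hi.
  have pxi := px _ hti; have pyi := py _ hti.
  have B := past_subalg W (tt i).
  have pd : past (tt i) (x (tt i) - y (tt i)) by exact: (subB B).
  have ttl : tt i <= tt i.+1 by rewrite ttS lerDl.
  have -> : DD i = (x (tt i) - y (tt i)) * (w (tt i.+1) - w (tt i)) * x (tt i) +
     y (tt i) * (w (tt i.+1) - w (tt i)) * (x (tt i) - y (tt i)).
    rewrite /DD; set S := w (tt i.+1) - w (tt i); nc.
  have dt : tt i.+1 - tt i = h by rewrite ttS addrC addKr.
  apply: (le_trans (n2D_le _ _)); rewrite !n2_inc // dt.
  have := hx _ hti; have := hy _ hti; have := hxy _ hti.
  have := n2_ge0 (x (tt i)); have := n2_ge0 (y (tt i)); have := n2_ge0 (x (tt i) - y (tt i)).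
  rewrite -/(tt i); set p := n2 (x (tt i)); set q := n2 (y (tt i)); set v := n2 (_ - _).
  set E := expR _ => v0 q0 p0 vN qC pC.
  have h3 : v * p <= N * E * C by apply: ler_pM.
  have h4 : q * v <= C * (N * E) by apply: ler_pM.
  have h5 : h * v * p + h * q * v <= 2 * (h * (C * (N * E))).
    have := ler_wpM2l h0 h3; have := ler_wpM2l h0 h4; lra.
  lra.
have pD i : (i < n)%N -> past (tt i.+1) (DD i).
  move=> hi; have hti := itv i hi; have B := past_subalg W (tt i.+1).
  have ttl : tt i <= tt i.+1 by rewrite ttS lerDl.
  have pxi := past_le ttl (px _ hti); have pyi := past_le ttl (py _ hti).
  have pS := past_inc hW (tt_ge i) ttl.
  by apply: (subB B); do 2 ! apply: (subM B) => //.
have key m : (m <= n)%N -> past (tt m) (\sum_(i < m) DD i) /\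
   n2 (\sum_(i < m) DD i) <= 4 * C * N * \sum_(i < m) h * expR (l * (i%:R * h)).
  elim: m => [|m IH] hm.
    by rewrite !big_ord0 n2_0 mulr0; split => //; exact: (sub0 (past_subalg W _)).
  have [p1 b1] := IH (ltnW hm).
  rewrite !big_ord_recr /=; split.
    apply: (subD (past_subalg W (tt m.+1))); last exact: pD.
    by apply: past_le p1; rewrite ttS lerDl.
  rewrite n2DE mulrDr.
  have hti := itv m hm; have B := past_subalg W (tt m).
  have ttl : tt m <= tt m.+1 by rewrite ttS lerDl.
  suff -> : ip (\sum_(i < m) DD i) (DD m) = 0 by rewrite mulr0 addr0 lerD // bdD.
  have ps : past (tt m) (star (\sum_(i < m) DD i)) by exact: (sub_star B).
  rewrite /ip /DD mulrBr rtrB.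
  have e1 z : past (tt m) z -> rtr (star (\sum_(i < m) DD i) * (z * (w (tt m.+1) - w (tt m)) * z)) = 0.
    move=> pz; have -> : star (\sum_(i < m) DD i) * (z * (w (tt m.+1) - w (tt m)) * z) =
       (star (\sum_(i < m) DD i) * z) * ((w (tt m.+1) - w (tt m)) * z) by rewrite !mulrA.
    by apply: (past_inc_orth hW) => //; exact: (subM B).
  by rewrite !e1 ?subr0 //; [exact: py|exact: px].
have -> : X - Y = \sum_(i < n) DD i by rewrite /X /Y -sumrB.
have [_ b1] := key n (leqnn n); apply: (le_trans b1).
apply: ler_wpM2l; first by rewrite !mulr_ge0.
have := exp_left_sum n l0 h0; rewrite -/(tt n) ttn; exact.
Qed.

End uniqueness.

(** * Uniqueness and the critical time *)

Section mild_solutions.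
Context {R : realType} {A : wprob_space R}.
Local Notation M := (walg A).
Variable W : R -> op A.
Hypothesis hW : free_brownian_motion W.
Local Notation past := (past W).

(** For nonzero [k] the equation determines the value of the integral, which is written out instead
    of being quantified. *)
Definition solves_in_alg (k a T : R) (x : R -> M) :=
  [/\ x 0 = a%:C *: 1, forall t : R, 0 <= t <= T -> past t (x t), mcontinuous x T
    & forall t : R, 0 <= t <= T -> free_integral W x x t (k^-1%:C *: (x t - x 0))].

Lemma solves_sde_lift (k a T : R) X : 0 <= T -> solves_sde W k a T X ->
  exists x : R -> M, [/\ forall t : R, 0 <= t <= T -> X t = oper (x t),
    k != 0 -> solves_in_alg k a T x & k = 0 -> forall t : R, 0 <= t <= T -> x t = a%:C *: 1].
Proof.
move=> T0 [X0 Xp Xc Xi].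
pose x t : M := if pselect (wp_alg (X t)) is left h then WAlg h else 0.
have xE t : 0 <= t <= T -> X t = oper (x t).
  move=> tT; rewrite /x; case: pselect => // h; exfalso; apply: h.
  by apply: (past_wp_alg hW) (Xp t tT); case/andP: tT.
have z0 : 0 <= (0 : R) <= T by rewrite lexx.
have x0 : x 0 = a%:C *: 1 by apply: oper_inj; rewrite -xE // X0.
exists x; split => // k0.
- split => //.
  + by move=> t tT; change (filtration W t (oper (x t))); rewrite -xE //; exact: Xp.
  + move=> t tT e e0; have [d d0 hd] := Xc t tT e e0; exists d => // s sT hs.
    by apply/nle_opnorm; have := hd s sT hs; rewrite !xE.
  + move=> t tT; have [J iJ eJ] := Xi t tT.
    apply/(free_integralP hW (u := X) (v := X)).
    * by move=> r /andP[r0 rt]; apply: xE; rewrite r0; case/andP: tT => _; exact: le_trans.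
    * by move=> r /andP[r0 rt]; apply: xE; rewrite r0; case/andP: tT => _; exact: le_trans.
    suff <- : J = oper (k^-1%:C *: (x t - x 0)) by [].
    have -> : oper (k^-1%:C *: (x t - x 0)) = k^-1%:C *: (X t - X 0) by rewrite !xE.
    by rewrite eJ addrC addKr scalerA -rmorphM mulVf // scale1r.
- move=> t tT; rewrite -x0; apply: oper_inj; have [J _ eJ] := Xi t tT.
  by rewrite -!xE // eJ k0 scale0r addr0.
Qed.

Lemma solves_in_alg_unique (k a T : R) x y : 0 <= T -> k != 0 ->
  solves_in_alg k a T x -> solves_in_alg k a T y ->
  forall t : R, 0 <= t <= T -> x t = y t.
Proof.
move=> T0 k0 [x0 px cx ix] [y0 py cy iy].
have [Cx Cx0 hCx] := n2_bounded T0 cx; have [Cy Cy0 hCy] := n2_bounded T0 cy.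
pose C := Cx + Cy; have C0 : 0 <= C by rewrite addr_ge0.
have k20 : 0 < k ^+ 2 by rewrite exprn_even_gt0.
(* Any [l] above [4 k^2 C] gives a strict contraction for the weighted norm. *)
pose l := 8 * k ^+ 2 * C + 1.
have l0 : 0 < l.
  have : 0 <= k ^+ 2 * C by rewrite mulr_ge0 // ltW.
  by rewrite /l; lra.
have cpsi : {within `[0, T], continuous (fun t => expR (- l * t) * n2 (x t - y t))}.
  move=> t; apply: cvgM; last exact: (n2_continuous (mcontinuousB cx cy)).
  apply: (@continuous_subspaceT _ _ `[0, T] (fun t : R => expR (- l * t))) => s.
  apply: continuous_comp; last exact: continuous_expR.
  exact: mulrl_continuous.
(* The weighted distance attains its maximum [N] at some [c]. The isometry at time [c] yields
   [N l <= 4 k^2 C N], which leaves only [N = 0]. *)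
have [c /[!in_itv]/= /andP[c0 cT] hc] := EVT_max T0 cpsi.
set N := expR (- l * c) * n2 (x c - y c) in hc.
have N0 : 0 <= N by rewrite mulr_ge0 ?expR_ge0 // n2_ge0.
have expN s : expR (- l * s) * expR (l * s) = 1 by rewrite -expRD mulNr addNr expR0.
have phiN t : 0 <= t <= T -> n2 (x t - y t) <= N * expR (l * t).
  move=> tT; have := hc t; rewrite in_itv /= => /(_ tT) h.
  have -> : n2 (x t - y t) = (expR (- l * t) * n2 (x t - y t)) * expR (l * t).
    by rewrite mulrAC expN mul1r.
  by rewrite ler_wpM2r // expR_ge0.
have sT t : 0 <= t <= c -> 0 <= t <= T.
  by case/andP=> -> h; exact: le_trans cT.
have cI : 0 <= c <= T by rewrite c0.
have key := free_integral_n2 hW c0 C0 N0 l0 (fun t h => px t (sT t h)) (fun t h => py t (sT t h))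
  (fun t h => le_trans (hCx t (sT t h)) (_ : Cx <= C))
  (fun t h => le_trans (hCy t (sT t h)) (_ : Cy <= C))
  (fun t h => phiN t (sT t h)) (ix c cI) (iy c cI).
have {}key := key ltac:(by rewrite lerDl) ltac:(by rewrite lerDr).
rewrite x0 y0 -scalerBr in key.
have e1 : (x c - a%:C *: 1) - (y c - a%:C *: 1) = x c - y c by nc.
rewrite e1 n2Z in key.
have e2 : n2 (x c - y c) = N * expR (l * c) by rewrite /N mulrAC expN mul1r.
have N00 : N = 0.
  apply: le_anti; rewrite N0 andbT.
  have E0 := expR_gt0 (l * c).
  move: key; rewrite e2 exprVn [_^-1 * _]mulrC ler_pdivrMr //.
  have -> : 4 * C * N * (expR (l * c) / l) * k ^+ 2 = (4 * C * k ^+ 2 * N) * expR (l * c) / l by ring.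
  rewrite ler_pdivlMr //.
  have -> : N * expR (l * c) * l = N * l * expR (l * c) by ring.
  rewrite ler_pM2r // /l => h.
  have : 0 <= k ^+ 2 * C * N by apply: mulr_ge0 => //; rewrite mulr_ge0 // ltW.
  lra.
move=> t tT; apply/subr0_eq/n2_eq0/le_anti.
by rewrite n2_ge0 andbT; have := phiN t tT; rewrite N00 mul0r.
Qed.

Lemma solves_in_alg_restrict (k a T T' : R) x : T' <= T ->
  solves_in_alg k a T x -> solves_in_alg k a T' x.
Proof.
move=> TT [x0 px cx ix].
have sT t : 0 <= t <= T' -> 0 <= t <= T by case/andP=> -> h; exact: le_trans TT.
split=> //; first by move=> t /sT; exact: px.
  move=> t tT e e0; have [d d0 hd] := cx t (sT t tT) e e0; exists d => // s /sT; exact: hd.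
by move=> t /sT; exact: ix.
Qed.

Lemma solution_in_alg (k a T : R) : k != 0 -> 0 <= T -> a ^+ 2 * k ^+ 2 * T < 1 ->
  solves_in_alg k a T (solution W k a).
Proof.
move=> k0 T0 h; have [x [hx1 hx2 _]] := solves_sde_lift T0 (solution_sde hW T0 h).
have e t : 0 <= t <= T -> x t = solution W k a t by move=> tT; apply: oper_inj; rewrite -hx1.
have [x0 px cx ix] := hx2 k0.
have z0 : 0 <= (0 : R) <= T by rewrite lexx.
split; first by rewrite -e.
- by move=> t tT; rewrite -e //; exact: px.
- move=> t tT eps eps0; have [d d0 hd] := cx t tT eps eps0; exists d => // s sT hs.
  by rewrite -!e //; exact: hd.
- move=> t tT; rewrite -!e //.
  have hr r : 0 <= r <= t -> oper (solution W k a r) = oper (x r).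
    by move=> /andP[r0 rt]; rewrite e // r0; case/andP: tT => _; exact: le_trans.
  apply/(free_integralP hW (u := fun t => oper (solution W k a t)) (v := fun t => oper (solution W k a t))) => //.
  by apply/(free_integralP hW (Y := x) (Z := x)) => //; exact: ix.
Qed.

Lemma bernoulli_sub (v : R) n : 0 <= v -> 0 <= 1 - v -> 1 - n%:R * v <= (1 - v) ^+ n.
Proof.
move=> v0 v1; elim: n => [|n IH]; first by rewrite mul0r subr0 expr0.
rewrite exprS -natr1; have := ler_wpM2l v1 IH.
have : 0 <= n%:R * v ^+ 2 by rewrite mulr_ge0 // sqr_ge0.
lra.
Qed.

(* If the solution reached the critical time, its L2 norm would blow up there. *)
Lemma solves_in_alg_subcritical (k a T : R) x : k != 0 -> 0 <= T ->
  solves_in_alg k a T x -> a ^+ 2 * k ^+ 2 * T < 1.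
Proof.
move=> k0 T0 sx; rewrite ltNge; apply/negP => hT.
have ak0 : a * k != 0.
  by apply: contraTneq hT; rewrite -exprMn => ->; rewrite expr0n mul0r -ltNge ltr01.
have ak2 : 0 < (a * k) ^+ 2 by rewrite exprn_even_gt0.
rewrite -exprMn in hT.
have a0 : a != 0 by apply: contraNneq ak0 => ->; rewrite mul0r.
have a20 : 0 < a ^+ 2 by rewrite exprn_even_gt0.
have [_ _ cx _] := sx.
have [C C0 hC] := n2_bounded T0 cx.
pose N := (Num.truncn (2 * C / a ^+ 2)).+1.
have hN : 2 * C / a ^+ 2 < N%:R by exact: truncnS_gt.
have N1 : 1 <= N%:R :> R by rewrite ler1n.
(* By Bernoulli's inequality [u^i >= 1/2] for [i < N], so the lower bound on the squared L2 norm
   reaches [a^2 N / 2], which exceeds [C]. *)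
pose u := 1 - (2 * N%:R)^-1 : R.
have iN : (2 * N%:R)^-1 <= 2^-1 :> R.
  by rewrite lef_pV2 ?posrE; lra.
have iN0 : 0 < (2 * N%:R)^-1 :> R by rewrite invr_gt0; lra.
have u0 : 0 <= u by rewrite /u; lra.
have u1 : u < 1 by rewrite /u; lra.
pose t := u / (a * k) ^+ 2.
have t0 : 0 <= t by rewrite divr_ge0 // ltW.
have tu : (a * k) ^+ 2 * t = u by rewrite /t mulrC divfK // gt_eqF.
have tT : t <= T by rewrite ler_pdivrMr // mulrC; apply: le_trans hT; exact: ltW.
have tI : 0 <= t <= t by rewrite t0 lexx.
have e := solves_in_alg_unique t0 k0 (solves_in_alg_restrict tT sx)
  (solution_in_alg (a := a) k0 t0 ltac:(by rewrite -exprMn tu)) tI.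
have := hC t ltac:(by rewrite t0); rewrite e /solution n2Z.
have [q [q0 q1 hq]] := sqrt_half_sum u0 u1.
have hq' : (a * k) ^+ 2 * t <= q ^+ 2 by rewrite tu.
have [_ _ _ _ /(_ N)] := res_facts hW t0 q0 q1 hq'; rewrite tu => h1 h2.
have h3 : N%:R / 2 <= \sum_(i < N) u ^+ i.
  have -> : N%:R / 2 = \sum_(i < N) (2^-1 : R) by rewrite sumr_const card_ord -[RHS]mulr_natl.
  apply: ler_sum => i _; apply: le_trans (bernoulli_sub i (ltW iN0) u0).
  have : i%:R * (2 * N%:R)^-1 <= 2^-1 :> R.
    rewrite invfM mulrCA ler_piMr ?invr_ge0 // ler_pdivrMr ?mul1r ?ler_nat; last by lra.
    by rewrite ltnW.
  lra.
have h4 : a ^+ 2 * (N%:R / 2) <= C.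
  by apply: le_trans h2; rewrite ler_pM2l //; exact: le_trans h3 h1.
by move: hN; rewrite ltr_pdivrMr //; lra.
Qed.

Lemma solves_sdeP (k a T : R) X : 0 <= T -> solves_sde W k a T X ->
  a ^+ 2 * k ^+ 2 * T < 1 /\ forall t : R, 0 <= t <= T -> X t = oper (solution W k a t).
Proof.
move=> T0 /(solves_sde_lift T0)[x [hx hx1 hx2]].
have [k0|k0] := eqVneq k 0.
  split; first by rewrite k0 expr0n mulr0 mul0r.
  by move=> t tT; rewrite hx // hx2 // /solution k0 mulr0 res_zero.
have h := solves_in_alg_subcritical k0 T0 (hx1 k0).
split=> // t tT; rewrite hx // (solves_in_alg_unique T0 k0 (hx1 k0) (solution_in_alg k0 T0 h)) //.
Qed.

End mild_solutions.

(** * Spectral laws and their moments *)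

Section determinacy.
Context {R : realType}.
Local Notation T := (measurableTypeR R).
Implicit Types (mu : probability T R) (L c u v : R).

Lemma measure_unique_rays mu (nu : {measure set T -> \bar R}) :
  (forall c, mu `]c, +oo[%classic = nu `]c, +oo[%classic) ->
  forall B : set T, measurable B -> mu B = nu B.
Proof.
move=> h B mB.
apply: (@measure_unique _ R T (@RGenOInfty.G R) (fun k : nat => `]- k%:R, +oo[%classic)) => //.
- exact: RGenOInfty.measurableE.
- move=> _ _ [a ->] [b ->]; exists (Num.max a b).
  apply/seteqP; split => v /=; rewrite !in_itv /= !andbT gt_max.
    by case=> -> ->.
  by case/andP.
- by move=> k; exists (- k%:R).
- apply/seteqP; split => // v _; exists (Num.truncn `|v|).+1 => //=.
  rewrite in_itv /= andbT ltrNl; apply: le_lt_trans (truncnS_gt _).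
  by rewrite -normrN ler_norm.
- by move=> _ [a ->]; exact: h.
- by move=> k; apply: le_lt_trans (probability_le1 _ _) (ltry _).
Qed.

(** Composition with [clamp] makes continuous integrands bounded without changing integrals against
    laws carried by [[-L, L]]. *)
Definition clamp L u : R := Num.max (- L) (Num.min u L).

Lemma clampE L u : - L <= u <= L -> clamp L u = u.
Proof. by case/andP=> h1 h2; rewrite /clamp min_l // max_r. Qed.

Lemma clamp_itv L u : 0 <= L -> - L <= clamp L u <= L.
Proof.
move=> L0; rewrite /clamp le_max lexx /= ge_max ge_min lexx orbT andbT.
by lra.
Qed.

Lemma continuous_clamp L : continuous (clamp L).
Proof.
move=> u; rewrite /clamp.
apply: (@continuous_max _ _ (fun=> - L) (fun u => Num.min u L)); first exact: cst_continuous.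
by apply: (@continuous_min _ _ id (fun=> L)); [by move=> ?; exact: cvg_id|exact: cst_continuous].
Qed.

Lemma bounded_integrable mu (h : T -> R) (K : R) : measurable_fun setT h ->
  (forall u, `|h u| <= K) -> mu.-integrable setT (EFin \o h).
Proof.
move=> mh hK; apply: (le_integrable measurableT (g := cst K%:E)).
- exact/measurable_EFinP.
- by move=> u _ /=; rewrite lee_fin; apply: le_trans (hK u) (ler_norm _).
- exact: finite_measure_integrable_cst.
Qed.

Lemma le_Rintegral_cst mu (h : T -> R) (K : R) : measurable_fun setT h ->
  (forall u, `|h u| <= K) -> `|\int[mu]_(u in setT) h u| <= K.
Proof.
move=> mh hK; have ih := bounded_integrable mu mh hK.
apply: (le_trans (le_normr_Rintegral measurableT ih)).
have -> : K = \int[mu]_(u in setT) (cst K u).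
  by rewrite Rintegral_cst //= [X in fine X]probability_setT mulr1.
apply: le_Rintegral => //.
- by apply: (@bounded_integrable mu _ K) => [|u]; [exact: measurableT_comp|rewrite normr_id].
- exact: finite_measure_integrable_cst.
Qed.

Lemma Rintegral_clamp mu L (h : T -> R) : mu (~` [set u | - L <= u <= L]) = 0%E ->
  continuous (h : R -> R) -> \int[mu]_(u in setT) h u = \int[mu]_(u in setT) h (clamp L u).
Proof.
move=> mu0 ch.
have mh : measurable_fun setT h by exact: continuous_measurable_fun.
have mhc : measurable_fun setT (h \o clamp L).
  apply: continuous_measurable_fun => u.
  by apply: continuous_comp; [exact: continuous_clamp|exact: ch].
rewrite /Rintegral; congr fine; apply: ae_eq_integral => //; try exact/measurable_EFinP.
exists (~` [set u | - L <= u <= L]); split => //.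
  apply: measurableC; have -> : [set u : T | - L <= u <= L] = `[- L, L]%classic.
    by apply/seteqP; split => v /=; rewrite in_itv.
  exact: measurable_itv.
move=> u /= h1 h2; apply: h1 => _; by rewrite clampE.
Qed.

Lemma expr_linear_le1 (s : R) n : 0 <= s -> s <= 1 -> s ^+ n * (1 + n%:R * (1 - s)) <= 1.
Proof.
move=> s0 s1; elim: n => [|n IH]; first by rewrite mul0r addr0 expr0 mulr1.
apply: le_trans IH; rewrite exprS mulrC mulrA [leRHS]mulrC ler_wpM2r ?exprn_ge0 //.
have : 0 <= n.+1%:R * (1 - s) ^+ 2 by rewrite mulr_ge0 // sqr_ge0.
rewrite -natr1; lra.
Qed.

(** Behaves like [exp (- n (2 s)^(2n))]: the exponent tends to 0 below [1/2] and to infinity above.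
    The extra factor [n] settles [s = 1/2], so that the limit is exactly the indicator of
    [s < 1/2]. *)
Definition step_seq (s : R) n : R := (1 - s ^+ (2 * n)) ^+ (n * 4 ^ n).

Lemma step_seq_itv (s : R) n : 0 <= s -> s <= 1 -> 0 <= step_seq s n <= 1.
Proof.
move=> s0 s1; have h0 := exprn_ge0 (2 * n) s0; have h1 := exprn_ile1 (2 * n) s0 s1.
have h2 : 0 <= 1 - s ^+ (2 * n) by lra.
by rewrite /step_seq exprn_ge0 //= exprn_ile1 //; lra.
Qed.

Lemma step_seq_lt (s : R) n : 0 <= s -> s < 2^-1 -> 1 - step_seq s n.+1 <= n.+1%:R^-1 / (1 - 2 * s) ^+ 2.
Proof.
move=> s0 s1; have d0 : 0 < 1 - 2 * s by lra.
have h1 : s ^+ (2 * n.+1) <= 1 by rewrite exprn_ile1 //; lra.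
have := @bernoulli_sub R (s ^+ (2 * n.+1)) (n.+1 * 4 ^ n.+1) (exprn_ge0 _ s0) ltac:(by rewrite subr_ge0).
rewrite -/(step_seq s n.+1) => h2.
suff h3 : (n.+1 * 4 ^ n.+1)%:R * s ^+ (2 * n.+1) <= n.+1%:R^-1 / (1 - 2 * s) ^+ 2.
  by apply: le_trans h3; rewrite lerBlDr -lerBlDl.
have -> : (n.+1 * 4 ^ n.+1)%:R * s ^+ (2 * n.+1) = n.+1%:R * ((2 * s) ^+ n.+1) ^+ 2 :> R.
  rewrite natrM natrX -exprM mulnC exprMn -mulrA exprM; congr (_ * (_ * _)).
    by rewrite mulnC [RHS]exprM; congr (_ ^+ _); ring.
have h4 := @expr_linear_le1 (2 * s) n.+1 ltac:(lra) ltac:(lra).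
set x := (2 * s) ^+ n.+1 in h4 *; have x0 : 0 <= x by rewrite exprn_ge0 //; lra.
set N := n.+1%:R in h4 *; have N0 : 0 < N by rewrite /N ltr0n.
rewrite ler_pdivlMr ?exprn_gt0 // -[leRHS]mul1r ler_pdivlMr //.
have -> : N * x ^+ 2 * (1 - 2 * s) ^+ 2 * N = (x * (N * (1 - 2 * s))) ^+ 2 by ring.
have y0 : 0 <= x * (N * (1 - 2 * s)) by rewrite !mulr_ge0 // ltW.
rewrite expr_le1 //; apply: le_trans h4; rewrite ler_wpM2l //; lra.
Qed.

Lemma step_seq_ge (s : R) n : 2^-1 <= s -> s <= 1 -> step_seq s n <= (1 + n%:R)^-1.
Proof.
move=> s1 s2; have s0 : 0 <= s by lra.
have h1 : s ^+ (2 * n) <= 1 by rewrite exprn_ile1.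
have h2 : 0 <= s ^+ (2 * n) by exact: exprn_ge0.
have h3 := @expr_linear_le1 (1 - s ^+ (2 * n)) (n * 4 ^ n) ltac:(lra) ltac:(lra).
have n0 : 0 <= n%:R :> R by [].
rewrite -[leRHS]mul1r ler_pdivlMr; last by lra.
apply: le_trans h3; rewrite ler_wpM2l //.
  by have /andP[] := step_seq_itv n s0 s2.
have -> : (1 : R) - (1 - s ^+ (2 * n)) = s ^+ (2 * n) by ring.
rewrite (lerD2l 1) natrM natrX -mulrA ler_peMr //; set Q := 4 ^+ n * _.
have -> : Q = ((2 * s) ^+ n) ^+ 2.
  rewrite /Q exprMn exprMn -!exprM (mulnC n) [2 ^+ (2 * n)]exprM (_ : 2 ^+ 2 = 4 :> R) //; ring.
by rewrite !exprn_ege1 //; lra.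
Qed.

Lemma cvg_inv_nat : (fun n : nat => (1 + n%:R)^-1 : R) @ \oo --> (0 : R).
Proof.
rewrite (_ : (fun n => _) = harmonic); first exact: cvg_harmonic.
by apply/funext => n; rewrite /harmonic /= -natr1 addrC.
Qed.

Lemma step_seq_cvg (s : R) : 0 <= s -> s <= 1 -> step_seq s n @[n --> \oo] --> (((s < 2^-1)%R)%:R : R).
Proof.
move=> s0 s1; have [h|h] := ltP s 2^-1; last first.
  apply: (squeeze_cvgr _ (cvg_cst 0) cvg_inv_nat); near=> n.
  have /andP[-> _] := step_seq_itv n s0 s1; exact: step_seq_ge.
have c1 : (fun n : nat => 1 - (1 + n%:R)^-1 / (1 - 2 * s) ^+ 2 : R) @ \oo --> (1 - 0 / (1 - 2 * s) ^+ 2 : R).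
  by apply: cvgB; [exact: cvg_cst|apply: cvgMr_tmp; exact: cvg_inv_nat].
rewrite mul0r subr0 in c1.
suff : step_seq s n @[n --> \oo] --> (1 : R) by [].
have c2 : (fun n => step_seq s n.+1) @ \oo --> (1 : R).
  apply: squeeze_cvgr; [|exact: c1|exact: (cvg_cst (1 : R))]; near=> n.
  have /andP[_ ->] := step_seq_itv n.+1 s0 s1; rewrite andbT.
  by have := step_seq_lt n s0 h; rewrite -natr1 [n%:R + 1]addrC lerBlDr -lerBlDl.
by rewrite -cvg_shiftS; exact: c2.
Unshelve. all: by end_near. Qed.

(** Affine and decreasing, with value [1/2] at [c], and mapping [[-L, L]] into [[0, 1]] when
    [|c| < L]. *)
Definition step_arg L c : {poly R} := (2^-1 + c / (4 * L))%:P - (4 * L)^-1 *: 'X.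
Definition step_poly L c n : {poly R} := (1 - step_arg L c ^+ (2 * n)) ^+ (n * 4 ^ n).

Lemma step_polyE L c n u : (step_poly L c n).[u] = step_seq (step_arg L c).[u] n.
Proof. by rewrite /step_poly /step_seq !(hornerE, horner_exp). Qed.

Lemma step_argE L c u : (step_arg L c).[u] = 2^-1 + (c - u) / (4 * L).
Proof. by rewrite /step_arg !hornerE; ring. Qed.

(* The polynomials separate the two sides of c, so the moments determine the
   tails of a compactly supported law. *)
Lemma moments_tail mu L c : - L < c < L -> mu (~` [set u | - L <= u <= L]) = 0%E ->
  (\int[mu]_(u in setT) (step_poly L c n).[u]) @[n --> \oo] --> fine (mu `]c, +oo[%classic).
Proof.
move=> /andP[c1 c2] mu0; have L0 : 0 < L by lra.
have L40 : 0 < 4 * L by lra.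
pose f_ n (u : T) := (step_poly L c n).[clamp L u].
have cf n : continuous (f_ n : R -> R).
  by move=> u; apply: continuous_comp; [exact: continuous_clamp|exact: continuous_horner].
have mf n : measurable_fun setT (f_ n) by exact: continuous_measurable_fun.
have arg u : 0 <= (step_arg L c).[clamp L u] <= 1.
  have /andP[h1 h2] := clamp_itv u (ltW L0); rewrite step_argE.
  have h3 : (c - clamp L u) / (4 * L) <= 2^-1 by rewrite ler_pdivrMr //; lra.
  have h4 : - 2^-1 <= (c - clamp L u) / (4 * L) by rewrite ler_pdivlMr //; lra.
  by apply/andP; split; lra.
have fb n u : `|f_ n u| <= 1.
  have /andP[h1 h2] := arg u; have /andP[h3 h4] := step_seq_itv n h1 h2.
  by rewrite /f_ step_polyE ger0_norm.
have E n : \int[mu]_(u in setT) (step_poly L c n).[u] = fine (\int[mu]_(u in setT) (f_ n u)%:E)%E.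
  by rewrite (Rintegral_clamp mu0 (h := horner (step_poly L c n))) //; exact: continuous_horner.
under eq_fun do rewrite E.
have lim u : f_ n u @[n --> \oo] --> (\1_(`]c, +oo[%classic) u : R).
  rewrite /f_; under eq_fun do rewrite step_polyE.
  have /andP[h1 h2] := arg u; have := step_seq_cvg h1 h2.
  suff -> : ((step_arg L c).[clamp L u] < 2^-1) = (u \in `]c, +oo[%classic) by rewrite indicE.
  rewrite mem_setE in_itv /= andbT step_argE gtrDl pmulr_llt0 ?invr_gt0 // subr_lt0.
  by rewrite /clamp lt_max lt_min c2 andbT; case: ltP => //= h; lra.
have [] := @dominated_convergence _ T R mu setT measurableT (fun n u => (f_ n u)%:E)
  (fun u => (\1_(`]c, +oo[%classic) u)%:E) (cst 1%:E).
- by move=> n; exact/measurable_EFinP.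
- by apply/measurable_EFinP; exact: measurable_indic.
- by apply: aeW => u _; apply/fine_cvgP; split; [exact: nearW|exact: lim].
- exact: finite_measure_integrable_cst.
- by apply: aeW => u n _ /=; rewrite lee_fin.
move=> _ _; rewrite integral_indic // setIT => h.
apply: fine_cvg; rewrite fineK //; exact: fin_num_measure.
Qed.

End determinacy.

(** * Support and uniqueness of spectral distributions *)

Section spectral_uniqueness.
Context {R : realType} {A : wprob_space R}.
Local Notation M := (walg A).
Local Notation T := (measurableTypeR R).
Implicit Types (x y : M) (mu nu : probability T R).

(** Markov's inequality for the moment of order [2 n]. The interval is taken twice as long as the
    norm bound, so that the mass outside is at most [4^-n] for every [n]. *)
Lemma spectral_support x mu (r : R) : 0 < r -> nle x r -> spectral_distribution (oper x) mu ->
  mu (~` [set u | - (2 * r) <= u <= 2 * r]) = 0%E.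
Proof.
move=> r0 hx hmu.
have S2 : 0 < 2 * r by lra.
have mS : measurable (~` [set u : T | - (2 * r) <= u <= 2 * r]).
  apply: measurableC; have -> : [set u : T | - (2 * r) <= u <= 2 * r] = `[- (2 * r), 2 * r]%classic.
    by apply/seteqP; split => v /=; rewrite in_itv.
  exact: measurable_itv.
have key n : fine (mu (~` [set u | - (2 * r) <= u <= 2 * r])) <= 4^-1 ^+ n.
  have [ip ep] := spectral_peval ('X ^+ (2 * n)) hmu.
  have h1 := le_integral_abse mu measurableT (measurable_int mu ip) (exprn_gt0 (2 * n) S2).
  set S := ~` _ in mS *.
  have h2 : (((2 * r) ^+ (2 * n))%:E * mu S <= (r ^+ (2 * n))%:E)%E.
    apply: (le_trans (le_trans _ h1)).
      rewrite setTI lee_pmul2l ?lte_fin ?exprn_gt0 // le_measure ?inE //.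
        rewrite -[X in measurable X]setTI; apply: emeasurable_fun_c_infty => //.
        by apply: measurableT_comp => //; exact: measurable_int ip.
      move=> u /= hu; rewrite lee_fin hornerXn normrX; apply: lerXn2r; rewrite ?nnegrE //; first exact: ltW.
      by rewrite leNgt; apply/negP => hu'; apply: hu; rewrite /= -ler_norml ltW.
    have -> : (\int[mu]_u `|('X^(2 * n)).[u]%:E| = (\int[mu]_(u in setT) ('X ^+ (2 * n)).[u])%:E)%E.
      rewrite /Rintegral fineK; last exact: integrable_fin_num.
      by apply: eq_integral => u _; rewrite /= hornerXn exprM ger0_norm // exprn_ge0 // sqr_ge0.
    rewrite -ep lee_fin pevalXn pevalX; apply: rtr_nle.
    elim: (2 * n)%N => [|m IH]; first by rewrite !expr0; exact: nle1.
    by rewrite !exprS; apply: nleM => //; exact/ltW.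
  rewrite -[mu S]fineK ?fin_num_measure // -EFinM lee_fin mulrC in h2.
  rewrite -ler_pdivlMr ?exprn_gt0 // in h2; apply: (le_trans h2).
  rewrite exprMn invfM mulrCA mulfV ?mulr1; last by rewrite gt_eqF ?exprn_gt0.
  by rewrite exprM (_ : 2 ^+ 2 = 4 :> R) ?exprVn //; ring.
set S := ~` _ in mS key *.
rewrite -[LHS]fineK ?fin_num_measure //; congr _%:E.
apply: le_anti; rewrite fine_ge0 // andbT; apply/ler_addgt0Pl => e e0; rewrite addr0.
have [N hN] := @geometric_small R 4^-1 e ltac:(lra) ltac:(lra) e0.
by apply: le_trans (key N) (hN N (leqnn N)).
Qed.

Lemma spectral_distribution_unique x mu nu : spectral_distribution (oper x) mu ->
  spectral_distribution (oper x) nu -> forall B : set T, measurable B -> mu B = nu B.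
Proof.
move=> hmu hnu; apply: measure_unique_rays => c.
have [r r0 hr] := nle_ex x.
pose r' := Num.max r (`|c| + 1); have c0 := normr_ge0 c.
have r'0 : 0 < r' by rewrite lt_max r0.
have hr' : nle x r' by apply: nle_le hr; rewrite le_max lexx.
have cr : `|c| < 2 * r'.
  have : `|c| + 1 <= r' by rewrite le_max lexx orbT.
  lra.
rewrite ltr_norml in cr.
have h1 := moments_tail cr (spectral_support r'0 hr' hmu).
have h2 := moments_tail cr (spectral_support r'0 hr' hnu).
have E n : \int[mu]_(u in setT) (step_poly (2 * r') c n).[u] = \int[nu]_(u in setT) (step_poly (2 * r') c n).[u].
  have [_ <-] := spectral_peval (step_poly (2 * r') c n) hmu.
  by have [_ <-] := spectral_peval (step_poly (2 * r') c n) hnu.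
rewrite (_ : (fun n => _) = (fun n => \int[nu]_(u in setT) (step_poly (2 * r') c n).[u])) in h1; last exact/funext.
have hm (m : probability T R) : m `]c, +oo[%classic = (fine (m `]c, +oo[%classic))%:E.
  by rewrite fineK // fin_num_measure.
by rewrite hm [RHS]hm; congr _%:E; apply: (cvg_unique (@Rhausdorff R) h1 h2).
Qed.

End spectral_uniqueness.

(** * The law of the inverse of a polynomial in an operator *)

Section inverse_law.
Context {R : realType} {A : wprob_space R}.
Local Notation M := (walg A).
Local Notation T := (measurableTypeR R).
Implicit Types (x y z : M) (u : R).
Variables (x y : M) (sigma : probability T R) (D : {poly R}) (L dl K : R).
Hypothesis sx : star x = x.
Hypothesis hsigma : spectral_distribution (oper x) sigma.
Hypothesis sigma0 : sigma (~` [set u | - L <= u <= L]) = 0%E.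
Hypothesis yD : y * peval D x = 1.
Hypothesis Dy : peval D x * y = 1.
Hypothesis dl0 : 0 < dl.
Hypothesis hD : forall u, dl <= D.[clamp L u] <= K.

Lemma n2_peval p : n2 (peval p x) = \int[sigma]_(u in setT) p.[clamp L u] ^+ 2.
Proof.
rewrite /n2 /ip star_peval // -pevalM; have [_ ->] := spectral_peval (p * p) hsigma.
rewrite (Rintegral_clamp sigma0 (h := horner (p * p))); last exact: continuous_horner.
by apply: eq_Rintegral => u _; rewrite hornerM expr2.
Qed.

Let D0 u : 0 < D.[clamp L u].
Proof. by have /andP[h _] := hD u; exact: lt_le_trans h. Qed.

Lemma continuous_inv_clamp : continuous (fun u => (D.[clamp L u])^-1).
Proof.
move=> u; apply: cvgV; first by rewrite gt_eqF.
by apply: (@continuous_comp _ _ _ (clamp L) (horner D)); [exact: continuous_clamp|exact: continuous_horner].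
Qed.

Lemma inv_clamp_le u : `|(D.[clamp L u])^-1| <= dl^-1.
Proof.
rewrite ger0_norm; last by rewrite invr_ge0 ltW.
rewrite lef_pV2 ?posrE //.
by have /andP[] := hD u.
Qed.

Lemma measurable_inv_clamp n : measurable_fun setT (fun u : T => (D.[clamp L u])^-1 ^+ n).
Proof.
by apply: measurable_funX; apply: continuous_measurable_fun; exact: continuous_inv_clamp.
Qed.

Lemma inv_clampX_le n u : `|(D.[clamp L u])^-1 ^+ n| <= dl^-1 ^+ n.
Proof.
rewrite normrX; apply: lerXn2r; rewrite ?nnegrE ?inv_clamp_le //.
by rewrite invr_ge0 ltW.
Qed.

Lemma integrable_inv_clamp n :
  sigma.-integrable setT (EFin \o (fun u : T => (D.[clamp L u])^-1 ^+ n)).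
Proof. exact: (bounded_integrable sigma (measurable_inv_clamp n) (inv_clampX_le n)). Qed.

(* The n-th power of the inverse is the L2 limit of the Neumann series of D^n. *)
Lemma inverse_power_moment n :
  rtr (y ^+ n) = \int[sigma]_(u in setT) ((D.[clamp L u])^-1) ^+ n.
Proof.
have K0 : 0 < K by have /andP[h1 h2] := hD 0; apply: lt_le_trans dl0 (le_trans h1 h2).
have dK : dl <= K by have /andP[h1 h2] := hD 0; exact: le_trans h2.
pose q := dl / K; have q0 : 0 < q by rewrite divr_gt0.
have q1 : q <= 1 by rewrite ler_pdivrMr // mul1r.
pose rho := 1 - q ^+ n.
have rho0 : 0 <= rho by rewrite subr_ge0 exprn_ile1 // ltW.
have rho1 : rho < 1 by rewrite /rho ltrBlDr ltrDl exprn_gt0.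
(* On the support [r] lies in [[0, rho]] with [rho < 1], and [s m] is the truncated geometric series
   for the inverse of [D^n]. *)
pose r : {poly R} := 1 - (K^-1 *: D) ^+ n.
pose s m : {poly R} := K^-1 ^+ n *: \sum_(i < m) r ^+ i.
have Ds m : D ^+ n * s m = 1 - r ^+ m.
  rewrite /s -scalerAr scalerAl -exprZn.
  have -> : (K^-1 *: D) ^+ n = 1 - r by rewrite /r subKr.
  by apply: oppr_inj; rewrite -mulNr !opprB subrX1.
have rE u : 0 <= r.[clamp L u] <= rho.
  rewrite /r hornerD hornerN horner_exp hornerZ hornerC.
  have /andP[h1 h2] := hD u.
  have h3 : q <= K^-1 * D.[clamp L u] by rewrite /q mulrC ler_pM2l ?invr_gt0.
  have h4 : K^-1 * D.[clamp L u] <= 1 by rewrite mulrC ler_pdivrMr // mul1r.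
  have h0 : 0 <= K^-1 * D.[clamp L u] := le_trans (ltW q0) h3.
  rewrite subr_ge0 exprn_ile1 //= lerD2l lerN2; apply: lerXn2r => //; rewrite nnegrE //; exact: ltW.
have rmE m u : `|(r ^+ m).[clamp L u]| <= rho ^+ m.
  have /andP[h1 h2] := rE u; rewrite horner_exp ger0_norm ?exprn_ge0 //.
  by apply: lerXn2r.
have mr m : measurable_fun setT (fun u : T => (r ^+ m).[clamp L u]).
  apply: continuous_measurable_fun => u.
  by apply: (@continuous_comp _ _ _ (clamp L) (horner (r ^+ m))); [exact: continuous_clamp|exact: continuous_horner].
have cmm : GRing.comm y (peval D x) by rewrite /GRing.comm yD Dy.
have ynD : y ^+ n * peval (D ^+ n) x = 1.
  by rewrite pevalXn -exprMn_comm // yD expr1n.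
pose N := n2 (star (y ^+ n)).
have N0 : 0 <= N := n2_ge0 _.
have hA m : `|rtr (y ^+ n) - rtr (peval (s m) x)| <= (N + 1) * rho ^+ m.
  have -> : rtr (y ^+ n) - rtr (peval (s m) x) = ip (star (y ^+ n)) (peval (r ^+ m) x).
    rewrite /ip starK -rtrB; congr rtr.
    have -> : r ^+ m = 1 - D ^+ n * s m by rewrite Ds subKr.
    by rewrite pevalB peval1 pevalM mulrBr mulr1 mulrA ynD mul1r.
  have h0 : 0 <= (N + 1) * rho ^+ m by rewrite mulr_ge0 ?exprn_ge0 //; lra.
  rewrite -ler_sqr ?nnegrE // real_normK ?num_real //.
  apply: (le_trans (ip_cs _ _)); rewrite -/N exprMn.
  apply: ler_pM => //; [exact: n2_ge0|nra|].
  rewrite n2_peval; apply: le_trans (ler_norm _) _; apply: le_Rintegral_cst.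
    by apply: measurable_funX; exact: mr.
  by move=> u; rewrite normrX; apply: lerXn2r; rewrite ?nnegrE ?exprn_ge0.
have hB m : `|\int[sigma]_(u in setT) ((D.[clamp L u])^-1) ^+ n - rtr (peval (s m) x)| <=
    dl^-1 ^+ n * rho ^+ m.
  have [_ ->] := spectral_peval (s m) hsigma.
  rewrite (Rintegral_clamp sigma0 (h := horner (s m))); last exact: continuous_horner.
  have sE u : (s m).[clamp L u] = (D.[clamp L u])^-1 ^+ n - (D.[clamp L u])^-1 ^+ n * (r ^+ m).[clamp L u].
    have /(congr1 (fun p => p.[clamp L u])) := Ds m.
    rewrite hornerM horner_exp hornerD hornerC hornerN => h.
    apply: (mulfI (_ : D.[clamp L u] ^+ n != 0)); first by rewrite expf_neq0 // gt_eqF.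
    by rewrite h mulrBr mulrA -exprMn mulfV ?gt_eqF // expr1n mul1r.
  have ms : measurable_fun setT (fun u : T => (D.[clamp L u])^-1 ^+ n * (r ^+ m).[clamp L u]).
    by apply: measurable_funM => //; exact: measurable_inv_clamp.
  have sb u : `|(D.[clamp L u])^-1 ^+ n * (r ^+ m).[clamp L u]| <= dl^-1 ^+ n * rho ^+ m.
    by rewrite normrM ler_pM // inv_clampX_le.
  have ig := integrable_inv_clamp n; have i_s := bounded_integrable sigma ms sb.
  under [X in _ - X]eq_Rintegral do rewrite sE.
  rewrite RintegralB // subKr; exact: le_Rintegral_cst.
apply/eqP; rewrite -subr_eq0 -normr_le0; apply/ler_addgt0Pl => e e0; rewrite addr0.
pose C := N + 1 + dl^-1 ^+ n.
have C0 : 0 < C by have := exprn_ge0 n (ltW (_ : 0 < dl^-1)); rewrite invr_gt0 => /(_ dl0); rewrite /C; lra.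
have [m hm] := geometric_small rho0 rho1 (divr_gt0 e0 C0).
have {}hm := hm m (leqnn m); rewrite ler_pdivlMr // in hm.
set a1 := rtr _ in hA *; set b1 := Rintegral _ _ _ in hB *; have {}hA := hA m; have {}hB := hB m.
have -> : a1 - b1 = (a1 - rtr (peval (s m) x)) - (b1 - rtr (peval (s m) x)) by ring.
apply: (le_trans (ler_normB _ _)); apply: le_trans hm; rewrite /C; lra.
Qed.

(** The image of [sigma] under [u |-> a / D(u)]; composing with [clamp] keeps this map continuous
    and bounded on the whole line. *)
Lemma inverse_law a : star y = y -> exists mu : probability T R,
  spectral_distribution (oper (a%:C *: y)) mu /\
  forall B : set T, mu B = sigma [set u | B (a / D.[clamp L u])].
Proof.
move=> sy; pose f (u : T) : T := a / D.[clamp L u].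
have cf : continuous (f : R -> R).
  by move=> u; apply: cvgM; [exact: cvg_cst|exact: continuous_inv_clamp].
have mf : measurable_fun setT f by exact: continuous_measurable_fun.
pose F : {mfun T >-> T} := HB.pack f (isMeasurableFun.Build _ _ _ _ f mf).
exists (distribution sigma F); split => //.
split; first exact: operP.
  by move=> u v; rewrite starP starZr sy.
move=> n.
have mfn : measurable_fun setT (fun u : T => f u ^+ n) by exact: measurable_funX.
have fb u : `|f u ^+ n| <= (`|a| * dl^-1) ^+ n.
  rewrite normrX; apply: lerXn2r; rewrite ?nnegrE ?mulr_ge0 ?invr_ge0 //; first exact: ltW.
  by rewrite normrM ler_pM // inv_clamp_le.
have ifn := bounded_integrable sigma mfn fb.
have mX : measurable_fun setT (fun u : T => (u ^+ n)%:E).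
  by apply/measurable_EFinP; exact: exprn_measurable.
split.
  exact: (@integrable_pushforward _ _ T T R F mf sigma setT (fun v => (v ^+ n)%:E) mX ifn measurableT).
rewrite -oper_expr -/(tr _) tr_sa; last by rewrite starX starZr sy.
congr _%:C; rewrite exprZn -rmorphXn rtrZ inverse_power_moment.
rewrite /Rintegral (integral_distribution (X := F)) //=.
rewrite -RintegralZl //; last exact: integrable_inv_clamp.
by apply: eq_Rintegral => u _; rewrite /f exprMn.
Qed.

End inverse_law.

(** * The law of the solution and its support *)

Section solution_law.
Context {R : realType} {A : wprob_space R}.
Local Notation M := (walg A).
Local Notation T := (measurableTypeR R).
Variable W : R -> op A.
Hypothesis hW : free_brownian_motion W.
Local Notation w := (bm W).

Lemma bm_law (t : R) : 0 < t -> exists sigma : probability T R,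
  [/\ spectral_distribution (oper (w t)) sigma, has_density (semicircle_density t) sigma
    & sigma (~` [set u | - (2 * Num.sqrt t) <= u <= 2 * Num.sqrt t]) = 0%E].
Proof.
move=> t0; have := bm_inc_law hW (lexx 0) t0; rewrite (bm0 hW) !subr0.
move=> [[sigma hs] /(_ _ hs) hd]; exists sigma; split => //.
rewrite hd; last first.
  apply: measurableC; rewrite [X in measurable X](_ : _ = `[- (2 * Num.sqrt t), 2 * Num.sqrt t]%classic).
    exact: measurable_itv.
  by apply/seteqP; split => v /=; rewrite in_itv.
apply: integral0_eq => u /= hu; congr _%:E.
by apply: semicircle_density_out => //; exact: ltW.
Qed.

(** The law of increments covers positive lengths only; at time 0 the operator is 0 and its law the
    point mass. *)
Lemma bm_law0 : exists sigma : probability T R,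
  spectral_distribution (oper (w 0)) sigma /\ sigma (~` [set u | - (2 * Num.sqrt 0) <= u <= 2 * Num.sqrt 0]) = 0%E.
Proof.
exists (dirac (0 : T)); split; last first.
  by rewrite /= diracE memNset //= => h; apply: h; rewrite sqrtr0 mulr0 oppr0 lexx.
rewrite (bm0 hW); split; first exact: operP.
  by move=> u v; rewrite starP star0.
have mX n : measurable_fun setT (fun u : T => (u ^+ n)%:E).
  by apply/measurable_EFinP; exact: exprn_measurable.
move=> n; split.
  apply/integrableP; split; first exact: mX.
  rewrite integral_dirac //; last by apply: measurableT_comp.
  by rewrite diracT mul1e ltry.
rewrite -oper_expr -/(tr _) tr_sa; last by rewrite starX star0.
rewrite /Rintegral (integral_dirac _ measurableT (mX n)).
rewrite diracT mul1e /=; congr _%:C.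
by case: n => [|n]; rewrite ?expr0 ?rtr1 // exprS mul0r rtr0 exprS mul0r.
Qed.

Definition den_poly (b t : R) : {poly R} := (1 + b ^+ 2 * t)%:P - b *: 'X.

Lemma den_polyE (b t u : R) : (den_poly b t).[u] = 1 + b ^+ 2 * t - b * u.
Proof. by rewrite /den_poly !hornerE. Qed.

Lemma peval_den_poly (b t : R) : peval (den_poly b t) (w t) = den W b t.
Proof. by rewrite /den_poly /den pevalB pevalC pevalZ pevalX. Qed.

Lemma scaled_clamp (b t u : R) : 0 <= t ->
  `|b * clamp (2 * Num.sqrt t) u| <= 2 * (`|b| * Num.sqrt t).
Proof.
move=> t0; rewrite normrM mulrCA ler_wpM2l // ler_norml.
by apply: clamp_itv; rewrite mulr_ge0 // sqrtr_ge0.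
Qed.

Lemma den_poly_itv (b t u : R) : 0 <= t ->
  (1 - `|b| * Num.sqrt t) ^+ 2 <= (den_poly b t).[clamp (2 * Num.sqrt t) u]
   <= (1 + `|b| * Num.sqrt t) ^+ 2.
Proof.
move=> t0; have := scaled_clamp b u t0; rewrite ler_norml den_polyE => /andP[h1 h2].
have e : b ^+ 2 * t = (`|b| * Num.sqrt t) ^+ 2 by rewrite exprMn real_normK ?num_real // sqr_sqrtr.
by rewrite e; apply/andP; split; lra.
Qed.

Lemma solution_law (k a t : R) (sigma : probability T R) : 0 <= t -> (a * k) ^+ 2 * t < 1 ->
  spectral_distribution (oper (w t)) sigma ->
  sigma (~` [set u | - (2 * Num.sqrt t) <= u <= 2 * Num.sqrt t]) = 0%E ->
  forall b : R, exists mu : probability T R,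
  spectral_distribution (oper (b%:C *: res W (a * k) t)) mu /\
  forall B : set T, mu B = sigma [set u | B (b / (den_poly (a * k) t).[clamp (2 * Num.sqrt t) u])].
Proof.
move=> t0 h hs s0 b.
have [q [q0 q1 hq]] := sqrt_half_sum (mulr_ge0 (sqr_ge0 (a * k)) t0) h.
have [_ [yD Dy sy _ _] _ _ _] := res_facts hW t0 q0 q1 hq.
have e : (a * k) ^+ 2 * t = (`|a * k| * Num.sqrt t) ^+ 2.
  by rewrite [RHS]exprMn real_normK ?num_real // sqr_sqrtr.
have r0 : 0 <= `|a * k| * Num.sqrt t by rewrite mulr_ge0 // sqrtr_ge0.
have r1 : `|a * k| * Num.sqrt t < 1.
  by move: h; rewrite e => h; rewrite -(ltr_sqr (_ : _ \is Num.nneg)) ?nnegrE ?expr1n.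
apply: (inverse_law (D := den_poly (a * k) t) (sigma := sigma) (x := w t)
  (dl := (1 - `|a * k| * Num.sqrt t) ^+ 2) (K := (1 + `|a * k| * Num.sqrt t) ^+ 2)) => //.
- exact: bm_sa.
- by rewrite peval_den_poly.
- by rewrite peval_den_poly.
- by rewrite exprn_gt0 // subr_gt0.
- by move=> u; exact: den_poly_itv.
Qed.

(** Symmetric in [p] and [q], which avoids deciding which endpoint of the spectral interval is the
    larger one. *)
Lemma between (p q f : R) : 0 <= (p - f) * (f - q) -> Num.min p q <= f <= Num.max p q.
Proof.
move=> h; have [pq|qp] := leP p q.
  by apply/andP; split; nra.
by apply/andP; split; nra.
Qed.

(** With [s = a k sqrt t] the endpoints simplify to [a / (1 + s)^2] and [a / (1 - s)^2], the values
    at the two ends of the semicircle. The product in [between] then has the sign of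
    [(2 s)^2 - v^2]. *)
Lemma inverse_in_interval (k a t u : R) : 0 <= t -> (a * k) ^+ 2 * t < 1 ->
  spectral_interval a k t (a / (den_poly (a * k) t).[clamp (2 * Num.sqrt t) u]).
Proof.
move=> t0 h; apply: between.
set s := a * k * Num.sqrt t.
have s2 : (a * k) ^+ 2 * t = s ^+ 2 by rewrite [RHS]exprMn sqr_sqrtr.
have hs : `|s| = `|a * k| * Num.sqrt t by rewrite normrM (ger0_norm (sqrtr_ge0 t)).
have s1 : `|s| < 1.
  by move: h; rewrite s2 -real_normK ?num_real // => h; rewrite -(ltr_sqr (_ : _ \is Num.nneg)) ?nnegrE ?expr1n.
move: s1; rewrite ltr_norml => /andP[s1 s1'].
have p0 : 1 + s != 0 by rewrite gt_eqF //; lra.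
have m0 : 1 - s != 0 by rewrite gt_eqF //; lra.
have := scaled_clamp (a * k) u t0; rewrite -hs => hc.
have {}hc : (a * k * clamp (2 * Num.sqrt t) u) ^+ 2 <= (2 * s) ^+ 2.
  rewrite -real_normK ?num_real // -[leRHS]real_normK ?num_real // [`|2 * s|]normrM (ger0_norm (ler0n R 2)).
  by apply: lerXn2r; rewrite ?nnegrE // mulr_ge0.
have : (1 - `|a * k| * Num.sqrt t) ^+ 2 <= (den_poly (a * k) t).[clamp (2 * Num.sqrt t) u].
  by have /andP[] := den_poly_itv (a * k) u t0.
rewrite -hs => hD.
have D0 : 0 < (den_poly (a * k) t).[clamp (2 * Num.sqrt t) u].
  apply: lt_le_trans hD; rewrite exprn_gt0 // subr_gt0 ltr_norml; apply/andP; split; lra.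
rewrite den_polyE s2 in D0 *; set v := a * k * _ in hc D0 *.
rewrite /endpoint_minus /endpoint_plus -exprMn s2 -/s (_ : 1 - s ^+ 2 = (1 - s) * (1 + s)); last by ring.
have -> : a * ((1 - s) ^+ 2 / ((1 - s) * (1 + s)) ^+ 2) = a / (1 + s) ^+ 2.
  by field; rewrite p0 m0.
have -> : a * ((1 + s) ^+ 2 / ((1 - s) * (1 + s)) ^+ 2) = a / (1 - s) ^+ 2.
  by field; rewrite p0 m0.
have -> : (a / (1 + s) ^+ 2 - a / (1 + s ^+ 2 - v)) * (a / (1 + s ^+ 2 - v) - a / (1 - s) ^+ 2) =
  a ^+ 2 * ((2 * s) ^+ 2 - v ^+ 2) / ((1 + s) * (1 - s) * (1 + s ^+ 2 - v)) ^+ 2.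
  by field; rewrite p0 m0 gt_eqF.
by rewrite divr_ge0 ?sqr_ge0 // mulr_ge0 ?sqr_ge0 // subr_ge0.
Qed.

Lemma solution_support (k a t : R) : 0 <= t -> (a * k) ^+ 2 * t < 1 ->
  spectral_law (oper (solution W k a t)) (fun mu => mu (~` spectral_interval a k t) = 0%E).
Proof.
move=> t0 h.
have [sigma [hs s0]] : exists sigma : probability T R,
   spectral_distribution (oper (w t)) sigma /\
   sigma (~` [set u | - (2 * Num.sqrt t) <= u <= 2 * Num.sqrt t]) = 0%E.
  move: t0; rewrite le_eqVlt => /predU1P[<-|/bm_law[sigma [h1 _ h3]]]; first exact: bm_law0.
  by exists sigma.
have [mu [hmu muE]] := solution_law t0 h hs s0 a.
split; first by exists mu.
move=> nu hnu; rewrite (spectral_distribution_unique hnu hmu) ?muE.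
  rewrite (_ : [set u | _] = set0) ?measure0 //; apply/seteqP; split => // u /= hu.
  by apply: hu; exact: inverse_in_interval.
apply: measurableC; rewrite /spectral_interval; set p := Num.min _ _; set q := Num.max _ _.
rewrite [X in measurable X](_ : _ = `[p, q]%classic); first exact: measurable_itv.
by apply/seteqP; split => v /=; rewrite in_itv.
Qed.

End solution_law.

(** * The density *)

Section density.
Context {R : realType}.
Local Notation T := (measurableTypeR R).
Local Notation leb := (@lebesgue_measure R).
Implicit Types (u p c xi : R).

(** Absorbs the point [p], where open and closed rays differ, and everything off the support of
    [g]. *)
Lemma ae_set_integral (g : T -> R) (B1 B2 : set T) p : measurable_fun setT g ->
  measurable B1 -> measurable B2 ->
  (forall u, u != p -> g u != 0 -> (B1 u <-> B2 u)) ->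
  (\int[leb]_(u in B1) (g u)%:E = \int[leb]_(u in B2) (g u)%:E)%E.
Proof.
move=> mg m1 m2 h; rewrite [LHS]integral_mkcond [RHS]integral_mkcond.
have mr (B : set T) : measurable B -> measurable_fun setT ((fun u => (g u)%:E) \_ B).
  by move=> mB; apply/measurable_restrict => //; rewrite setTI; apply/measurable_EFinP; exact: measurable_funTS.
apply: ae_eq_integral => //; try exact: mr.
exists [set p]; split; [exact: measurable_set1|exact: lebesgue_measure_set1|].
move=> u /= hu; apply: contrapT => up; apply: hu => _.
rewrite !patchE; have [g0|g0] := eqVneq (g u) 0; first by rewrite g0 !if_same.
have [h1 h2] := h u (introN eqP up) g0.
by case: ifPn => [/set_mem/h1 hb|hb]; [rewrite mem_set|rewrite memNset // => /h2 hb'; move: hb; rewrite mem_set].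
Qed.

Variables (tau b : R).
Hypothesis tau01 : 0 < tau < 1.
Hypothesis b0 : 0 < b.
Let s := Num.sqrt tau.
Let t := tau / b ^+ 2.
(** [alpha] and [beta] are the roots of the radicand, the images of the two ends of the semicircle
    law. *)
Let alpha := ((1 + s) ^+ 2)^-1.
Let beta := ((1 - s) ^+ 2)^-1.

Let s2 : s ^+ 2 = tau.
Proof. by rewrite sqr_sqrtr // ltW; case/andP: tau01. Qed.

Let s0 : 0 < s.
Proof. by rewrite sqrtr_gt0; case/andP: tau01. Qed.

Let s1 : s < 1.
Proof. by rewrite -(ltr_sqr (_ : s \is Num.nneg)) ?nnegrE ?(ltW s0) // s2 expr1n; case/andP: tau01. Qed.

Let alpha0 : 0 < alpha.
Proof. by rewrite invr_gt0 exprn_gt0 //; have := s0; lra. Qed.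

Let alpha_beta : alpha < beta.
Proof.
by rewrite ltf_pV2 ?posrE ?exprn_gt0 //; have := s0; have := s1; nra.
Qed.

Definition radicand xi := - (1 - tau) ^+ 2 * xi ^+ 2 + 2 * (1 + tau) * xi - 1.

Lemma radicandE xi : radicand xi = (xi - alpha) * (beta - xi) / (alpha * beta).
Proof.
rewrite /radicand -s2 /alpha /beta; field.
by rewrite !gt_eqF //; have := s0; have := s1; lra.
Qed.

Lemma radicand_le0 xi : ~ (alpha < xi < beta) -> radicand xi <= 0.
Proof.
move=> h; rewrite radicandE.
have h0 : 0 < (alpha * beta)^-1 by rewrite invr_gt0 mulr_gt0 // (lt_trans alpha0 alpha_beta).
rewrite pmulr_lle0 //.
have [h1|h1] := leP xi alpha.
  by rewrite mulr_le0_ge0 ?subr_le0 // subr_ge0 ltW // (le_lt_trans h1).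
have [h2|h2] := leP beta xi.
  by rewrite mulr_ge0_le0 ?subr_le0 // subr_ge0 ltW.
by exfalso; apply: h; rewrite h1.
Qed.

Lemma spectral_density_out xi : ~ (alpha < xi < beta) -> spectral_density tau xi = 0.
Proof. by move=> /radicand_le0 h; rewrite /spectral_density ler0_sqrtr ?mul0r. Qed.

Lemma spectral_density_ge0 xi : 0 <= spectral_density tau xi.
Proof.
have [h|/spectral_density_out -> //] := pselect (alpha < xi < beta).
have /andP[t0 _] := tau01; have x0 : 0 < xi by case/andP: h => h _; exact: lt_trans h.
apply: divr_ge0; first exact: sqrtr_ge0.
apply: mulr_ge0; last exact: ltW.
by apply: mulr_ge0; [rewrite mulr_ge0 // pi_ge0|rewrite exprn_ge0 // ltW].
Qed.

(** The denominator vanishes at 0. Replacing [xi] there by its maximum with [alpha] changes nothing,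
    the square root being 0 below [alpha], and makes the function continuous. *)
Lemma measurable_spectral_density : measurable_fun setT (spectral_density tau : T -> R).
Proof.
have -> : spectral_density tau = fun xi => Num.sqrt (radicand xi) * (2 * pi * (Num.max xi alpha) ^+ 3 * tau)^-1.
  apply/funext => xi; rewrite /spectral_density -/(radicand xi).
  have [h|h] := leP xi alpha; last by [].
  by rewrite ler0_sqrtr ?mul0r // radicand_le0 // => /andP[h1 _]; move: h1; rewrite ltNge h.
apply: continuous_measurable_fun => xi; apply: cvgM.
  apply: (continuous_sqrt_comp (h := radicand)) => z.
  have -> : radicand = horner (- ((1 - tau) ^+ 2)%:P * 'X ^+ 2 + (2 * (1 + tau))%:P * 'X - 1).
    by apply/funext => y; rewrite /radicand !hornerE; ring.
  exact: continuous_horner.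
have m0 : 0 < Num.max xi alpha by rewrite lt_max alpha0 orbT.
apply: cvgV.
  have /andP[t0 _] := tau01.
  by rewrite gt_eqF // mulr_gt0 // mulr_gt0 ?exprn_gt0 // mulr_gt0 // pi_gt0.
apply: cvgMr_tmp; apply: cvgMl_tmp.
apply: (@continuous_comp _ _ _ (fun y => Num.max y alpha) (fun y => y ^+ 3)); last exact: exprn_continuous.
by apply: (@continuous_max _ _ id (fun=> alpha)); [move=> ?; exact: cvg_id|exact: cst_continuous].
Qed.

Definition spectral_measure (B : set T) : \bar R := (\int[leb]_(xi in B) (spectral_density tau xi)%:E)%E.

Let spectral_measure0 : spectral_measure set0 = 0%E.
Proof. exact: integral_set0. Qed.

Let spectral_measure_ge0 B : (0 <= spectral_measure B)%E.
Proof. by apply: integral_ge0 => xi _; rewrite lee_fin spectral_density_ge0. Qed.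

Let spectral_measure_additive : semi_sigma_additive spectral_measure.
Proof.
move=> F mF tF mUF; rewrite /spectral_measure ge0_integral_bigcup //.
- apply: is_cvg_ereal_nneg_natsum_cond => n _ _; exact: spectral_measure_ge0.
- by apply/measurable_EFinP; apply: measurable_funTS; exact: measurable_spectral_density.
- by move=> xi _; rewrite lee_fin spectral_density_ge0.
Qed.

(** Total mass 1 is not known here; it comes out of the comparison on rays. *)
Lemma spectral_measure_measure : exists nu : {measure set T -> \bar R}, forall B, nu B = spectral_measure B.
Proof.
by exists (HB.pack spectral_measure (isMeasure.Build _ _ _ spectral_measure
  spectral_measure0 spectral_measure_ge0 spectral_measure_additive) : {measure set T -> \bar R}).
Qed.

Definition change xi := (1 + tau - xi^-1) / b.

Lemma is_derive_change xi : xi != 0 -> is_derive xi 1 change (xi ^- 2 / b).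
Proof.
move=> x0; have hV := is_deriveV x0 (is_derive_id xi 1).
have h := is_deriveM (is_deriveB (is_derive_cst (1 + tau) xi 1) hV) (is_derive_cst b^-1 xi 1).
have -> : change = (cst (1 + tau) - (fun y => y^-1)) * cst b^-1 by apply/funext.
apply: (is_derive_eq h).
rewrite /GRing.scale /= mulr0 add0r sub0r mulr1 /cst mulrC; congr (_ * _).
by rewrite opprK.
Qed.

Lemma change_deriveE xi : xi != 0 -> (derive1 change) xi = xi ^- 2 / b.
Proof. by move=> /is_derive_change h; rewrite derive1E; exact: derive_val. Qed.

Lemma change_continuous xi : xi != 0 -> {for xi, continuous change}.
Proof.
move=> /is_derive_change h; apply: differentiable_continuous; apply/derivable1_diffP.
exact: ex_derive.
Qed.

Lemma change_derive_continuous xi : 0 < xi -> {for xi, continuous (derive1 change)}.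
Proof.
move=> x0; have xn : xi != 0 by rewrite gt_eqF.
have c1 : {for xi, continuous (fun y : R => y ^- 2 / b)}.
  apply: cvgMr_tmp; apply: cvgV; first by rewrite expf_neq0.
  exact: exprn_continuous.
have : derive1 change y @[y --> xi] --> xi ^- 2 / b.
  apply: cvg_trans c1; apply: near_eq_cvg; near=> y.
  rewrite change_deriveE // gt_eqF //.
  by near: y; exact: lt_nbhsr.
by rewrite -(change_deriveE xn).
Unshelve. all: by end_near. Qed.

Lemma change_beta : change beta = 2 * Num.sqrt t.
Proof.
have /andP[t0 _] := tau01.
rewrite /change /t sqrtrM ?ltW // -exprVn sqrtr_sqr ger0_norm ?invr_ge0 ?ltW // -/s /beta invrK -s2.
by rewrite mulrA; congr (_ * _); ring.
Qed.

(** The semicircle radicand becomes [(b xi)^-2] times [radicand xi], which contributes one factor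
    [xi^-1]; the Jacobian contributes two more, whence the cube. *)
Lemma density_change xi : 0 < xi ->
  semicircle_density t (change xi) * (xi ^- 2 / b) = spectral_density tau xi.
Proof.
move=> x0; have /andP[t0 _] := tau01.
have bn : b != 0 by rewrite gt_eqF. have xn : xi != 0 by rewrite gt_eqF.
have tn : tau != 0 by rewrite gt_eqF.
have pn : pi != 0 :> R by rewrite gt_eqF // pi_gt0.
rewrite /semicircle_density /spectral_density -/(radicand xi).
have -> : 4 * t - change xi ^+ 2 = (b * xi)^-1 ^+ 2 * radicand xi.
  rewrite /t /change /radicand; field; by rewrite bn xn.
rewrite sqrtrM ?sqr_ge0 // sqrtr_sqr ger0_norm; last by rewrite invr_ge0 mulr_ge0 // ltW.
by rewrite /t; move: (pi : R) pn => P pn; field; rewrite bn xn tn pn.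
Qed.

Lemma semicircle_tail c : alpha <= c -> c <= beta ->
  (\int[leb]_(u in `[change c, (2 * Num.sqrt t)%R]) (semicircle_density t u)%:E =
   \int[leb]_(xi in `[c, beta]) (spectral_density tau xi)%:E)%E.
Proof.
move=> ac cb; have c0 : 0 < c := lt_le_trans alpha0 ac.
have be0 : 0 < beta := lt_le_trans c0 cb.
have pos xi : c <= xi -> 0 < xi by exact: lt_le_trans.
rewrite -change_beta (integration_by_substitution_increasing cb).
- apply: eq_integral => xi; rewrite inE /= in_itv /= => /andP[h1 _].
  by rewrite -(density_change (pos _ h1)) -[in RHS]change_deriveE // gt_eqF // pos.
- move=> x y; rewrite !in_itv /= => /andP[x1 _] /andP[y1 _] xy.
  rewrite ltr_pM2r ?invr_gt0 // ltrD2l ltrN2 ltf_pV2 ?posrE ?pos //.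
- move=> x; rewrite in_itv /= => /andP[x1 _]; apply: change_derive_continuous; exact: lt_trans x1.
- apply/cvg_ex; exists ((derive1 change) c); apply: cvg_at_right_filter; exact: change_derive_continuous.
- apply/cvg_ex; exists ((derive1 change) beta); apply: cvg_at_left_filter; exact: change_derive_continuous.
- split.
  + move=> x; rewrite in_itv /= => /andP[x1 _].
    have /is_derive_change h : x != 0 by rewrite gt_eqF // (lt_trans c0).
    exact: ex_derive.
  + by apply: cvg_at_right_filter; apply: change_continuous; rewrite gt_eqF.
  + by apply: cvg_at_left_filter; apply: change_continuous; rewrite gt_eqF.
- by apply: continuous_subspaceT; exact: continuous_semicircle.
Qed.

(** Moves the start of a ray into [[alpha, beta]], where the substitution is available, without
    changing its mass. *)
Let cut c := Num.max alpha (Num.min c beta).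

Lemma cut_itv c : alpha <= cut c <= beta.
Proof.
rewrite /cut le_max lexx /= ge_max ge_min lexx orbT andbT; exact: ltW.
Qed.

Lemma cut_lt c xi : alpha < xi < beta -> (c < xi) = (cut c < xi).
Proof. by case/andP=> h1 h2; rewrite /cut gt_max gt_min h1 /= [beta < xi]ltNge (ltW h2) orbF. Qed.

Lemma spectral_measure_tail c :
  spectral_measure `]c, +oo[%classic = (\int[leb]_(xi in `[cut c, beta]) (spectral_density tau xi)%:E)%E.
Proof.
apply: (@ae_set_integral _ _ _ (cut c)) => //; first exact: measurable_spectral_density.
move=> xi xc d0; have h : alpha < xi < beta.
  by apply: contrapT => /spectral_density_out h; move: d0; rewrite h eqxx.
rewrite /= !in_itv /= andbT (cut_lt c h) le_eqVlt eq_sym (negbTE xc) /=.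
have /andP[_ h2] := h.
by split=> [->|/andP[]//]; rewrite /= ltW.
Qed.

Lemma change_lt c u : 0 < c -> 0 < 1 + tau - b * u -> (change c < u) = (c < (1 + tau - b * u)^-1).
Proof.
move=> c0 d0; rewrite /change ltr_pdivrMr // -[c in RHS]invrK ltf_pV2 ?posrE ?invr_gt0 //.
by apply/idP/idP; lra.
Qed.

Lemma semicircle_support u : semicircle_density t u != 0 -> (b * u) ^+ 2 < (2 * s) ^+ 2.
Proof.
move=> h; rewrite ltNge; apply/negP => h2; move/eqP: h; apply.
have b2 : 0 < b ^+ 2 by rewrite exprn_gt0.
rewrite /semicircle_density ler0_sqrtr ?mul0r // subr_le0 /t mulrA ler_pdivrMr //.
by move: h2; rewrite !exprMn s2; lra.
Qed.

Lemma den_inv_itv v : v ^+ 2 < (2 * s) ^+ 2 ->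
  0 < 1 + tau - v /\ alpha < (1 + tau - v)^-1 < beta.
Proof.
have ss := s0; have ss1 := s1; rewrite -[v ^+ 2]real_normK ?num_real // ltr_sqr ?nnegrE; last by lra.
  rewrite ltr_norml => /andP[h1 h2].
  have h3 : (1 - s) ^+ 2 < 1 + tau - v by rewrite -s2; lra.
  have h4 : 1 + tau - v < (1 + s) ^+ 2 by rewrite -s2; lra.
  have h0 : 0 < (1 - s) ^+ 2 by rewrite exprn_gt0 // subr_gt0.
  have d0 := lt_trans h0 h3; split=> //.
  by rewrite !ltf_pV2 ?posrE ?h4 ?h3 // exprn_gt0 //; lra.
by [].
Qed.

Lemma change_le c : alpha <= c -> c <= beta -> change c <= 2 * Num.sqrt t.
Proof.
move=> ac cb; rewrite -change_beta ler_pM2r ?invr_gt0 // lerD2l lerN2 lef_pV2 ?posrE //.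
  exact: lt_le_trans alpha0 (le_trans ac cb).
exact: lt_le_trans alpha0 ac.
Qed.

(* The two signs of e reduce to each other since the semicircle law is symmetric. *)
Lemma semicircle_pushforward_tail (sigma : probability T R) (e c : R) : e ^+ 2 = 1 ->
  measurable [set u : T | c < (den_poly (e * b) t).[clamp (2 * Num.sqrt t) u]^-1] ->
  has_density (semicircle_density t) sigma ->
  sigma [set u | c < (den_poly (e * b) t).[clamp (2 * Num.sqrt t) u]^-1] =
  spectral_measure `]c, +oo[%classic.
Proof.
move=> e1 mB hs; rewrite hs // spectral_measure_tail.
have /andP[ac cb] := cut_itv c.
rewrite -semicircle_tail //; set p := change (cut c).
have msc : measurable_fun setT (semicircle_density t : T -> R).
  by apply: continuous_measurable_fun; exact: continuous_semicircle.
have pL : p <= 2 * Num.sqrt t := change_le ac cb.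
have bt : (e * b) ^+ 2 * t = tau.
  by rewrite exprMn e1 mul1r /t mulrC divfK // gt_eqF // exprn_gt0.
have L0 : 0 <= 2 * Num.sqrt t by rewrite mulr_ge0 // sqrtr_ge0.
have key u : semicircle_density t u != 0 ->
   (c < (den_poly (e * b) t).[clamp (2 * Num.sqrt t) u]^-1) = (p < e * u) /\ `|u| < 2 * Num.sqrt t.
  move=> /semicircle_support hu.
  have bu : `|u| < 2 * Num.sqrt t.
    rewrite -change_beta /change ltr_pdivlMr // /beta invrK.
    have -> : 1 + tau - (1 - s) ^+ 2 = 2 * s by rewrite -s2; ring.
    have ss := s0; rewrite -ltr_sqr ?nnegrE ?mulr_ge0 ?(ltW b0) ?(ltW ss) //.
    by rewrite exprMn real_normK ?num_real // mulrC -exprMn.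
  split=> //; rewrite clampE; last by rewrite -ler_norml ltW.
  rewrite den_polyE bt.
  have hv : (e * b * u) ^+ 2 < (2 * s) ^+ 2.
    by rewrite -mulrA exprMn e1 mul1r.
  have [d0 dab] := den_inv_itv hv.
  rewrite (cut_lt c dab) /p change_lt ?(lt_le_trans alpha0 ac) //.
    by rewrite mulrA [b * e]mulrC.
  by rewrite mulrA [b * e]mulrC.
have /orP[/eqP ee|/eqP ee] : (e == 1) || (e == -1) by rewrite -sqrf_eq1 e1.
  apply: (@ae_set_integral _ _ _ p) => // u up /key[h1 h2].
  move: h2; rewrite ltr_norml => /andP[_ h2].
  rewrite /= h1 ee mul1r in_itv /= (ltW h2) andbT le_eqVlt eq_sym (negbTE up); by [].
have sym u : semicircle_density t (- u) = semicircle_density t u.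
  by rewrite /semicircle_density sqrrN.
have -> : (\int[leb]_(u in `[p, (2 * Num.sqrt t)%R]) (semicircle_density t u)%:E =
  \int[leb]_(u in `[(- (2 * Num.sqrt t))%R, (- p)%R]) (semicircle_density t u)%:E)%E.
  rewrite integration_by_substitution_oppr //.
    by apply: eq_integral => u _; rewrite /= sym.
  by apply: continuous_subspaceT; exact: continuous_semicircle.
apply: (@ae_set_integral _ _ _ (- p)) => // u up /key[h1 h2].
move: h2; rewrite ltr_norml => /andP[h2 _].
by rewrite /= h1 ee mulN1r in_itv /= (ltW h2) /= [u <= - p]le_eqVlt (negbTE up) /= ltrNr.
Qed.

End density.

Section density_law.
Context {R : realType} {A : wprob_space R}.
Local Notation M := (walg A).
Local Notation T := (measurableTypeR R).
Variable W : R -> op A.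
Hypothesis hW : free_brownian_motion W.

(** The law and the measure with the claimed density are compared on rays, with [b = |a k|] and the
    sign of [a k] as the parameter [e]. *)
Lemma solution_density (k a tau : R) : a * k != 0 -> 0 < tau < 1 ->
  spectral_law (oper (1%:C *: res W (a * k) ((a * k) ^- 2 * tau) : M))
    (has_density (spectral_density tau)).
Proof.
move=> ak0 tau01; have /andP[tau0 tau1] := tau01.
set t := (a * k) ^- 2 * tau.
have ak2 : 0 < (a * k) ^+ 2 by rewrite exprn_even_gt0.
have t0 : 0 < t by rewrite mulr_gt0 // invr_gt0.
have tE : (a * k) ^+ 2 * t = tau by rewrite /t mulrA mulfV ?mul1r // gt_eqF.
have [sigma [hs hd s0]] := bm_law hW t0.
have t1 : (a * k) ^+ 2 * t < 1 by rewrite tE.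
have [mu [hmu muE]] := solution_law hW (ltW t0) t1 hs s0 1.
split; first by exists mu.
move=> nu hnu B mB; rewrite (spectral_distribution_unique hnu hmu mB).
have b0 : 0 < `|a * k| by rewrite normr_gt0.
have [rho hrho] := spectral_measure_measure tau01.
rewrite -/(spectral_measure tau B) -hrho; apply: measure_unique_rays mB => c.
rewrite muE hrho.
have tb : t = tau / `|a * k| ^+ 2 by rewrite real_normK ?num_real // mulrC.
have eb : a * k = Num.sg (a * k) * `|a * k| by exact: numEsg.
have e1 : Num.sg (a * k) ^+ 2 = 1 by rewrite sqr_sg ak0.
have -> : [set u | `]c, +oo[%classic (1 / (den_poly (a * k) t).[clamp (2 * Num.sqrt t) u])] =
  [set u : T | c < (den_poly (a * k) t).[clamp (2 * Num.sqrt t) u]^-1].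
  by apply/seteqP; split => u /=; rewrite in_itv /= andbT mul1r.
have tail := @semicircle_pushforward_tail R tau `|a * k| tau01 b0 sigma (Num.sg (a * k)) c e1.
rewrite -eb -tb in tail; apply: tail => //.
have dl0 : 0 < (1 - `|a * k| * Num.sqrt t) ^+ 2.
  rewrite exprn_gt0 // subr_gt0 -(ltr_sqr (_ : _ \is Num.nneg)) ?nnegrE ?expr1n ?mulr_ge0 ?sqrtr_ge0 //.
  by rewrite exprMn real_normK ?num_real // sqr_sqrtr ?ltW.
have cf := continuous_inv_clamp dl0 (fun u => den_poly_itv (a * k) u (ltW t0)).
have mf : measurable_fun setT ((fun u => (den_poly (a * k) t).[clamp (2 * Num.sqrt t) u]^-1) : T -> T).
  exact: continuous_measurable_fun.
have := mf measurableT _ (measurable_itv `]c, +oo[); rewrite setTI.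
by congr measurable; apply/seteqP; split => u /=; rewrite in_itv /= andbT.
Qed.

End density_law.

Theorem proposition3p9 (R : realType) (A : wprob_space R) (W : R -> op A)
    (hW : free_brownian_motion W) (k a : R) :
  (exists X : R -> op A, forall T : R,
     0 <= T -> a ^+ 2 * k ^+ 2 * T < 1 -> solves_sde W k a T X) /\
  (forall (T : R) (X : R -> op A), 0 <= T -> solves_sde W k a T X ->
     (forall t : R, 0 <= t <= T -> a ^+ 2 * k ^+ 2 * t <= 1 ->
        spectral_law (X t) (fun mu => mu (~` spectral_interval a k t) = 0%E))
     /\
     (a * k != 0 -> forall tau : R, 0 < tau < 1 -> (a * k) ^- 2 * tau <= T ->
        spectral_law ((a^-1)%:C *: X ((a * k) ^- 2 * tau))
                     (has_density (spectral_density tau)))).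
Proof.
split.
  by exists (fun t => oper (solution W k a t)) => T T0 h; exact: (solution_sde hW T0 h).
move=> T X T0 /(solves_sdeP hW T0)[hT XE]; split=> [t /andP[t0 tT] _|ak0 tau /andP[tau0 tau1] tT].
  rewrite XE ?t0 //; apply: solution_support => //.
  apply: le_lt_trans hT; rewrite -exprMn; apply: ler_wpM2l => //; exact: sqr_ge0.
have t0 : 0 <= (a * k) ^- 2 * tau by rewrite mulr_ge0 ?invr_ge0 ?sqr_ge0 // ltW.
have a0 : a != 0 by apply: contraNneq ak0 => ->; rewrite mul0r.
rewrite XE ?t0 //.
have -> : (a^-1)%:C *: oper (solution W k a ((a * k) ^- 2 * tau)) =
    oper (1%:C *: res W (a * k) ((a * k) ^- 2 * tau)).
  have <- : (a^-1)%:C *: solution W k a ((a * k) ^- 2 * tau) =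
      1%:C *: res W (a * k) ((a * k) ^- 2 * tau) by rewrite scalerA -rmorphM mulVf.
  by [].
by apply: solution_density => //; rewrite tau0.
Qed.
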